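(* Let $A=\begin{pmatrix}1&1&0\\0&1&1\\1&0&1\end{pmatrix}$, let $\beta>0$, and let $\bar{x}(n)\in\Delta^2$ be the vector of proportions of the three colours at time $n$ in the urn process with matrix $A$ and reinforcement exponent $\beta$. (1) When $\beta<4$ there is positive probability that $\bar{x}(n)\to(1/3,1/3,1/3)$ as $n\to\infty$. (2) When $\beta>4$, almost surely $\bar{x}(n)$ fails to converge, and the limit set of $(\bar{x}(n))_{n}$ is either a periodic orbit or a connected union of periodic orbits of the flow on $\Delta^2$ of the ODE $\dot{x}=F(x)$, where $F$ is the vector field associated with the urn process.
   Context: Urn process. Let $A=(a_{ij})$ be a non-negative $3\times 3$ matrix and $\beta>0$. The process $x(n)=(x_1(n),x_2(n),x_3(n))\in\mathbb{N}^3$ (with $0\in\mathbb{N}$), $n=0,1,2,\dots$, counts the balls of each of three colours in an urn. It starts from a fixed $x(0)$ with $n_0:=x_1(0)+x_2(0)+x_3(0)>0$. Let $\mathcal{F}_n$ be the $\sigma$-algebra generated by $x(0),\dots,x(n)$, let $x^\beta(n)$ be the coordinatewise $\beta$-th power of $x(n)$, and let $u(n)=Ax^\beta(n)$. Then $$\mathbb{P}(x(n+1)-x(n)=\mathbf{e}_i\mid\mathcal{F}_n)=\frac{u_i(n)}{\sum_{j=1}^3u_j(n)},\qquad i=1,2,3,$$ where $\mathbf{e}_i$ is the $i$-th standard unit vector. The proportions are $\bar{x}(n)=x(n)/(n+n_0)$, which lie in the simplex $\Delta^2=\{x\in[0,\infty)^3:x_1+x_2+x_3=1\}$. For $x\in\Delta^2$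 put $u=Ax^\beta$ (coordinatewise power). The vector field associated with the process is $F_i(x)=\frac{u_i}{u_1+u_2+u_3}-x_i$, $i=1,2,3$. For the matrix in the claim, with $S=x_1^\beta+x_2^\beta+x_3^\beta$, this is $$F_1=\frac{x_1^\beta+x_2^\beta}{2S}-x_1,\quad F_2=\frac{x_2^\beta+x_3^\beta}{2S}-x_2,\quad F_3=\frac{x_3^\beta+x_1^\beta}{2S}-x_3.$$ The limit set of $(\bar{x}(n))$ is the set of limits of its convergent subsequences. A periodic orbit is the image of a non-constant periodic trajectory of $\dot{x}=F(x)$. *)

(* Defs.v *)
From HB Require Import structures.
From mathcomp Require Import all_boot all_order all_algebra.
From mathcomp Require Import all_classical all_reals all_analysis.
Import Order.TTheory GRing.Theory Num.Theory.
Import numFieldNormedType.Exports.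

Set Implicit Arguments.
Unset Strict Implicit.
Unset Printing Implicit Defensive.

Local Open Scope classical_set_scope.
Local Open Scope ring_scope.

Section ConditionalProbability.
Context {d : measure_display} {Omega : measurableType d} {R : realType}.
Implicit Types (P : probability Omega R) (x : nat -> Omega -> 'cV[nat]_3).

(* The sigma-algebra generated by x(0), ..., x(n); nat carries its discrete
   sigma-algebra. *)
Definition history x (n : nat) : set (set Omega) :=
  <<s [set B | exists k (i : 'I_3) (Y : set nat),
         (k <= n)%N /\ B = [set w | Y (x k w i 0)]] >>.

(* f is a version of the conditional probability P(E | G), for a
   sub-sigma-algebra G of the measurable sets. *)
Definition is_cond_prob P (G : set (set Omega)) (E : set Omega)
    (f : Omega -> R) : Prop :=
  [/\ forall Y : set R, measurable Y -> G (f @^-1` Y),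
      P.-integrable setT (EFin \o f) &
      forall B, G B -> P (E `&` B) = (\int[P]_(w in B) (f w)%:E)%E].

End ConditionalProbability.

Section Urn.
Context {R : realType}.
Implicit Types (A : 'M[R]_3) (beta : R) (v : 'cV[R]_3).

Definition urn_u A beta v : 'cV[R]_3 := A *m map_mx (fun t => t `^ beta) v.

Definition urn_share A beta v : 'cV[R]_3 :=
  (\sum_j urn_u A beta v j 0)^-1 *: urn_u A beta v.

Definition real_vec (c : 'cV[nat]_3) : 'cV[R]_3 := map_mx (fun k => k%:R) c.

Definition ball_count (c : 'cV[nat]_3) : nat := (\sum_i c i 0%R)%N.

(* delta_mx i 0 is the i-th standard unit vector e_i; the increment
   x(n+1) - x(n) = e_i is written additively because counts are in nat. *)
Definition urn_process {d} {Omega : measurableType d} (P : probability Omega R)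
    A beta (x0 : 'cV[nat]_3) (x : nat -> Omega -> 'cV[nat]_3) : Prop :=
  [/\ forall n (i : 'I_3), measurable_fun setT (fun w => x n w i 0),
      forall w, x 0%N w = x0,
      (0 < ball_count x0)%N &
      forall n (i : 'I_3),
        is_cond_prob P (history x n)
          [set w | x n.+1 w = x n w + delta_mx i 0]
          (fun w => urn_share A beta (real_vec (x n w)) i 0)].

Definition proportions {Omega : Type} (x0 : 'cV[nat]_3)
    (x : nat -> Omega -> 'cV[nat]_3) (n : nat) (w : Omega) : 'cV[R]_3 :=
  ((n + ball_count x0)%N%:R)^-1 *: real_vec (x n w).

Definition simplex : set 'cV[R]_3 :=
  [set v | (forall i, 0 <= v i 0) /\ \sum_i v i 0 = 1].

Definition urn_field A beta v : 'cV[R]_3 := urn_share A beta v - v.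

Definition limit_set (y : nat -> 'cV[R]_3) : set 'cV[R]_3 :=
  [set l | exists phi : nat -> nat,
     (forall m n, (m < n)%N -> (phi m < phi n)%N) /\ y \o phi @ \oo --> l].

Definition trajectory A beta (gamma : R -> 'cV[R]_3) : Prop :=
  forall t, simplex (gamma t) /\
    is_derive t (1 : R) gamma (urn_field A beta (gamma t)).

Definition periodic_orbit A beta (O : set 'cV[R]_3) : Prop :=
  exists gamma : R -> 'cV[R]_3,
    [/\ trajectory A beta gamma,
        exists2 T, 0 < T & forall t, gamma (t + T) = gamma t,
        exists s t, gamma s <> gamma t &
        O = range gamma].

Definition connected_union_of_periodic_orbits A beta (L : set 'cV[R]_3) :
    Prop :=
  connected L /\
  exists C : set (set 'cV[R]_3),
    [/\ C !=set0, forall O, C O -> periodic_orbit A beta O &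
        L = \bigcup_(O in C) O].

Definition cyclic_matrix : 'M[R]_3 :=
  \matrix_(i < 3, j < 3)
    nth 0 (nth [::] [:: [:: 1; 1; 0];
                        [:: 0; 1; 1];
                        [:: 1; 0; 1]] i) j.

End Urn.

Arguments cyclic_matrix : clear implicits.

(* Main.v *)
(** Histories are read as words over the colours. If a nonnegative function of
    words is a supermartingale until a bad or a dead word is met, its value at a
    word bounds the conditional probability of hitting a bad word from there.

    Let v be the squared distance of the proportions to the centre. If beta < 4,
    then (1 + c t) (v + 2 / n) is a supermartingale near the centre, where t is
    the time on the harmonic clock; from a late balanced urn v stays of order
    1 / t with probability at least 1/2. If beta > 4, then - ln (v + K / n) is a
    supermartingale near the centre, so the centre is almost surely not the
    limit; the noise sums converge, so the proportions shadow the flow on the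
    harmonic clock, and the outward drift then keeps them away from the centre.
    There the rearrangement inequality gives the field a positive angular
    velocity. Trajectories in the plane cannot cross, so the map that sends the
    radius at one turn to the radius at the next is monotone up to small errors,
    and a limit point that is visited infinitely often must be approached again
    after exactly one turn, that is, within a bounded time. The pieces between
    two such visits converge to a periodic trajectory through the limit point. *)
Require Import Defs.
From mathcomp Require Import all_boot all_order all_algebra.
From mathcomp Require Import all_classical all_reals all_analysis.
From mathcomp Require Import ring lra zify.
Import Order.TTheory GRing.Theory Num.Theory.
Import numFieldNormedType.Exports.

Set Implicit Arguments.
Unset Strict Implicit.
Unset Printing Implicit Defensive.

Local Open Scope classical_set_scope.
Local Open Scope ring_scope.

(** * One step of an Euler scheme in a rotated frame *)

(** The number 4 comes from linearising at the centre. For deviations [w_i] with sum zero, the share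
    of colour [i] is [1 / 3 + beta * (w_i + w_(i+1)) / 2] to first order, and the products
    [w_i * w_(i+1)] sum to [- v / 2]. So the mean outward push is [beta / 4 * v], against the pull
    [v] exerted by averaging. Above 4 the obstacle is that an argument about planar flows has to be
    run on a noisy discrete sequence. Angles advance in steps [h = 2 pi / N], so that different
    turns can be compared on the same rays. The comparison is one-sided: a point inside another one
    stays inside it up to O(h) over a turn. Each later turn is compared directly with the first one,
    so the errors of infinitely many turns do not add up. The trajectories are limits of pieces of
    the sequence itself. Null events are covered by hitting events of arbitrarily small probability,
    which are measurable by construction. *)

Section TrigBounds.
Variable R : realType.
Implicit Types x : R.

Lemma sin_MVT x : 0 <= x -> exists2 c, 0 <= c <= x & sin x = cos c * x.
Proof.
move=> x0; have [c] := MVT_segment x0 (fun y _ => is_derive_sin y)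
  (continuous_subspaceT (@continuous_sin R)).
by rewrite in_itv/= sin0 !subr0 => ? ?; exists c.
Qed.

Lemma cos_MVT x : 0 <= x -> exists2 c, 0 <= c <= x & cos x = 1 - sin c * x.
Proof.
move=> x0; have [c] := MVT_segment x0 (fun y _ => is_derive_cos y)
  (continuous_subspaceT (@continuous_cos R)).
by rewrite in_itv/= cos0 !subr0 => ? ?; exists c => //; lra.
Qed.

Lemma sin_le_id x : 0 <= x -> sin x <= x.
Proof. by move=> x0; have [c _ ->] := sin_MVT x0; rewrite ler_piMl// cos_le1. Qed.

Lemma cos_ge_quadratic x : 0 <= x -> 1 - x ^+ 2 <= cos x.
Proof.
move=> x0; have [c /andP[c0 cx] ->] := cos_MVT x0.
have := sin_le_id c0; rewrite expr2; nra.
Qed.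

Lemma sin_ge_quadratic x : 0 <= x <= 1 -> x - x ^+ 2 <= sin x.
Proof.
case/andP=> x0 x1; have [c /andP[c0 cx] ->] := sin_MVT x0.
have := cos_ge_quadratic c0; rewrite !expr2 => h.
have : x * (1 - c * c - cos c) <= 0 by rewrite mulr_ge0_le0//; lra.
have : x * (c * c) <= x * x by rewrite ler_wpM2l//; nra.
by lra.
Qed.

Lemma small_turn x : 0 <= x <= 1 ->
  [/\ `|sin x - x| <= x ^+ 2, `|sin x| <= x & `|cos x - 1| <= x ^+ 2].
Proof.
move=> hx; have := sin_ge_quadratic hx; case/andP: hx => x0 x1.
have := cos_ge_quadratic x0; have := sin_le_id x0; have := cos_le1 x.
by split; rewrite ler_norml; apply/andP; split; nra.
Qed.

(** A sine below 1/2 forces [cos x >= 1 / 2], and the mean value theorem gives [sin x = cos c * x]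
    with [cos c >= cos x]. *)
Lemma id_le_sin x : 0 <= x <= pi / 2 -> sin x < 2^-1 -> x <= 2 * sin x.
Proof.
move=> /andP[x0 xp] s1; have p0 := pi_gt0 R.
have [c /andP[c0 cx] sE] := sin_MVT x0.
have cosx : 0 <= cos x by apply: cos_ge0_pihalf; lra.
have s0 : 0 <= sin x by apply: sin_ge0_pi; lra.
have le_cos : cos x <= cos c.
  have [->//|ne] := eqVneq c x.
  by rewrite ltW// ltr_cos ?in_itv/=; rewrite ?lt_neqAle ?ne; lra.
have := cos2Dsin2 x; rewrite !expr2 => e.
have : 2^-1 <= cos x by nra.
nra.
Qed.
(** The positive cosine excludes the angles near [pi]. The two alternatives are the angle just after
    the direction 0 and the angle just short of a full turn. *)
Lemma ray_alignment x a : 0 <= x <= pi *+ 2 -> `|sin x| <= a -> a < 2^-1 ->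
  0 < cos x -> x <= 2 * a \/ pi *+ 2 - x <= 2 * a.
Proof.
rewrite mulr2n => /andP[x0 x2] sa a1 cx; have p0 := pi_gt0 R.
have [xs|xl] := leP x (pi / 2).
  left; have := @id_le_sin x; rewrite x0 xs; have := ler_norm (sin x).
  by move=> s1 /(_ isT)/(_ _); lra.
have [xs|xl'] := leP x (pi + pi / 2).
  have : 0 <= cos (x - pi) by apply: cos_ge0_pihalf; lra.
  by have := cosDpi (x - pi); rewrite subrK; lra.
right; set y := pi + pi - x.
have sy : sin y = - sin x.
  by rewrite /y -mulr2n -sinN addrC -mulN1r mulN1r sinD2pi.
have := @id_le_sin y; have := ler_norm (- sin x); rewrite normrN -sy => s1.
have -> : 0 <= y <= pi / 2 by rewrite /y; apply/andP; split; lra.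
by move=> /(_ isT)/(_ _); lra.
Qed.
End TrigBounds.

Section NormBounds.
Context {R : numDomainType} {V : normedZmodType R}.
Lemma normD_le (x y : V) a b : `|x| <= a -> `|y| <= b -> `|x + y| <= a + b.
Proof. by move=> xa yb; apply: le_trans (ler_normD _ _) (lerD xa yb). Qed.

Lemma normB_le (x y : V) a b : `|x| <= a -> `|y| <= b -> `|x - y| <= a + b.
Proof. by move=> xa yb; apply: le_trans (ler_normB _ _) (lerD xa yb). Qed.

Lemma normM_le (x y a b : R) : `|x| <= a -> `|y| <= b -> `|x * y| <= a * b.
Proof. by move=> xa yb; rewrite normrM ler_pM. Qed.
End NormBounds.

Ltac norm_bound := repeat first
  [ eassumption | apply: normB_le | apply: normD_le | apply: normM_le ].

Section LocalStep.
Variable R : realType.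

(** Near the ray [V] is negligible, so the cross product is essentially [U * b]. Both factors being
    at most [B], neither can be small: the ray is crossed transversally, away from the origin. *)
Lemma transverse_bounds (B b0 h U V a b : R) : 1 <= B -> 0 < b0 -> 0 < U ->
  `|U| <= B -> `|a| <= B -> `|b| <= B -> `|V| <= h ^+ 2 -> h ^+ 2 * B <= b0 / 2 ->
  b0 <= U * b - V * a -> b0 <= 2 * B * b /\ b0 <= 2 * B * U.
Proof.
move=> B1 b00 U0 UB aB bB Vh hB cr.
have : `|V * a| <= h ^+ 2 * B by exact: normM_le.
rewrite ler_norml => /andP[VaB _].
have Ub : b0 / 2 <= U * b by lra.
have b_gt0 : 0 < b by rewrite -(pmulr_rgt0 _ U0); lra.
move: UB bB; rewrite !ler_norml => /andP[_ UB] /andP[_ bB].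
have : U * b <= B * b by rewrite ler_wpM2r// ltW.
have : U * b <= U * B by rewrite ler_wpM2l// ltW.
by split; lra.
Qed.

(* The position after a time [p] of order [h], in the frame turned by [h]. *)
Lemma turned_step_bounds (B P e h c s U V a b p e1 e2 : R) :
  1 <= B -> 1 <= P -> 1 <= e -> 0 <= h <= 1 ->
  `|s - h| <= h ^+ 2 -> `|s| <= h -> `|c - 1| <= h ^+ 2 ->
  `|U| <= B -> `|V| <= h ^+ 2 -> `|a| <= B -> `|b| <= B -> `|p| <= P * h ->
  `|e1| <= e * h ^+ 2 -> `|e2| <= e * h ^+ 2 -> `|U + p * a + e1| <= B ->
  let U' := U + p * a + e1 in let V' := V + p * b + e2 in
  `|(c * V' - s * U') - (p * b - h * U)| <= (3 * B + 2 * (P * B) + 3 * e) * h ^+ 2 /\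
  `|(c * U' + s * V') - U - p * a| <= (2 * B + P * B + 2 * e) * h ^+ 2.
Proof.
move=> B1 P1 e_1 /andP[h0 h1] sh sle c1 UB VB aB bB pP e1B e2B U'B U' V'.
have h2 : h ^+ 2 <= h by rewrite expr2 ler_piMl.
have V'B : `|V'| <= (1 + P * B + e) * h.
  apply: (@le_trans _ _ (h ^+ 2 + P * h * B + e * h ^+ 2)); first by rewrite /V'; norm_bound.
  by have : e * h ^+ 2 <= e * h; [rewrite ler_wpM2l//; lra | lra].
have V'B' : `|V'| <= 1 + P * B + e.
  apply: le_trans V'B _; rewrite ler_piMr//.
  by rewrite !addr_ge0 ?mulr_ge0//; lra.
have U'U : `|p * a + e1| <= (P * B + e) * h.
  apply: (@le_trans _ _ (P * h * B + e * h ^+ 2)); first by norm_bound.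
  by have : e * h ^+ 2 <= e * h; [rewrite ler_wpM2l//; lra | lra].
split.
  have -> : c * V' - s * U' - (p * b - h * U) =
     (c - 1) * V' + V + e2 - s * (p * a + e1) - (s - h) * U by rewrite /V' /U'; ring.
  apply: (@le_trans _ _ (h ^+ 2 * (1 + P * B + e) + h ^+ 2 + e * h ^+ 2 +
     h * ((P * B + e) * h) + h ^+ 2 * B)); first by norm_bound.
  rewrite [h * (_ * h)]mulrCA -expr2.
  by have : 1 * h ^+ 2 <= B * h ^+ 2; [rewrite ler_wpM2r ?sqr_ge0 | lra].
have -> : c * U' + s * V' - U - p * a = (c - 1) * U' + s * V' + e1.
  by rewrite /U'; ring.
apply: (@le_trans _ _ (h ^+ 2 * B + h * ((1 + P * B + e) * h) + e * h ^+ 2)).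
  by norm_bound.
rewrite [h * (_ * h)]mulrCA -expr2.
by have : 1 * h ^+ 2 <= B * h ^+ 2; [rewrite ler_wpM2r ?sqr_ge0 | lra].
Qed.
End LocalStep.

(* Discrete sequences that follow, up to [eta], the Euler step of drift [f]
   over all windows of duration at most 1 on the clock [t]. *)
Definition euler_window (R : realType) (C : R) (t eta X f : nat -> R) (n : nat) :=
  forall k m, (n <= k)%N -> (k <= m)%N -> t m - t k <= 1 ->
    `|X m - X k - (t m - t k) * f k| <= C * (t m - t k) ^+ 2 + eta k.

Lemma clock_reach (R : realType) (t : nat -> R) (n : nat) (s w : R) : 0 <= s -> 0 <= w ->
  (forall A, exists k, A <= t k) ->
  (forall k, (n <= k)%N -> t k.+1 - t k <= w) ->
  exists m, (n <= m)%N /\ t n + s <= t m <= t n + s + w.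
Proof.
move=> s0 w0 tunb tstep.
(* Since [t] is not assumed monotone here, the target is put above all [t i] with [i < n]; this
   forces [n <= k]. *)
have [k tk] := tunb (\big[Order.max/t n]_(i < n) t i + s + 1).
have kn : (n <= k)%N.
  rewrite leqNgt; apply/negP => kn.
  have : t k <= \big[Order.max/t n]_(i < n) t i.
    by have := le_bigmax (t n) (fun i : 'I_n => t i) (Ordinal kn).
  lra.
have tk' : t n + s <= t k.
  have : t n <= \big[Order.max/t n]_(i < n) t i by exact: bigmax_ge_id.
  lra.
have ex : exists k, (n <= k)%N && (t n + s <= t k) by exists k; rewrite kn.
case: (ex_minnP ex) => m /andP[nm tm] mmin; exists m; split=> //; rewrite tm/=.
have [E|ne] := eqVneq m n; first by rewrite E in tm *; lra.
have nm1 : (n <= m.-1)%N by lia.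
have : ~~ (t n + s <= t m.-1).
  by apply/negP => h; have := mmin m.-1; rewrite nm1 h => /(_ isT); lia.
have := tstep _ nm1; rewrite prednK; last by lia.
by rewrite -ltNge; lra.
Qed.

(** The sequence leaves the first axis with transverse speed [g n > 0]; [m] is the first index past
    the ray turned by [h]. The elapsed time is [h * X n / g n] up to order [h ^+ 2], whence the
    radial increment [h * (X n * f n / g n)]. [D] and [M] depend on [B], [C], [b0] only, so that [h]
    can be chosen afterwards. *)
Lemma local_step (R : realType) (B C b0 : R) : 1 <= B -> 1 <= C -> 0 < b0 ->
  exists D M : R, [/\ 1 <= D, 1 <= M &
   forall (h : R) (t eta X Y f g : nat -> R) (n : nat),
    0 < h -> M * h <= 1 ->
    {homo t : k m / (k <= m)%N >-> k <= m} ->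
    (forall A, exists k, A <= t k) ->
    (forall k, (n <= k)%N -> t k.+1 - t k <= h ^+ 2 / (4 * (B + C))) ->
    (forall k, (n <= k)%N -> eta k <= h ^+ 2 / (4 * (B + C))) ->
    euler_window C t eta X f n -> euler_window C t eta Y g n ->
    (forall k, `|X k| <= B) -> (forall k, `|Y k| <= B) ->
    (forall k, `|f k| <= B) -> (forall k, `|g k| <= B) ->
    b0 <= X n * g n - Y n * f n -> `|Y n| <= h ^+ 2 -> 0 < X n ->
    b0 <= D * g n /\
    exists m, [/\ (n < m)%N,
      h <= D * (t m - t n) /\ t m - t n <= D * h,
      0 < cos h * X m + sin h * Y m,
      `|cos h * Y m - sin h * X m| <= h ^+ 2 /\
      `|cos h * X m + sin h * Y m - X n - h * (X n * f n / g n)| <= D * h ^+ 2 &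
      forall k, (n <= k <= m)%N -> `|X k - X n| <= D * h /\ `|Y k - Y n| <= D * h]].
Proof.
move=> B1 C1 b00.
have B0 : 0 < B by lra.
(* [b1] is the lower bound of [X n] and [g n] given by [transverse_bounds]. *)
have [b1 b10 b1E] : exists2 b1 : R, 0 < b1 & b0 = 2 * B * b1.
  exists (b0 / (2 * B)); first by rewrite divr_gt0//; lra.
  by rewrite mulrC divfK//; lra.
(* In time [(P - 1) * h] the transverse move is at least [2 * B * h], twice the bound on the
   [h * X n] that reaching the turned ray requires. *)
have [P P1 PE] : exists2 P : R, 1 <= P & (P - 1) * b1 = 2 * B.
  exists (2 * B / b1 + 1); first by rewrite lerDr divr_ge0//; lra.
  by rewrite addrK divfK// gt_eqF.
(* In units of [h ^+ 2], [e] bounds the Euler error over times up to [P * h]; [K1] and [K2] are the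
   constants of [turned_step_bounds]. *)
have [e e1 eE] : exists2 e : R, 1 <= e & e = C * P ^+ 2 + 1.
  by exists (C * P ^+ 2 + 1) => //; rewrite lerDr mulr_ge0 ?sqr_ge0//; lra.
have PB0 : 0 < P * B by rewrite mulr_gt0//; lra.
have [K1 K10 K1E] : exists2 K1 : R, 0 < K1 & K1 = 3 * B + 2 * (P * B) + 3 * e.
  by exists (3 * B + 2 * (P * B) + 3 * e) => //; lra.
have [K2 K20 K2E] : exists2 K2 : R, 0 < K2 & K2 = 2 * B + P * B + 2 * e.
  by exists (2 * B + P * B + 2 * e) => //; lra.
have d0 : 0 < b1^-1 by rewrite invr_gt0.
have d1 : 0 < B * (1 + K1) / b1 by rewrite divr_gt0 ?mulr_gt0//; lra.
have d2 : 0 < 2 * B / b1 by rewrite divr_gt0//; lra.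
have d3 : 0 < 2 * (1 + K1) / b1 by rewrite divr_gt0//; lra.
have d4 : 0 < 2 * (P * B + K2) / b1 by rewrite divr_gt0//; lra.
have [D [D1 DB DP De] [Db DK]] : exists2 D : R,
    [/\ 1 <= D, 2 * B <= D, P <= D & P * B + e <= D] &
    2 * B / b1 <= D /\ B * (1 + K1) / b1 + K2 <= D.
  exists (2 * B + P + (P * B + e) + 2 * B / b1 + (B * (1 + K1) / b1 + K2)).
    by clear -B1 P1 PB0 e1 d1 d2 K20; split; lra.
  by clear -B1 P1 PB0 e1 d1 d2 K20; split; lra.
have [M [M1 MP Mb] [MK1 MK2]] : exists2 M : R,
    [/\ 1 <= M, P <= M & b1^-1 <= M] &
    2 * (1 + K1) / b1 <= M /\ 2 * (P * B + K2) / b1 <= M.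
  exists (P + b1^-1 + 2 * (1 + K1) / b1 + 2 * (P * B + K2) / b1).
    by clear -P1 d0 d3 d4; split; lra.
  by clear -P1 d0 d3 d4; split; lra.
clear d1 d2 d3 d4.
exists D, M; split=> // h t eta X Y f g n h0 hM tmono tunb tstep etale WX WY XB YB fB gB cr Yn Xn.
have hle a : a <= M -> a * h <= 1.
  by move=> aM; apply: le_trans hM; rewrite ler_pM2r.
have hle' a : a / b1 <= M -> a * h <= b1.
  by move=> /hle; rewrite mulrAC ler_pdivrMr// mul1r.
have h1 : h <= 1 by have := hle _ M1; rewrite mul1r.
have Ph1 := hle _ MP.
have hb1 : h <= b1 by have := @hle' 1; rewrite !mul1r; apply.
have K1h := hle' _ MK1.
have K2h := hle' _ MK2.
have h20 : 0 < h ^+ 2 by rewrite exprn_gt0.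
have hh : h ^+ 2 <= h by rewrite expr2 ler_piMl// ltW.
have [gb Xb] : b1 <= g n /\ b1 <= X n.
  have [] := transverse_bounds B1 b00 Xn (XB n) (fB n) (gB n) Yn _ cr.
    have : h ^+ 2 * B <= b1 * B by rewrite ler_pM2r// (le_trans hh).
    by rewrite b1E; clear; lra.
  by rewrite b1E !ler_pM2l ?mulr_gt0.
have g0 : 0 < g n by exact: lt_le_trans gb.
have B4 : 0 < 4 * (B + C) by rewrite mulr_gt0// addr_gt0// (lt_le_trans _ C1).
(* With this mesh a single index moves the turned transverse coordinate by at most
   [2 * w * (B + C + 1) <= h ^+ 2], which bounds the overshoot past the ray. *)
have [w wE] : exists w, w = h ^+ 2 / (4 * (B + C)) by eexists.
rewrite -wE in tstep etale.
have w0 : 0 < w by rewrite wE divr_gt0.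
have {wE}wE : w * (4 * (B + C)) = h ^+ 2 by rewrite wE divfK// gt_eqF.
have wh : w <= h ^+ 2 by rewrite -wE ler_peMr ?ltW//; clear -B1 C1; lra.
have P10 : 0 <= (P - 1) * h by rewrite mulr_ge0 ?subr_ge0// ltW.
have [m1 [nm1 /andP[m1l m1u]]] : exists m, (n <= m)%N /\
    t n + (P - 1) * h <= t m <= t n + (P - 1) * h + w.
  by apply: clock_reach => //; exact: ltW.
have within k : (n <= k <= m1)%N -> [/\ 0 <= t k - t n, t k - t n <= P * h & t k - t n <= 1].
  move=> /andP[nk km]; have := tmono _ _ nk; have := tmono _ _ km.
  by clear -m1u wh hh Ph1; split; lra.
have hx : 0 <= h <= 1 by rewrite ltW.
have [trig1 trig2 trig3] := small_turn hx.
have err Z d k : (n <= k <= m1)%N -> euler_window C t eta Z d n ->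
    `|Z k - Z n - (t k - t n) * d n| <= e * h ^+ 2.
  move=> nk WZ; have [p0 pP p1] := within _ nk.
  apply: le_trans (WZ n k _ _ p1) _ => //; first by case/andP: nk.
  rewrite eE mulrDl mul1r -mulrA -exprMn lerD//; last exact: le_trans (etale _ _) wh.
  rewrite ler_pM2l ?(lt_le_trans _ C1)// ler_pXn2r ?nnegrE//.
  by rewrite mulr_ge0 ?ltW// (lt_le_trans _ P1).
have bounds k : (n <= k <= m1)%N ->
    `|(cos h * Y k - sin h * X k) - ((t k - t n) * g n - h * X n)| <= K1 * h ^+ 2 /\
    `|(cos h * X k + sin h * Y k) - X n - (t k - t n) * f n| <= K2 * h ^+ 2.
  move=> nk; have [p0 pP p1] := within _ nk.
  have := @turned_step_bounds R B P e h (cos h) (sin h) (X n) (Y n) (f n) (g n)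
    (t k - t n) (X k - X n - (t k - t n) * f n) (Y k - Y n - (t k - t n) * g n).
  rewrite /= -K1E -K2E.
  have -> : X n + (t k - t n) * f n + (X k - X n - (t k - t n) * f n) = X k by ring.
  have -> : Y n + (t k - t n) * g n + (Y k - Y n - (t k - t n) * g n) = Y k by ring.
  apply=> //.
  - by rewrite ger0_norm.
  - exact: err.
  - exact: err.
have gB' : g n <= B by have := gB n; rewrite ler_norml => /andP[].
have XB' : X n <= B by have := XB n; rewrite ler_norml => /andP[].
have hXB : h * X n <= h * B by rewrite ler_pM2l.
have hb1X : h * b1 <= h * X n by rewrite ler_pM2l.
have K1h2 : 2 * (1 + K1) * h ^+ 2 <= b1 * h by rewrite expr2 mulrA ler_pM2r.
have K2h2 : 2 * (P * B + K2) * h <= b1 by [].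
have b1h0 : 0 < b1 * h by rewrite mulr_gt0.
have K1h0 : 0 < K1 * h ^+ 2 by rewrite mulr_gt0.
split.
  by rewrite b1E; apply: ler_pM => //; rewrite ltW// mulr_gt0.
have ex : exists k, (n <= k)%N && (0 <= cos h * Y k - sin h * X k).
  exists m1; rewrite nm1/=.
  have /bounds[+ _] : (n <= m1 <= m1)%N by rewrite nm1/=.
  rewrite ler_norml => /andP[+ _].
  have : (P - 1) * b1 * h <= (t m1 - t n) * g n.
    rewrite mulrAC; apply: ler_pM => //; first exact: ltW.
    by rewrite lerBrDl.
  rewrite PE; have : b1 * h <= B * h by rewrite ler_pM2r// (le_trans gb).
  by clear -hXB K1h2 b1h0 h20; lra.
case: (ex_minnP ex) => m /andP[nm Vm] mmin.
have mm1 : (m <= m1)%N.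
  rewrite leqNgt; apply/negP => lt.
  have := mmin m1; rewrite nm1/=.
  case: (lerP 0 (cos h * Y m1 - sin h * X m1)) => [_ /(_ isT)|neg _].
    by rewrite leqNgt lt.
  have /bounds[+ _] : (n <= m1 <= m1)%N by rewrite nm1/=.
  rewrite ler_norml => /andP[+ _].
  have : (P - 1) * b1 * h <= (t m1 - t n) * g n.
    rewrite mulrAC; apply: ler_pM => //; first exact: ltW.
    by rewrite lerBrDl.
  rewrite PE; have : b1 * h <= B * h by rewrite ler_pM2r// (le_trans gb).
  by clear -hXB K1h2 b1h0 h20 neg; lra.
have nltm : (n < m)%N.
  rewrite ltn_neqAle nm andbT; apply/eqP => E; move: Vm; rewrite -E.
  have /bounds[+ _] : (n <= n <= m1)%N by rewrite leqnn nm1.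
  rewrite subrr mul0r sub0r ler_norml => /andP[_].
  by clear -hb1X K1h2 b1h0 h20 K1h0; lra.
have nm' : (n <= m <= m1)%N by rewrite nm.
have [p0 pP p1] := within _ nm'.
have [bV bU] := bounds _ nm'.
have Vsmall : `|cos h * Y m - sin h * X m| <= h ^+ 2.
  have m0 : (0 < m)%N by exact: leq_ltn_trans nltm.
  have nm1' : (n <= m.-1)%N by rewrite -ltnS prednK.
  have neg : cos h * Y m.-1 - sin h * X m.-1 < 0.
    rewrite ltNge; apply/negP => h'.
    by have := mmin m.-1; rewrite nm1' h' => /(_ isT); rewrite leqNgt prednK ?leqnn.
  have step := tstep _ nm1'; rewrite prednK// in step.
  have step0 : 0 <= t m - t m.-1 by rewrite subr_ge0; apply: tmono; exact: leq_pred.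
  have w1 : w <= 1 by rewrite (le_trans wh)// (le_trans hh).
  have jump Z d : euler_window C t eta Z d n -> `|d m.-1| <= B ->
      `|Z m - Z m.-1| <= w * B + (C * w + w).
    move=> WZ dB; have -> : Z m - Z m.-1 = (t m - t m.-1) * d m.-1 +
      (Z m - Z m.-1 - (t m - t m.-1) * d m.-1) by ring.
    apply: normD_le; first by apply: normM_le => //; rewrite ger0_norm.
    apply: le_trans (WZ m.-1 m nm1' (leq_pred _) (le_trans step w1)) _.
    apply: lerD; last exact: etale.
    rewrite ler_pM2l ?(lt_le_trans _ C1)// expr2.
    by apply: le_trans (_ : w * w <= _); [exact: ler_pM|rewrite ler_piMl// ltW].
  have jX := jump _ _ WX (fB _); have jY := jump _ _ WY (gB _).
  have : `|cos h * (Y m - Y m.-1) - sin h * (X m - X m.-1)| <=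
      1 * (w * B + (C * w + w)) + 1 * (w * B + (C * w + w)).
    by apply: normB_le; apply: normM_le => //; rewrite ?cos_max ?sin_max.
  have : 0 <= w * (B - 1) /\ 0 <= w * (C - 1).
    split; apply: mulr_ge0; rewrite ?subr_ge0//; exact: ltW.
  rewrite !ler_norml => -[w1B w1C] /andP[_ ju]; apply/andP; split.
    by apply: le_trans Vm; rewrite oppr_le0 ltW.
  by clear -neg ju w1B w1C wE w0; lra.
(* At [m] the turned transverse coordinate is small; comparing it with its first-order expression
   determines the elapsed time. *)
have pg : `|(t m - t n) * g n - h * X n| <= (1 + K1) * h ^+ 2.
  rewrite [leRHS]mulrDl mul1r distrC.
  have -> : h * X n - (t m - t n) * g n = (cos h * Y m - sin h * X m -
    ((t m - t n) * g n - h * X n)) - (cos h * Y m - sin h * X m) by ring.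
  by rewrite [leRHS]addrC; apply: normB_le.
exists m; split=> //.
- split; last by apply: le_trans pP _; rewrite ler_pM2r.
  have : (t m - t n) * g n <= (t m - t n) * B by rewrite ler_wpM2l.
  move: pg; rewrite ler_norml => /andP[+ _] => lo up.
  have : h * b1 <= 2 * B * (t m - t n) by clear -hb1X K1h2 lo up; lra.
  rewrite -ler_pdivlMr// => /le_trans; apply.
  by rewrite mulrAC ler_wpM2r.
- have : `|(t m - t n) * f n| <= P * h * B.
    by apply: normM_le => //; rewrite ger0_norm.
  move: bU; rewrite !ler_norml => /andP[+ _] /andP[+ _].
  have : K2 * h ^+ 2 <= K2 * h by rewrite ler_pM2l.
  by clear -Xb K2h2 b10; lra.
- split=> //; have -> : cos h * X m + sin h * Y m - X n - h * (X n * f n / g n) =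
    (cos h * X m + sin h * Y m - X n - (t m - t n) * f n) +
    f n * (((t m - t n) * g n - h * X n) / g n).
    by field; rewrite gt_eqF.
  apply: (@le_trans _ _ ((B * (1 + K1) / b1 + K2) * h ^+ 2)); last first.
    by rewrite ler_pM2r.
  rewrite [leRHS]mulrDl [leRHS]addrC; apply: normD_le => //.
  have -> : B * (1 + K1) / b1 * h ^+ 2 = B * (((1 + K1) * h ^+ 2) / b1) by ring.
  apply: normM_le => //; rewrite normrM normfV (gtr0_norm g0).
  by apply: ler_pM => //; [rewrite invr_ge0 ltW | rewrite lef_pV2].

- have inc Z d k : (n <= k <= m)%N -> euler_window C t eta Z d n -> `|d n| <= B ->
      `|Z k - Z n| <= D * h.
    move=> /andP[nk km] WZ dB; have nk1 : (n <= k <= m1)%N by rewrite nk (leq_trans km).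
    have [q0 qP q1] := within _ nk1; have := err _ _ _ nk1 WZ => ee.
    have -> : Z k - Z n = (t k - t n) * d n + (Z k - Z n - (t k - t n) * d n) by ring.
    apply: le_trans (_ : P * h * B + e * h <= _).
      apply: normD_le; first by apply: normM_le => //; rewrite ger0_norm.
      by apply: le_trans ee _; rewrite ler_pM2l ?(lt_le_trans _ e1).
    by rewrite mulrAC -mulrDl ler_pM2r.
  by move=> k nkm; split; [exact: inc WX _|exact: inc WY _].
Qed.

(** Only the positive part of the difference of two radii is followed. If the second radius is the
    smaller one, [Q * h <= 1] keeps the difference of slopes from closing the gap, up to the
    [h ^+ 2] error. This is the discrete form of non-crossing. *)
Lemma one_sided_step (R : realType) (D h Q s1 s2 u1' u1 u2' u2 : R) :
  1 <= D -> 0 < h -> h <= 1 -> 1 <= Q -> Q * h <= 1 ->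
  `|u2 - u2' - h * s2| <= D * h ^+ 2 -> `|u1 - u1' - h * s1| <= D * h ^+ 2 ->
  `|s2 - s1| <= Q * (`|u2' - u1'| + 2 * h ^+ 2) ->
  Num.max (u2 - u1) 0 <=
    (1 + Q * h) * Num.max (u2' - u1') 0 + (2 * Q + 2 * D) * h ^+ 2.
Proof.
move=> D1 h0 h1 Q1 Qh.
have -> : (2 * Q + 2 * D) * h ^+ 2 = Q * (2 * h ^+ 2) + 2 * (D * h ^+ 2) by ring.
set w := D * h ^+ 2 => r1 r2 r3.
have w2 : 0 <= h ^+ 2 by exact: sqr_ge0.
have Q0 : 0 <= Q by exact: le_trans Q1.
have D0 : 0 <= D by exact: le_trans D1.
have Qw : 0 <= Q * (2 * h ^+ 2) by do 2?apply: mulr_ge0.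
have w0 : 0 <= w by exact: mulr_ge0.
have hs : h * (s2 - s1) <= Q * h * `|u2' - u1'| + Q * (2 * h ^+ 2).
  apply: le_trans (_ : h * (Q * (`|u2' - u1'| + 2 * h ^+ 2)) <= _).
    by rewrite ler_pM2l//; apply: le_trans (ler_norm _) r3.
  rewrite mulrDr mulrDr; apply: lerD; first by rewrite mulrA [h * Q]mulrC.
  by rewrite ler_piMl.
have e1 : u2 - u1 <= u2' - u1' + Q * h * `|u2' - u1'| + Q * (2 * h ^+ 2) + 2 * w.
  by move: r1 r2; rewrite !ler_norml => /andP[_ r1] /andP[r2 _]; clear -r1 r2 hs; lra.
have Qh0 : 0 <= Q * h by rewrite mulr_ge0// ltW.
rewrite ge_max; apply/andP; split; last first.
  apply: addr_ge0; last by apply: addr_ge0 => //; exact: mulr_ge0.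
  by apply: mulr_ge0; [exact: addr_ge0 | rewrite le_max lexx orbT].
apply: le_trans e1 _; rewrite -[leLHS]addrA lerD2r.
have [p|n] := lerP 0 (u2' - u1').
  by rewrite ger0_norm// mulrDl mul1r.
rewrite mulr0 ltr0_norm// mulrN subr_le0.
by rewrite -[leRHS]mul1r; nra.
Qed.

(* A monotone return map that moves the first return far off one side of [L]
   stays off on that side. *)
Lemma monotone_escape (R : realFieldType) (rho : nat -> R) (L e : R) : 0 < e ->
  `|rho 0%N - L| <= e / 4 -> e < `|rho 1%N - L| ->
  (forall k k', rho k <= rho k' -> rho k.+1 <= rho k'.+1 + e / 4) ->
  forall k, e / 2 <= `|rho k.+1 - L|.
Proof.
move=> e0; rewrite ler_norml => /andP[lo up]; rewrite ltNge ler_norml negb_and -!ltNge => far cmp k.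
case/orP: far => far.
  have claim : rho k.+1 <= L - e / 2.
    elim: k => [|k IH]; first lra.
    have /cmp : rho k.+1 <= rho 0%N by lra.
    lra.
  by rewrite ler_normr; apply/orP; right; lra.
have claim : L + e / 2 <= rho k.+1.
  elim: k => [|k IH]; first lra.
  have /cmp : rho 0%N <= rho k.+1 by lra.
  lra.
by rewrite ler_normr; apply/orP; left; lra.
Qed.

(** * Return times of an asymptotic rotation *)

Section Return.
Context (R : realType) (t eta X Y f g : nat -> R) (B C b0 K : R) (n0 : nat).
Context (B1 : 1 <= B) (C1 : 1 <= C) (b00 : 0 < b0) (K0 : 0 <= K).
Context (tmono : {homo t : k m / (k <= m)%N >-> k <= m}).
Context (tunb : forall A, exists k, A <= t k).
Context (tstep : forall e, 0 < e ->
  exists n1, forall k, (n1 <= k)%N -> t k.+1 - t k <= e).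
Context (eta0 : forall e, 0 < e -> exists n1, forall k, (n1 <= k)%N -> eta k <= e).
Context (WX : euler_window C t eta X f n0) (WY : euler_window C t eta Y g n0).
Context (XB : forall k, `|X k| <= B) (YB : forall k, `|Y k| <= B).
Context (fB : forall k, `|f k| <= B) (gB : forall k, `|g k| <= B).
Context (fL : forall n m, `|f n - f m| <= K * (`|X n - X m| + `|Y n - Y m|)).
Context (gL : forall n m, `|g n - g m| <= K * (`|X n - X m| + `|Y n - Y m|)).
Context (crossP : forall n, (n0 <= n)%N -> b0 <= X n * g n - Y n * f n).

Definition rotX (u v : nat -> R) (a : R) (n : nat) := cos a * u n + sin a * v n.
Definition rotY (u v : nat -> R) (a : R) (n : nat) := cos a * v n - sin a * u n.
Local Notation U := (rotX X Y).
Local Notation V := (rotY X Y).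
Local Notation F := (rotX f g).
Local Notation G := (rotY f g).

Lemma rotX_le u v a n A : `|u n| <= A -> `|v n| <= A -> `|rotX u v a n| <= 2 * A.
Proof.
move=> uA vA; apply: le_trans (_ : 1 * A + 1 * A <= _); last by lra.
by apply: normD_le; apply: normM_le; rewrite ?cos_max ?sin_max.
Qed.

Lemma rotY_le u v a n A : `|u n| <= A -> `|v n| <= A -> `|rotY u v a n| <= 2 * A.
Proof.
move=> uA vA; apply: le_trans (_ : 1 * A + 1 * A <= _); last by lra.
by apply: normB_le; apply: normM_le; rewrite ?cos_max ?sin_max.
Qed.

Lemma rotXD u v a h n :
  cos h * rotX u v a n + sin h * rotY u v a n = rotX u v (a + h) n.
Proof. by rewrite /rotX /rotY cosD sinD; ring. Qed.

Lemma rotYD u v a h n :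
  cos h * rotY u v a n - sin h * rotX u v a n = rotY u v (a + h) n.
Proof. by rewrite /rotX /rotY cosD sinD; ring. Qed.

Lemma rot_invX u v a n : u n = cos a * rotX u v a n - sin a * rotY u v a n.
Proof.
rewrite /rotX /rotY -[LHS]mul1r -(cos2Dsin2 a); ring.
Qed.

Lemma rot_invY u v a n : v n = sin a * rotX u v a n + cos a * rotY u v a n.
Proof.
rewrite /rotX /rotY -[LHS]mul1r -(cos2Dsin2 a); ring.
Qed.

Lemma rot_dist u v a n m A : `|rotX u v a n - rotX u v a m| <= A ->
  `|rotY u v a n - rotY u v a m| <= A ->
  `|u n - u m| <= 2 * A /\ `|v n - v m| <= 2 * A.
Proof.
move=> uA vA; split.
  rewrite [u n](rot_invX u v a) [u m](rot_invX u v a).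
  have -> : cos a * rotX u v a n - sin a * rotY u v a n - (cos a * rotX u v a m - sin a * rotY u v a m) = cos a * (rotX u v a n - rotX u v a m) - sin a * (rotY u v a n - rotY u v a m) by ring.
  apply: le_trans (_ : 1 * A + 1 * A <= _); last by lra.
  by apply: normB_le; apply: normM_le; rewrite ?cos_max ?sin_max.
rewrite [v n](rot_invY u v a) [v m](rot_invY u v a).
have -> : sin a * rotX u v a n + cos a * rotY u v a n - (sin a * rotX u v a m + cos a * rotY u v a m) = sin a * (rotX u v a n - rotX u v a m) + cos a * (rotY u v a n - rotY u v a m) by ring.
apply: le_trans (_ : 1 * A + 1 * A <= _); last by lra.
by apply: normD_le; apply: normM_le; rewrite ?cos_max ?sin_max.
Qed.

Lemma rot_window a : euler_window (2 * C) t (fun k => 2 * eta k) (U a) (F a) n0 /\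
  euler_window (2 * C) t (fun k => 2 * eta k) (V a) (G a) n0.
Proof.
split=> k m nk km tm; have wX := WX nk km tm; have wY := WY nk km tm.
  have -> : U a m - U a k - (t m - t k) * F a k =
    cos a * (X m - X k - (t m - t k) * f k) + sin a * (Y m - Y k - (t m - t k) * g k).
    by rewrite /rotX; ring.
  set e := C * (t m - t k) ^+ 2 + eta k in wX wY; apply: le_trans (_ : 1 * e + 1 * e <= _); last by rewrite /e; lra.
  by apply: normD_le; apply: normM_le; rewrite ?cos_max ?sin_max.
have -> : V a m - V a k - (t m - t k) * G a k =
  cos a * (Y m - Y k - (t m - t k) * g k) - sin a * (X m - X k - (t m - t k) * f k).
  by rewrite /rotY; ring.
set e := C * (t m - t k) ^+ 2 + eta k in wX wY; apply: le_trans (_ : 1 * e + 1 * e <= _); last by rewrite /e; lra.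
by apply: normB_le; apply: normM_le; rewrite ?cos_max ?sin_max.
Qed.

Lemma rot_cross a n : U a n * G a n - V a n * F a n = X n * g n - Y n * f n.
Proof.
rewrite /rotX /rotY -[RHS]mul1r -(cos2Dsin2 a); ring.
Qed.

Definition on_ray (h a : R) n := `|V a n| <= h ^+ 2 /\ 0 < U a n.

(** The derivative of the radius with respect to the angle: on the ray the radial speed is [F] and
    the angular speed is [G / U]. *)
Definition slope a n := U a n * F a n / G a n.

(** [local_step] in the frame turned by [a]. The threshold [n1] is uniform in [a], so that the step
    can be repeated forever; turning the frame doubles the constants [B], [C] and [eta]. *)
Lemma turn_step : exists D M : R, [/\ 1 <= D, 1 <= M &
  forall h, 0 < h -> M * h <= 1 -> exists n1, (n0 <= n1)%N /\
   forall a n, (n1 <= n)%N -> on_ray h a n ->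
    b0 <= D * G a n /\
    exists m, [/\ (n < m)%N,
      h <= D * (t m - t n) /\ t m - t n <= D * h,
      on_ray h (a + h) m,
      `|U (a + h) m - U a n - h * slope a n| <= D * h ^+ 2 &
      forall k, (n <= k <= m)%N -> `|X k - X n| <= 2 * (D * h) /\ `|Y k - Y n| <= 2 * (D * h)]].
Proof.
have B2 : 1 <= 2 * B by have := B1; lra.
have C2 : 1 <= 2 * C by have := C1; lra.
have [D [M [D1 M1 step]]] := @local_step R (2 * B) (2 * C) b0 B2 C2 b00.
exists D, M; split=> // h h0 hM.
pose w := h ^+ 2 / (4 * (2 * B + 2 * C)).
have w0 : 0 < w by rewrite divr_gt0 ?exprn_gt0// mulr_gt0//; lra.
have [n1 Hn1] := tstep w0.
have [n2 Hn2] := eta0 (divr_gt0 w0 (@ltr0n R 2)).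
exists (maxn n0 (maxn n1 n2)); split; first by rewrite leq_maxl.
move=> a n; rewrite !geq_max => /andP[nn0 /andP[nn1 nn2]] [Vn Un].
have [WU WV] := rot_window a.
have [|||||||||||Gn [m [nm tm Um [Vm UUm] pos]]] := step h t (fun k => 2 * eta k) (U a) (V a) (F a) (G a) n h0 hM tmono tunb.
- by move=> k nk; apply: Hn1; exact: leq_trans nk.
- by move=> k nk; rewrite -/w mulrC -ler_pdivlMr//; apply: Hn2; exact: leq_trans nk.
- by move=> k m nk; apply: WU; exact: leq_trans nk.
- by move=> k m nk; apply: WV; exact: leq_trans nk.
- by move=> k; apply: rotX_le.
- by move=> k; apply: rotY_le.
- by move=> k; apply: rotX_le.
- by move=> k; apply: rotY_le.
- by rewrite rot_cross; apply: crossP.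
- by [].
- by [].
split=> //; exists m; split=> //.
- by split; rewrite -?rotYD -?rotXD.
- by rewrite -rotXD.
by move=> k /pos[Uk Vk]; apply: rot_dist Uk Vk.
Qed.

(** Two points near a common ray differ in the [V] coordinate by at most [2 * h ^+ 2], so the
    Lipschitz bounds on [f] and [g] become a bound in the radius. [Q] is fixed before [h], which
    later has to satisfy [Q * h <= 1]. *)
Lemma slope_lipschitz D : 1 <= D -> exists Q : R, 1 <= Q /\
  forall h a n m, `|V a n| <= h ^+ 2 -> `|V a m| <= h ^+ 2 ->
   b0 <= D * G a n -> b0 <= D * G a m ->
   `|slope a n - slope a m| <= Q * (`|U a n - U a m| + 2 * h ^+ 2).
Proof.
move=> D1; have D0 : 0 < D by exact: lt_le_trans D1.
have B0 : 0 <= B by exact: le_trans (XB 0).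
pose Q := 1 + 4 * B * B * (1 + 16 * K) * (D / b0 * (D / b0)).
exists Q; split.
  rewrite /Q lerDl; repeat apply: mulr_ge0 => //; rewrite ?invr_ge0; try exact: ltW.
  by rewrite addr_ge0 ?mulr_ge0.
move=> h a n m Vn Vm Gn Gm.
have Gpos k : b0 <= D * G a k -> 0 < G a k /\ `|(G a k)^-1| <= D / b0.
  move=> Gk; have G0 : 0 < G a k by rewrite -(pmulr_rgt0 _ D0) (lt_le_trans b00).
  by rewrite gtr0_norm ?invr_gt0// -[_^-1]div1r ler_pdivrMr// mulrAC ler_pdivlMr// mul1r.
have [Gn0 iGn] := Gpos _ Gn; have [Gm0 iGm] := Gpos _ Gm.
have UB k : `|U a k| <= 2 * B by apply: rotX_le.
have FB k : `|F a k| <= 2 * B by apply: rotX_le.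
have GB k : `|G a k| <= 2 * B by apply: rotY_le.
set d := `|U a n - U a m| + 2 * h ^+ 2.
have h20 : 0 <= 2 * h ^+ 2 by apply: mulr_ge0 => //; exact: sqr_ge0.
have d0 : 0 <= d by exact: addr_ge0.
have dU : `|U a n - U a m| <= d by rewrite lerDl.
have dV : `|V a n - V a m| <= d.
  apply: le_trans (normB_le Vn Vm) _.
  by rewrite -[leLHS]add0r lerD// mulr_natl mulr2n.
have [dX dY] := rot_dist dU dV.
have dK w : (forall n m, `|w n - w m| <= K * (`|X n - X m| + `|Y n - Y m|)) ->
    `|w n - w m| <= 4 * K * d.
  move=> /(_ n m) /le_trans; apply; rewrite (_ : 4 * K * d = K * (4 * d)); last by ring.
  rewrite ler_wpM2l//.
  by apply: le_trans (lerD dX dY) _; lra.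
have dF : `|F a n - F a m| <= 8 * K * d.
  have -> : F a n - F a m = cos a * (f n - f m) + sin a * (g n - g m) by rewrite /rotX; ring.
  apply: le_trans (_ : 1 * (4 * K * d) + 1 * (4 * K * d) <= _); last by lra.
  by apply: normD_le; apply: normM_le; rewrite ?cos_max ?sin_max//; apply: dK.
have dG : `|G a n - G a m| <= 8 * K * d.
  have -> : G a n - G a m = cos a * (g n - g m) - sin a * (f n - f m) by rewrite /rotY; ring.
  apply: le_trans (_ : 1 * (4 * K * d) + 1 * (4 * K * d) <= _); last by lra.
  by apply: normB_le; apply: normM_le; rewrite ?cos_max ?sin_max//; apply: dK.
have -> : slope a n - slope a m =
   ((U a n - U a m) * (F a n * G a m) + U a m * ((F a n - F a m) * G a m)
     - U a m * (F a m * (G a n - G a m))) * ((G a n)^-1 * (G a m)^-1).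
  by rewrite /slope; field; rewrite !gt_eqF.
apply: (@le_trans _ _ ((d * (2 * B * (2 * B)) + 2 * B * (8 * K * d * (2 * B))
   + 2 * B * (2 * B * (8 * K * d))) * (D / b0 * (D / b0)))).
  apply: normM_le; last exact: normM_le.
  apply: normB_le; last by apply: normM_le => //; apply: normM_le.
  apply: normD_le; first by apply: normM_le => //; apply: normM_le.
  by apply: normM_le => //; apply: normM_le.
rewrite [leLHS](_ : _ = 4 * B * B * (1 + 16 * K) * (D / b0 * (D / b0)) * d); last by ring.
by rewrite ler_wpM2r// /Q lerDr.
Qed.

(** Discrete Gronwall inequality: iterate, then use [1 + q <= expR q]. *)
Lemma max0_recursion (e : nat -> R) (q err : R) N : 0 <= q -> 0 <= err ->
  (forall j, (j < N)%N -> Num.max (e j.+1) 0 <= (1 + q) * Num.max (e j) 0 + err) ->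
  Num.max (e N) 0 <= expR (q * N%:R) * (Num.max (e 0%N) 0 + err * N%:R).
Proof.
move=> q0 err0 He.
have pow j : (1 + q) ^+ j <= expR (q * j%:R).
  by rewrite expRM_natr lerXn2r ?nnegrE ?expR_ge0 ?addr_ge0// expR_ge1Dx.
suff H j : (j <= N)%N -> Num.max (e j) 0 <= (1 + q) ^+ j * (Num.max (e 0%N) 0 + err * j%:R).
  apply: le_trans (H N (leqnn _)) _; rewrite ler_wpM2r//.
  by rewrite addr_ge0 ?mulr_ge0// le_max lexx orbT.
elim: j => [|j IH] jN; first by rewrite expr0 mul1r mulr0 addr0.
apply: le_trans (He _ jN) _.
have q1 : 1 <= (1 + q) ^+ j.+1 by rewrite exprn_ege1// lerDl.
have := IH (ltnW jN) => {}IH.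
have -> : err * j.+1%:R = err * j%:R + err by rewrite -addn1 natrD mulrDr mulr1.
rewrite addrA [leRHS]mulrDr; apply: lerD.
  by rewrite exprS -mulrA ler_wpM2l// addr_ge0.
by rewrite -[leLHS]mul1r ler_wpM2r.
Qed.

(* A turn consists of [N] steps of angle [2 pi / N]; indices that differ by a
   multiple of [N] lie on the same ray. *)
Record chain (D h : R) (c : nat -> nat) : Prop := Chain {
  chain_ray : forall i, on_ray h (i%:R * h) (c i);
  chain_lt : forall i, (c i < c i.+1)%N;
  chain_G : forall i, b0 <= D * G (i%:R * h) (c i);
  chain_clock : forall i, h <= D * (t (c i.+1) - t (c i)) /\
    t (c i.+1) - t (c i) <= D * h;
  chain_rec : forall i, `|U (i.+1%:R * h) (c i.+1) - U (i%:R * h) (c i)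
     - h * slope (i%:R * h) (c i)| <= D * h ^+ 2;
  chain_near : forall i k, (c i <= k <= c i.+1)%N ->
     `|X k - X (c i)| <= 2 * (D * h) /\ `|Y k - Y (c i)| <= 2 * (D * h) }.

Lemma chain_exists : exists D M : R, [/\ 1 <= D, 1 <= M &
  forall h, 0 < h -> M * h <= 1 -> exists n1, (n0 <= n1)%N /\
   forall n, (n1 <= n)%N -> on_ray h 0 n ->
    exists c, c 0%N = n /\ chain D h c].
Proof.
have [D [M [D1 M1 step]]] := turn_step; exists D, M; split=> // h h0 hM.
have [n1 [n01 Hn1]] := step h h0 hM; exists n1; split=> // n nn ray0.
pose Q (im : nat * nat) (m : nat) := [/\ (im.2 < m)%N,
      h <= D * (t m - t im.2) /\ t m - t im.2 <= D * h,
      on_ray h (im.1%:R * h + h) m,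
      `|U (im.1%:R * h + h) m - U (im.1%:R * h) im.2 - h * slope (im.1%:R * h) im.2| <= D * h ^+ 2 &
      forall k, (im.2 <= k <= m)%N -> `|X k - X im.2| <= 2 * (D * h) /\ `|Y k - Y im.2| <= 2 * (D * h)].
(* The choice function has to be total: before [n1] or off the ray it takes the dummy value 0. *)
have : forall im : nat * nat, exists m, (n1 <= im.2)%N -> on_ray h (im.1%:R * h) im.2 -> Q im m.
  move=> [i m]/=; case: (leqP n1 m) => [n1m|]; last by exists 0%N.
  have [r|nr] := pselect (on_ray h (i%:R * h) m); last by exists 0%N => _ /nr.
  by have [_ [m' Hm']] := Hn1 _ _ n1m r; exists m'.
move=> /choice[nx nxP].
pose c := fix c i := if i is i'.+1 then nx (i', c i') else n.
have natS (i : nat) : i.+1%:R * h = i%:R * h + h by rewrite -addn1 natrD mulrDl mul1r.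
have cP i : (n1 <= c i)%N /\ on_ray h (i%:R * h) (c i).
  elim: i => [|i [IH1 IH2]]; first by rewrite mul0r.
  have [/= lt _ ? _ _] := nxP (i, c i) IH1 IH2.
  by split; [exact: leq_trans IH1 (ltnW lt)|rewrite natS].
have cQ i : Q (i, c i) (c i.+1) by have [? ?] := cP i; exact: nxP.
exists c; split=> //; split.
- by move=> i; case: (cP i).
- by move=> i; case: (cQ i).
- by move=> i; have [? r] := cP i; have [] := Hn1 _ _ _ r.
- by move=> i; case: (cQ i).
- by move=> i; rewrite natS; case: (cQ i).
- by move=> i; case: (cQ i).
Qed.

(** * Comparison of successive turns *)

Section Chain.
Context (D h Q : R) (N : nat) (c : nat -> nat).
Context (D1 : 1 <= D) (h0 : 0 < h) (h1 : h <= 1) (Q1 : 1 <= Q) (Qh : Q * h <= 1).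
Context (Nh : N%:R * h = pi *+ 2).
Context (slopeP : forall a n m, `|V a n| <= h ^+ 2 -> `|V a m| <= h ^+ 2 ->
   b0 <= D * G a n -> b0 <= D * G a m ->
   `|slope a n - slope a m| <= Q * (`|U a n - U a m| + 2 * h ^+ 2)).
Context (cP : chain D h c) (c0 : (n0 <= c 0%N)%N).

Definition radius i := U (i%:R * h) (c i).

Lemma chain_le i j : (c i <= c (i + j))%N.
Proof.
elim: j => [|j IH]; first by rewrite addn0.
by rewrite addnS; apply: leq_trans IH _; exact: ltnW (chain_lt cP _).
Qed.

Lemma chain_move i j :
  `|X (c (i + j)) - X (c i)| <= j%:R * (2 * (D * h)) /\
  `|Y (c (i + j)) - Y (c i)| <= j%:R * (2 * (D * h)).
Proof.
elim: j => [|j [IX IY]]; first by rewrite addn0 !subrr normr0 mul0r.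
have [|SX SY] := @chain_near _ _ _ cP (i + j) (c (i + j).+1).
  by rewrite leqnn andbT ltnW// (chain_lt cP).
rewrite addnS -[j.+1]addn1 natrD mulrDl mul1r; split.
  by rewrite -(subrK (X (c (i + j))) (X _)) -addrA addrC; apply: normD_le.
by rewrite -(subrK (Y (c (i + j))) (Y _)) -addrA addrC; apply: normD_le.
Qed.

Lemma chain_duration i j :
  j%:R * h <= D * (t (c (i + j)) - t (c i)) /\
  t (c (i + j)) - t (c i) <= j%:R * (D * h).
Proof.
elim: j => [|j [I1 I2]]; first by rewrite addn0 subrr !mul0r mulr0.
have [S1 S2] := chain_clock cP (i + j).
by rewrite addnS -[j.+1]addn1 natrD !mulrDl !mul1r; split; lra.
Qed.

Lemma chain_full_turn a k : U (a + k%:R * (N%:R * h)) = U a /\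
  V (a + k%:R * (N%:R * h)) = V a /\ F (a + k%:R * (N%:R * h)) = F a /\
  G (a + k%:R * (N%:R * h)) = G a.
Proof.
have per : cos (a + k%:R * (N%:R * h)) = cos a /\ sin (a + k%:R * (N%:R * h)) = sin a.
  rewrite Nh mulr_natl; elim: k => [|k [IHc IHs]]; first by rewrite mulr0n addr0.
  by rewrite mulrS [_ + _ *+ k]addrC addrA cosD2pi sinD2pi.
by rewrite /rotX /rotY per.1 per.2.
Qed.

(* One-sided Gronwall estimate: turns of the chain preserve the radial order,
   up to an error of order [h]. *)
Lemma radius_compare i i' : (forall a, U (i%:R * h + a) = U (i'%:R * h + a) /\
     V (i%:R * h + a) = V (i'%:R * h + a) /\ F (i%:R * h + a) = F (i'%:R * h + a) /\
     G (i%:R * h + a) = G (i'%:R * h + a)) ->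
  radius (i + N) - radius (i' + N) <=
   expR (Q * (pi *+ 2)) * (Num.max (radius i - radius i') 0
     + (2 * Q + 2 * D) * (pi *+ 2) * h).
Proof.
move=> same; pose e j := radius (i + j) - radius (i' + j).
have := @max0_recursion e (Q * h) ((2 * Q + 2 * D) * h ^+ 2) N.
rewrite -mulrA [h * _]mulrC Nh.
have -> : (2 * Q + 2 * D) * h ^+ 2 * N%:R = (2 * Q + 2 * D) * (pi *+ 2) * h.
  by rewrite -Nh; ring.
have Q0 : 0 <= Q by exact: le_trans Q1.
have D0 : 0 <= D by exact: le_trans D1.
rewrite /e !addn0 => rec; apply: le_trans (rec _ _ _).
- by rewrite le_max lexx.
- by rewrite mulr_ge0// ltW.
- by rewrite mulr_ge0 ?sqr_ge0// addr_ge0 ?mulr_ge0.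
move=> j _; have r1 := chain_rec cP (i + j); have r2 := chain_rec cP (i' + j).
have [Eu [Ev [Ef Eg]]] := same (j%:R * h).
rewrite -!mulrDl -!natrD in Eu Ev Ef Eg.
have Vn : `|V ((i' + j)%:R * h) (c (i + j))| <= h ^+ 2.
  by rewrite -Ev (chain_ray cP _).1.
have Gn : b0 <= D * G ((i' + j)%:R * h) (c (i + j)) by rewrite -Eg (chain_G cP).
have := slopeP Vn (chain_ray cP _).1 Gn (chain_G cP _).
rewrite -{1}Eu -[slope ((i' + j)%:R * h) (c (i + j))]/(slope _ _).
have -> : slope ((i' + j)%:R * h) (c (i + j)) = slope ((i + j)%:R * h) (c (i + j)).
  by rewrite /slope Eu Ef Eg.
rewrite /radius !addnS; move: r1 r2; rewrite -{}Eu.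
move: (slope _ _) (slope _ _) (U _ _) (U _ _) (U _ _) (U _ _) => s1 s2 u1' u1 u2' u2.
exact: one_sided_step.
Qed.

Lemma chain_cover n : (c 0%N <= n)%N -> exists i, (c i <= n < c i.+1)%N.
Proof.
move=> cn; have ci i : (i <= c i)%N.
  by elim: i => // i IH; apply: leq_ltn_trans IH (chain_lt cP i).
have ex : exists i, (n < c i)%N by exists n.+1; exact: ci.
case: (ex_minnP ex) => -[|i] ni imin; first by rewrite ltnNge cn in ni.
exists i; rewrite ni andbT leqNgt; apply/negP => /imin; by rewrite ltnn.
Qed.

(** The cross product in the turned frame gives [U * G >= b0 - 2 * B * h ^+ 2 >= b0 / 2], and
    [G <= 2 * B]. *)
Lemma radius_ge i : 4 * B * h ^+ 2 <= b0 -> b0 / (4 * B) <= radius i.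
Proof.
move=> hb; have B0 : 0 < B by exact: lt_le_trans B1.
have B40 : 0 < 4 * B by rewrite mulr_gt0.
have ci : (n0 <= c i)%N by apply: leq_trans c0 (chain_le 0 i).
have := crossP ci; rewrite -(rot_cross (i%:R * h)).
have [Vi Ui] := chain_ray cP i.
have h1' : `|V (i%:R * h) (c i) * F (i%:R * h) (c i)| <= h ^+ 2 * (2 * B).
  by apply: normM_le => //; exact: rotX_le.
have GB : G (i%:R * h) (c i) <= 2 * B.
  by apply: le_trans (ler_norm _) _; exact: rotY_le.
have h2' : radius i * G (i%:R * h) (c i) <= radius i * (2 * B).
  by rewrite ler_wpM2l// ltW.
move: h1'; rewrite ler_norml => /andP[h1' _] H.
rewrite ler_pdivrMr// /radius in h2' *; lra.
Qed.

(** At a visit to [(L0, 0)] the current angle has a small sine and a positive cosine, so it lies a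
    few steps after the start of a turn or before the start of the next; the chain moves by O(h) in
    these steps. [A * h] bounds the sine because the radius is at least [b0 / (4 * B)]. *)
Lemma visit_near_section (L0 A : R) : A * b0 = (2 * D + 2) * (4 * B) ->
  2 * A * h < 1 -> 4 * B * h ^+ 2 <= b0 -> (2 * D + 2) * h < L0 ->
  forall i n, (c i <= n <= c i.+1)%N -> `|X n - L0| <= h ^+ 2 -> `|Y n| <= h ^+ 2 ->
  exists k, (i < k.+1 * N)%N /\ `|X (c (k * N)) - L0| <= (4 * A * D + 2 * D + 1) * h.
Proof.
move=> AE Ah hb hL i n nci Xn Yn.
have B40 : 0 < 4 * B by rewrite mulr_gt0// (lt_le_trans _ B1).
have D0 : 0 < D by exact: lt_le_trans D1.
have hh : h ^+ 2 <= h by rewrite expr2 ler_piMl// ltW.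
have [dX dY] := chain_near cP nci.
have A0 : 0 < A by rewrite -(pmulr_lgt0 _ b00) AE mulr_gt0// addr_gt0// mulr_gt0.
have [Vi Ui] := chain_ray cP i.
have Ri := radius_ge i hb.
set a := i%:R * h in Vi Ui.
have Xi : `|cos a * radius i - L0| <= (2 * D + 2) * h.
  have -> : cos a * radius i - L0 = (X n - L0) + sin a * V a (c i) - (X n - X (c i)).
    by rewrite [X (c i)](rot_invX X Y a) /radius -/a; ring.
  apply: (@le_trans _ _ (h ^+ 2 + 1 * h ^+ 2 + 2 * (D * h))); last first.
    rewrite (_ : (2 * D + 2) * h = 2 * (D * h) + 2 * h); last by ring.
    by move: (D * h) => z; lra.
  by do 2?[apply: normB_le || apply: normD_le] => //; apply: normM_le => //; exact: sin_max.
have Yi : `|sin a * radius i| <= (2 * D + 2) * h.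
  have -> : sin a * radius i = Y n - cos a * V a (c i) - (Y n - Y (c i)).
    by rewrite [Y (c i)](rot_invY X Y a) /radius -/a; ring.
  apply: (@le_trans _ _ (h ^+ 2 + 1 * h ^+ 2 + 2 * (D * h))); last first.
    rewrite (_ : (2 * D + 2) * h = 2 * (D * h) + 2 * h); last by ring.
    by move: (D * h) => z; lra.
  by do 2?[apply: normB_le || apply: normD_le] => //; apply: normM_le => //; exact: cos_max.
have R0 : 0 < radius i by apply: lt_le_trans Ri; rewrite divr_gt0.
have sa : `|sin a| <= A * h.
  rewrite -(ler_pM2r R0) -{1}(gtr0_norm R0) -normrM; apply: le_trans Yi _.
  apply: (@le_trans _ _ (A * h * (b0 / (4 * B)))); last by rewrite ler_pM2l// mulr_gt0.
  rewrite (_ : A * h * (b0 / (4 * B)) = A * b0 / (4 * B) * h); last by ring.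
  by rewrite AE mulfK// gt_eqF.
have ca : 0 < cos a.
  rewrite -(pmulr_lgt0 _ R0); move: Xi; rewrite ler_norml => /andP[lo _].
  by move: lo hL; move: (_ * h) (cos a * _) => u v; lra.
have N0 : (0 < N)%N.
  by rewrite lt0n; apply/eqP => E; have := pi_gt0 R; have := Nh; rewrite E mul0r mulr2n; lra.
pose q := (i %/ N)%N; pose j := (i %% N)%N.
have iE : i = (q * N + j)%N by exact: divn_eq.
have jN : (j < N)%N by rewrite ltn_mod.
have aE : [/\ cos a = cos (j%:R * h) & sin a = sin (j%:R * h)].
  rewrite /a iE natrD natrM mulrDl -mulrA Nh mulr_natl addrC.
  elim: q {iE} => [|q [IHc IHs]]; first by rewrite mulr0n addr0.
  by rewrite mulrS [_ + _ *+ q]addrC addrA cosD2pi sinD2pi.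
have [ac as_] := aE; rewrite ac in ca; rewrite as_ in sa.
have jh : 0 <= j%:R * h <= pi *+ 2.
  by rewrite -Nh ler_pM2r// ler_nat (ltnW jN) andbT mulr_ge0// ltW.
have Ah2 : A * h < 2^-1 by move: Ah; rewrite -mulrA; move: (A * h) => z; lra.
have fin k m : (m <= N)%N -> m%:R * h <= 2 * (A * h) ->
    `|X (c (k * N)) - X (c i)| <= m%:R * (2 * (D * h)) ->
    `|X (c (k * N)) - L0| <= (4 * A * D + 2 * D + 1) * h.
  move=> _ mh dk.
  have -> : X (c (k * N)) - L0 = (X (c (k * N)) - X (c i)) + (X n - L0) - (X n - X (c i)) by ring.
  apply: (@le_trans _ _ (m%:R * (2 * (D * h)) + h ^+ 2 + 2 * (D * h))).
    by apply: normB_le => //; exact: normD_le.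
  have : m%:R * (2 * (D * h)) <= 2 * (A * h) * (2 * D).
    rewrite (_ : m%:R * (2 * (D * h)) = m%:R * h * (2 * D)); last by ring.
    by rewrite ler_pM2r// mulr_gt0.
  rewrite (_ : 2 * (A * h) * (2 * D) = 4 * A * D * h); last by ring.
  rewrite (_ : (4 * A * D + 2 * D + 1) * h = 4 * A * D * h + 2 * (D * h) + h); last by ring.
  by move: (4 * A * D * h) (D * h) (m%:R * _) => z1 z2 z3; lra.
case: (ray_alignment jh sa Ah2 ca) => jA.
  exists q; split; first by rewrite mulSn addnC [X in (X < _)%N]iE ltn_add2l.
  apply: (fin q j (ltnW jN) jA).
  by rewrite distrC; have := (chain_move (q * N) j).1; rewrite -iE.
exists q.+1; split.
  by rewrite iE !mulSn; apply: leq_trans (leq_addl _ _); rewrite addnC ltn_add2r.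
have jj : (N - j)%:R * h = pi *+ 2 - j%:R * h by rewrite (natrB _ (ltnW jN)) mulrBl Nh.
apply: (fin q.+1 (N - j)%N (leq_subr _ _)); first by rewrite jj.
have := (chain_move i (N - j)).1.
by rewrite {1}iE -addnA subnKC ?(ltnW jN)// -mulSnr.
Qed.
End Chain.

Definition near_axis (L0 e : R) n := `|X n - L0| <= e /\ `|Y n| <= e.

(* If a turn started near [(L0, 0)] missed it by [e], say outwards, then by
   [radius_compare] all later turns would stay outside and the point would not
   be visited again. *)
Theorem return_times (L0 : R) : 0 < L0 -> exists Tmin Tmax : R, 0 < Tmin /\
  ((forall e n1, 0 < e -> exists n, (n1 <= n)%N /\ near_axis L0 e n) ->
   forall e n1, 0 < e -> exists n m, [/\ (n1 <= n <= m)%N, near_axis L0 e n,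
     near_axis L0 e m & Tmin <= t m - t n <= Tmax]).
Proof.
move=> L00; have [D [M [D1 M1 chainP]]] := chain_exists.
have [Q [Q1 slopeP]] := slope_lipschitz D1.
have p0 : 0 < pi *+ 2 :> R by rewrite mulrn_wgt0// pi_gt0.
have D0 : 0 < D by exact: lt_le_trans D1.
(* A step of angle [h] takes between [h / D] and [D * h] on the clock; summed over a turn this gives
   bounds that do not depend on [e]. *)
exists (pi *+ 2 / D), ((pi *+ 2) * D); split; first by rewrite divr_gt0.
move=> visits e n1 e0.
have B0 : 0 < B by exact: lt_le_trans B1.
pose A := (2 * D + 2) * (4 * B) / b0.
have AE : A * b0 = (2 * D + 2) * (4 * B) by rewrite /A divfK// gt_eqF.
have A0 : 0 < A by rewrite /A divr_gt0// mulr_gt0// ?addr_gt0// mulr_gt0.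
pose La := expR (Q * (pi *+ 2)) * ((2 * Q + 2 * D) * (pi *+ 2)).
have La0 : 0 <= La.
  by rewrite /La mulr_ge0 ?expR_ge0// mulr_ge0 ?(ltW p0)// addr_ge0// mulr_ge0// (le_trans _ Q1, ltW D0).
have [h [N [h0 Nh [hM hQ h1 hA] [hb hL he hLa hE]]]] : exists (h : R) (N : nat), [/\ 0 < h, N%:R * h = pi *+ 2,
    [/\ M * h <= 1, Q * h <= 1, h <= 1 & 2 * A * h < 1] &
    [/\ 4 * B * h <= b0, (2 * D + 2) * h < L0, (4 * A * D + 2 * D + 1) * h < e / 2,
      La * h <= e / 4 & h <= e / 4]].
  (* Each entry [a] of [Z] encodes a requirement [a * h < 1]. Taking [h] as an exact fraction of the
     full turn brings the chain back to the same ray after [N] steps. *)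
  pose Z := [:: M; Q; 1; 2 * A; 4 * B / b0; (2 * D + 2) / L0;
    (4 * A * D + 2 * D + 1) / (e / 2); La / (e / 4); 1 / (e / 4)].
  pose z := \sum_(a <- Z) `|a|.
  have zP a : a \in Z -> a <= z.
    move=> aZ; apply: le_trans (ler_norm _) _.
    by rewrite /z (big_rem a)//= lerDl sumr_ge0.
  have z0 : 0 <= z by rewrite sumr_ge0.
  have bnd := archi_boundP (mulr_ge0 (ltW p0) z0).
  set N := Num.bound _ in bnd.
  have N0 : 0 < N%:R :> R by apply: le_lt_trans bnd; rewrite mulr_ge0// ltW.
  pose h : R := pi *+ 2 / N%:R.
  have h0 : 0 < h by rewrite divr_gt0.
  have hZ a : a \in Z -> a * h < 1.
    move=> /zP az; apply: le_lt_trans (_ : z * h < 1); first by rewrite ler_pM2r.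
    by rewrite /h mulrA ltr_pdivrMr// mul1r mulrC.
  have hZ' a b : 0 < b -> a / b \in Z -> a * h < b.
    by move=> b_0 /hZ; rewrite mulrAC ltr_pdivrMr// mul1r.
  exists h, N; rewrite {2}/h mulrCA divff ?gt_eqF// mulr1; split=> //.
    split; [| | |by apply: hZ; rewrite !inE eqxx !orbT];
      rewrite ltW// ?[ltLHS](_ : h = 1 * h) ?mul1r//; last (rewrite -[h]mul1r);
      by apply: hZ; rewrite !inE eqxx ?orbT.
  have e2 : 0 < e / 2 by rewrite divr_gt0.
  have e4 : 0 < e / 4 by rewrite divr_gt0.
  split; rewrite ?ltW//; last (rewrite -[h]mul1r);
    by apply: hZ' => //; rewrite !inE eqxx ?orbT.
have hh : h ^+ 2 <= h by rewrite expr2 ler_piMl// ltW.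
have h20 : 0 < h ^+ 2 by rewrite exprn_gt0.
have [n2 [n02 chn]] := chainP h h0 hM.
have [n [nn [Xn Yn]]] := visits (h ^+ 2) (maxn n1 n2) h20.
have ray0 : on_ray h 0 n.
  split; rewrite /rotX /rotY cos0 sin0 !mul0r !mul1r ?subr0 ?addr0//.
  move: Xn; rewrite ler_norml => /andP[lo _].
  have : 2 * h <= (2 * D + 2) * h by rewrite ler_pM2r// lerDr mulr_ge0// ltW.
  by move: lo hh hL; move: (h ^+ 2) ((2 * D + 2) * h) => u v; lra.
have [c [c0E cP]] := chn n (leq_trans (leq_maxr _ _) nn) ray0.
have c0 : (n0 <= c 0%N)%N.
  by rewrite c0E (leq_trans n02)// (leq_trans _ nn)// leq_maxr.
have slopeh := slopeP h.
have full a k : U ((k * N)%:R * h + a) = U a /\ V ((k * N)%:R * h + a) = V a /\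
    F ((k * N)%:R * h + a) = F a /\ G ((k * N)%:R * h + a) = G a.
  by rewrite natrM -mulrA addrC; exact: (chain_full_turn Nh).
have sec k : radius h c (k * N) = X (c (k * N)%N) /\ `|Y (c (k * N)%N)| <= h ^+ 2.
  have := full 0 k; rewrite addr0 => -[EU [EV _]]; have [Vk _] := chain_ray cP (k * N).
  rewrite /radius EU; move: Vk; rewrite EV /rotX /rotY cos0 sin0 !mul0r !mul1r subr0 addr0.
  by split.
have cmp k k' : radius h c (k * N) <= radius h c (k' * N) ->
    radius h c (k.+1 * N) <= radius h c (k'.+1 * N) + e / 4.
  move=> le; have same a : U ((k * N)%:R * h + a) = U ((k' * N)%:R * h + a) /\
      V ((k * N)%:R * h + a) = V ((k' * N)%:R * h + a) /\
      F ((k * N)%:R * h + a) = F ((k' * N)%:R * h + a) /\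
      G ((k * N)%:R * h + a) = G ((k' * N)%:R * h + a).
    have [-> [-> [-> ->]]] := full a k.
    by have [-> [-> [-> ->]]] := full a k'.
  have := radius_compare D1 h0 h1 Q1 hQ Nh slopeh cP same.
  rewrite max_r ?subr_le0// add0r mulrA -/La -!mulSnr => cmpE.
  by rewrite -lerBlDl; apply: le_trans cmpE _.
have R0 : radius h c (0 * N) = X n by rewrite (sec 0%N).1 mul0n c0E.
have [far|near] := ltP e (`|X (c N) - L0|); last first.
  exists n, (c N); split.
  - by rewrite (leq_trans _ nn) ?leq_maxl//= -c0E; exact: (chain_le cP 0 N).
  - by split; [apply: le_trans Xn _|apply: le_trans Yn _]; lra.
  - by split=> //; have [_] := sec 1%N; rewrite mul1n => /le_trans; apply; lra.
  have [lo up] := chain_duration cP 0 N; rewrite add0n c0E in lo up.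
  by rewrite ler_pdivrMr// -Nh [_ * D in X in X && _]mulrC lo/= -mulrA [h * D]mulrC.
exfalso.
(* A visit after the first turn puts the start of some turn [k >= 1] within [e / 2] of [L0], whereas
   [monotone_escape] keeps all these starts away. *)
have [m [nm Xm]] : exists m, (c N <= m)%N /\ near_axis L0 (h ^+ 2) m by exact: visits.
have [i /andP[im mi]] := chain_cover cP (leq_trans (chain_le cP 0 N) nm).
have Ni : (N <= i)%N.
  rewrite leqNgt; apply/negP => iN; have := chain_le cP i.+1 (N - i.+1).
  by rewrite subnKC// => /leq_trans/(_ nm); rewrite leqNgt mi.
have hb' : 4 * B * h ^+ 2 <= b0 by apply: le_trans hb; rewrite ler_pM2l// mulr_gt0.
have [|k [ik Xk]] := visit_near_section D1 h0 h1 Nh cP c0 AE hA hb' hL (i := i) (n := m) _ Xm.1 Xm.2.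
  by rewrite im ltnW.
have k0 : (0 < k)%N.
  by rewrite lt0n; apply/eqP => k0; move: ik; rewrite k0 mul1n ltnNge Ni.
rewrite -(prednK k0) in Xk.
have XcN : X (c N) = radius h c (1 * N) by rewrite (sec 1%N).1 mul1n.
move: Xn Xk far; rewrite XcN -(sec _).1 -R0 => Xn Xk far.
have {}Xk := le_lt_trans Xk he.
have X0 : `|radius h c (0 * N) - L0| <= e / 4 by apply: le_trans Xn _; lra.
have := monotone_escape (rho := fun k => radius h c (k * N)) e0 X0 far cmp k.-1.
by rewrite leNgt Xk.
Qed.
End Return.

Lemma step_difference (E : zmodType) (a' a c b' b d : E) :
  a' - b' = (a - b) + (c - d) + ((a' - a - c) - (b' - b - d)).
Proof.
have H u v : (u + c + a) - (v + d + b) = (a - b) + (c - d) + (u - v).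
  rewrite !opprD addrACA [X in X + _ = _]addrACA [LHS]addrC [X in _ + X = _]addrC.
  exact: addrA.
by rewrite -(H (a' - a - c) (b' - b - d)) !subrK.
Qed.

Lemma euler_difference (E : zmodType) (m k pu g' g pv dv : E) :
  g' - g - dv = (m - k - pu) - (m - g') + (k - g) + (pu - pv) + (pv - dv).
Proof.
have -> : m - k - pu - (m - g') = g' - (k + pu).
  by rewrite opprB addrC -[m - k - pu]addrA -opprD subrKA.
rewrite -[RHS]addrA subrKA -[RHS]addrA [X in _ = _ + X]addrACA -opprD subrKA.
by rewrite opprD addrA.
Qed.

Lemma four_point (E : zmodType) (a b c m : E) :
  a - b = (c - b) - (c - m) - (m - a).
Proof. by rewrite !opprB [RHS]addrC [X in _ = _ + X]addrC !subrKA. Qed.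

Lemma euler_is_derive (R : realType) (E : normedModType R) (g : R -> E) (s A : R) (v : E) :
  (forall h, `|h| <= 1 / 2 -> `|g (s + h) - g s - h *: v| <= A * h ^+ 2) ->
  is_derive s (1 : R) g v.
Proof.
move=> H.
have lim : (fun h => h^-1 *: (g (h *: (1 : R) + s) - g s)) @ 0^' --> v.
  apply/cvgrPdist_le => e e0.
  have A0 : 0 < `|A| + 1 by rewrite ltr_wpDl.
  have d0 : 0 < Num.min (1 / 2) (e / (`|A| + 1)) by rewrite lt_min !divr_gt0.
  near=> h.
  have h0 : h != 0 by near: h; exact: nbhs_dnbhs_neq.
  have : `|h| <= Num.min (1 / 2) (e / (`|A| + 1)).
    near: h; apply: nbhs_dnbhs; apply: filterS (nbhsx_ballx (0 : R) _ d0) => h.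
    by rewrite /ball/= sub0r normrN; exact: ltW.
  rewrite le_min => /andP[h2 he].
  have -> : v - h^-1 *: (g (h *: 1 + s) - g s) = - (h^-1 *: (g (s + h) - g s - h *: v)).
    by rewrite [_ *: 1]mulr1 [h + s]addrC [in RHS]scalerBr scalerA mulVf// scale1r opprB.
  rewrite normrN normrZ normfV ler_pdivrMl ?normr_gt0//.
  apply: le_trans (H _ h2) _; rewrite -[h ^+ 2]ger0_norm ?sqr_ge0// normrX expr2 mulrCA.
  rewrite ler_wpM2l//; apply: (@le_trans _ _ ((`|A| + 1) * `|h|)).
    by rewrite ler_wpM2r// (le_trans (ler_norm A))// lerDl.
  by rewrite mulrC -ler_pdivlMr.
have der : derivable g s (1 : R) by apply/cvg_ex; exists v.
by apply: DeriveDef => //; rewrite /derive; apply: cvg_lim.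
Unshelve. all: by end_near.
Qed.

(** * Periodic trajectories from approximate returns *)

Section FlowLimit.
Context (R : realType) (E : normedModType R) (t eta : nat -> R) (y : nat -> E).
Context (F : E -> E) (S : set E) (B C K : R) (n0 : nat).
Context (B1 : 1 <= B) (C1 : 1 <= C) (K0 : 0 <= K).
Context (tmono : {homo t : k m / (k <= m)%N >-> k <= m}).
Context (tunb : forall A, exists k, A <= t k).
Context (tstep : forall e, 0 < e ->
  exists n1, forall k, (n1 <= k)%N -> t k.+1 - t k <= e).
Context (eta0 : forall e, 0 < e -> exists n1, forall k, (n1 <= k)%N -> eta k <= e).
Context (window : forall k m, (n0 <= k)%N -> (k <= m)%N -> t m - t k <= 1 ->
  `|y m - y k - (t m - t k) *: F (y k)| <= C * (t m - t k) ^+ 2 + eta k).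
Context (yS : forall n, S (y n)).
Context (closedS : forall l, (forall e, 0 < e -> exists2 s, S s & `|s - l| <= e) -> S l).
Context (FB : forall v, S v -> `|F v| <= B).
Context (FL : forall v w, S v -> S w -> `|F v - F w| <= K * `|v - w|).
Context (complete : forall u : nat -> E,
  (forall e, 0 < e -> exists N, forall n m, (N <= n)%N -> (N <= m)%N -> `|u n - u m| <= e) ->
  exists l, forall e, 0 < e -> exists N, forall n, (N <= n)%N -> `|u n - l| <= e).

Lemma later_exists n s : exists m, (n <= m)%N && (t n + s <= t m).
Proof.
have [k tk] := tunb (t n + s); exists (maxn n k).
by rewrite leq_maxl (le_trans tk)// tmono// leq_maxr.
Qed.

(** Discrete stand-in for the flow: [y (later n s)] is the position a time [s] after index [n], up
    to one step of the clock. *)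
Definition later n s := ex_minn (later_exists n s).

Lemma laterP n s : [/\ (n <= later n s)%N, t n + s <= t (later n s) &
  forall m, (n <= m)%N -> t n + s <= t m -> (later n s <= m)%N].
Proof.
rewrite /later; case: ex_minnP => m /andP[nm tm] mmin; split=> // k nk tk.
by apply: mmin; rewrite nk.
Qed.

Lemma later_ub n s w : 0 <= s -> 0 <= w ->
  (forall k, (n <= k)%N -> t k.+1 - t k <= w) -> t (later n s) <= t n + s + w.
Proof.
move=> s0 w0 st; have [m [nm /andP[lo up]]] := clock_reach s0 w0 tunb st.
have [_ _ /(_ m nm lo) lm] := laterP n s.
by apply: le_trans up; exact: tmono.
Qed.

Lemma later_mono n s s' : s <= s' -> (later n s <= later n s')%N.
Proof.
move=> ss; have [_ _ H] := laterP n s; have [nl tl _] := laterP n s'.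
by apply: H => //; apply: le_trans tl; rewrite lerD2l.
Qed.

Lemma small_tail w : 0 < w -> exists n1, (n0 <= n1)%N /\
  forall k, (n1 <= k)%N -> t k.+1 - t k <= w /\ eta k <= w.
Proof.
move=> w0; have [a Ha] := tstep w0; have [b Hb] := eta0 w0.
exists (maxn n0 (maxn a b)); split; first exact: leq_maxl.
by move=> k; rewrite !geq_max => /and3P[_ ka kb]; split; [exact: Ha|exact: Hb].
Qed.

Lemma window_move k m w : (n0 <= k)%N -> (k <= m)%N -> t m - t k <= w -> w <= 1 ->
  eta k <= w -> `|y m - y k| <= (B + C + 1) * w.
Proof.
move=> nk km tw w1 ew; have tk0 : 0 <= t m - t k by rewrite subr_ge0 tmono.
have W := window nk km (le_trans tw w1).
rewrite -[y m - y k](subrK ((t m - t k) *: F (y k))).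
apply: (@le_trans _ _ ((C * w + w) + w * B)); last by rewrite !mulrDl mul1r [B * w]mulrC; lra.
apply: normD_le; last by rewrite normrZ ger0_norm//; apply: ler_pM => //; exact: FB.
apply: le_trans W _; apply: lerD => //; rewrite ler_pM2l ?(lt_le_trans ltr01 C1)//.
rewrite expr2 -[leRHS]mulr1; apply: ler_pM => //; exact: le_trans w1.
Qed.

(** [later] meets the grid times up to the mesh [h ^+ 2]. The error in the duration costs
    [B * h ^+ 2], the Euler error over a duration at most [2 * h] costs [4 * C * h ^+ 2], and [eta]
    the rest. *)
Lemma grid_step n h i : 0 < h -> 2 * h <= 1 -> (n0 <= n)%N ->
  (forall k, (n <= k)%N -> t k.+1 - t k <= h ^+ 2 /\ eta k <= h ^+ 2) ->
  `|y (later n (i.+1%:R * h)) - y (later n (i%:R * h)) - h *: F (y (later n (i%:R * h)))|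
   <= (B + 4 * C + 1) * h ^+ 2.
Proof.
move=> h0 h2 n0n small.
have h20 : 0 <= h ^+ 2 by exact: sqr_ge0.
have hh : h ^+ 2 <= h by rewrite expr2 ler_piMl ?ltW//; lra.
have st k : (n <= k)%N -> t k.+1 - t k <= h ^+ 2 by move=> /small[].
set a := later n _; set b := later n _.
have [na ta _] := laterP n (i.+1%:R * h); have [nb tb _] := laterP n (i%:R * h).
have tau := @later_ub n (i.+1%:R * h) _ (mulr_ge0 (ler0n _ _) (ltW h0)) h20 st.
have tbu := @later_ub n (i%:R * h) _ (mulr_ge0 (ler0n _ _) (ltW h0)) h20 st.
have iE : i.+1%:R * h = i%:R * h + h by rewrite -addn1 natrD mulrDl mul1r.
have ba : (b <= a)%N by apply: later_mono; rewrite iE lerDl ltW.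
rewrite -/a -/b iE in ta tau tb tbu.
have [p0 ph] : 0 <= t a - t b /\ `|t a - t b - h| <= h ^+ 2.
  by rewrite subr_ge0 tmono// ler_norml; split=> //; apply/andP; split; lra.
have p2 : t a - t b <= 2 * h by move: ph; rewrite ler_norml => /andP[_]; lra.
have W := window (leq_trans n0n nb) ba (le_trans p2 h2).
have -> : y a - y b - h *: F (y b) = (y a - y b - (t a - t b) *: F (y b)) +
   (t a - t b - h) *: F (y b).
  by rewrite [(_ - h) *: _]scalerBl addrA subrK.
apply: (@le_trans _ _ ((C * (4 * h ^+ 2) + h ^+ 2) + h ^+ 2 * B)); last by lra.
apply: normD_le; last by rewrite normrZ; apply: ler_pM => //; exact: FB.
apply: le_trans W _; apply: lerD; last by have [] := small b nb.
rewrite ler_pM2l ?(lt_le_trans ltr01 C1)// (_ : 4 * h ^+ 2 = (2 * h) ^+ 2).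
  by rewrite ler_pXn2r ?nnegrE// mulr_ge0// ltW.
by rewrite exprMn expr2; ring.
Qed.

Lemma grid_close n n' h N : 0 < h -> 2 * h <= 1 -> (n0 <= n)%N -> (n0 <= n')%N ->
  (forall k, (n <= k)%N -> t k.+1 - t k <= h ^+ 2 /\ eta k <= h ^+ 2) ->
  (forall k, (n' <= k)%N -> t k.+1 - t k <= h ^+ 2 /\ eta k <= h ^+ 2) ->
  `|y (later n (N%:R * h)) - y (later n' (N%:R * h))| <=
  expR (K * h * N%:R) * (`|y (later n 0) - y (later n' 0)| +
     2 * (B + 4 * C + 1) * h ^+ 2 * N%:R).
Proof.
move=> h0 h2 nn nn' sm sm'.
pose e i := `|y (later n (i%:R * h)) - y (later n' (i%:R * h))|.
have e0 i : Num.max (e i) 0 = e i by rewrite max_l// normr_ge0.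
have := @max0_recursion R e (K * h) (2 * (B + 4 * C + 1) * h ^+ 2) N.
rewrite !e0 /e !mul0r; apply.
- by rewrite mulr_ge0// ltW.
- apply: mulr_ge0; last exact: sqr_ge0.
  by have := B1; have := C1; lra.
move=> i _; rewrite !max_l ?normr_ge0//.
have g1 := grid_step i h0 h2 nn sm; have g2 := grid_step i h0 h2 nn' sm'.
set a' := y (later n (i.+1%:R * h)) in g1 *; set a := y (later n (i%:R * h)) in g1 *.
set b' := y (later n' (i.+1%:R * h)) in g2 *; set b := y (later n' (i%:R * h)) in g2 *.
have -> : a' - b' = (a - b) + h *: (F a - F b) + ((a' - a - h *: F a) - (b' - b - h *: F b)).
  by rewrite scalerBr; exact: step_difference.
rewrite [leRHS](_ : _ = `|a - b| + h * (K * `|a - b|) +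
   ((B + 4 * C + 1) * h ^+ 2 + (B + 4 * C + 1) * h ^+ 2)); last by ring.
  apply: normD_le; last exact: normB_le.
  apply: normD_le => //; rewrite normrZ gtr0_norm// ler_pM2l//.
  by apply: FL; exact: yS.
Qed.

Lemma later0 n : later n 0 = n.
Proof.
have [nl _ H] := laterP n 0; apply/eqP; rewrite eqn_leq nl andbT.
by apply: H => //; rewrite addr0.
Qed.

(** Continuous dependence on the initial point, uniform over late indices: Gronwall up to the last
    grid time before [s], then one short move for each piece. [A] collects these contributions, so
    that [A * h <= e] suffices. *)
Lemma flow_close T e : 0 <= T -> 0 < e -> exists k n1, 0 < k /\
  forall n n', (n1 <= n)%N -> (n1 <= n')%N -> `|y n - y n'| <= k ->
  forall s, 0 <= s <= T -> `|y (later n s) - y (later n' s)| <= e.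
Proof.
move=> T0 e0.
have c0 : 0 <= 2 * (B + 4 * C + 1) by have := B1; have := C1; lra.
pose A := expR (K * T) * (1 + 2 * (B + 4 * C + 1) * T) + 4 * (B + C + 1).
have A0 : 0 < A.
  have := B1; have := C1; have := mulr_ge0 (expR_ge0 (K * T)) (addr_ge0 ler01 (mulr_ge0 c0 T0)).
  by rewrite /A; move: (expR _ * _) => u; lra.
have [h [h0 h2 hA]] : exists h : R, [/\ 0 < h, 2 * h <= 1 & A * h <= e].
  exists (Num.min (1 / 2) (e / A)); split.
  - by rewrite lt_min !divr_gt0.
  - have : Num.min (1 / 2) (e / A) <= 1 / 2 by rewrite ge_min lexx.
    lra.
  - by rewrite mulrC -ler_pdivlMr// ge_min lexx orbT.
have hh0 : 0 < h ^+ 2 by rewrite exprn_gt0.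
have hh : h ^+ 2 <= h by rewrite expr2 ler_piMl ?(ltW h0)//; lra.
have [n1 [n01 small]] := small_tail hh0.
exists h, n1; split=> // n n' nn nn' ynn s /andP[s0 sT].
have sm m : (n1 <= m)%N -> forall k, (m <= k)%N -> t k.+1 - t k <= h ^+ 2 /\ eta k <= h ^+ 2.
  by move=> nm k mk; apply: small; exact: leq_trans mk.
pose i := Num.truncn (s / h).
have [is_ si] : i%:R * h <= s /\ s <= i%:R * h + h.
  have /truncn_itv/andP[lo up] : 0 <= s / h by rewrite divr_ge0// ltW.
  rewrite -ler_pdivlMr//; split=> //.
  by rewrite -[X in _ + X]mul1r -mulrDl -ler_pdivrMr// natr1 ltW.
have near m : (n1 <= m)%N -> `|y (later m s) - y (later m (i%:R * h))| <= (B + C + 1) * (2 * h).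
  move=> n1m; have [ml tl _] := laterP m (i%:R * h).
  apply: window_move => //.
  - by apply: leq_trans ml; apply: leq_trans n01 _.
  - exact: later_mono.
  - have st k : (m <= k)%N -> t k.+1 - t k <= h ^+ 2 by move=> /(sm _ n1m)[].
    have := later_ub s0 (ltW hh0) st; lra.
  - by have [_] := sm _ n1m _ ml; lra.
have := grid_close i h0 h2 (leq_trans n01 nn) (leq_trans n01 nn') (sm _ nn) (sm _ nn').
rewrite !later0; set a := y (later n (_ * _)); set b := y (later n' (_ * _)) => gc.
have -> : y (later n s) - y (later n' s) = (y (later n s) - a) + (a - b) - (y (later n' s) - b).
  by rewrite opprB !subrKA.
have na := near _ nn; have nb := near _ nn'; rewrite -/a -/b in na nb.
apply: le_trans hA; rewrite [leRHS](_ : _ = (B + C + 1) * (2 * h) +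
  expR (K * T) * ((1 + 2 * (B + 4 * C + 1) * T) * h) + (B + C + 1) * (2 * h)); last by rewrite /A; ring.
apply: normB_le => //; apply: normD_le => //.
apply: le_trans gc _; apply: ler_pM; rewrite ?expR_ge0//.
- by rewrite addr_ge0// mulr_ge0// mulr_ge0// ltW.
- by rewrite ler_expR -mulrA ler_wpM2l// mulrC (le_trans is_).
rewrite [leRHS](_ : _ = h + 2 * (B + 4 * C + 1) * (h * T)); last by ring.
rewrite lerD// -[leLHS]mulrA ler_wpM2l// expr2 -mulrA ler_wpM2l ?(ltW h0)//.
by rewrite mulrC (le_trans is_).
Qed.

(** * The limit trajectory and its period *)

Section Limit.
Context (phi : nat -> nat) (l : E) (phi_ge : forall j, (j <= phi j)%N).
Context (yl : forall e, 0 < e -> exists N, forall j, (N <= j)%N -> `|y (phi j) - l| <= e).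

(** For fixed [s], the positions a time [s] after the indices [phi j] form a Cauchy sequence by
    [flow_close]. *)
Lemma limit_exists : exists g : R -> E, forall s, 0 <= s -> forall e, 0 < e ->
  exists N, forall j, (N <= j)%N -> `|y (later (phi j) s) - g s| <= e.
Proof.
suff : forall s, exists v, 0 <= s -> forall e, 0 < e ->
  exists N, forall j, (N <= j)%N -> `|y (later (phi j) s) - v| <= e.
  by move=> /choice[g gP]; exists g.
(* The value [l] at negative times is a dummy. *)
move=> s; have [s0|] := leP 0 s; last by exists l.
have [|v vP] := complete (u := fun j => y (later (phi j) s)); last by exists v.
move=> e e0; have [k [n1 [k0 close]]] := flow_close s0 e0.
have [N NP] := yl (divr_gt0 k0 (@ltr0n R 2)).
exists (maxn N n1) => n m; rewrite !geq_max => /andP[Nn n1n] /andP[Nm n1m].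
apply: close; rewrite ?s0 ?lexx//; [exact: leq_trans (phi_ge n)|exact: leq_trans (phi_ge m)|].
rewrite -(subrKA l) [k]splitr; apply: normD_le; first exact: NP.
by rewrite distrC; exact: NP.
Qed.

Context (g : R -> E) (gP : forall s, 0 <= s -> forall e, 0 < e ->
  exists N, forall j, (N <= j)%N -> `|y (later (phi j) s) - g s| <= e).

Lemma norm_small_eq (v w : E) : (forall e, 0 < e -> `|v - w| <= e) -> v = w.
Proof.
move=> H; apply/eqP; rewrite -subr_eq0 -normr_le0.
by apply/ler_addgt0Pl => e e0; rewrite addr0; exact: H.
Qed.

Lemma limit0 : g 0 = l.
Proof.
apply: norm_small_eq => e e0; have e2 : 0 < e / 2 by rewrite divr_gt0.
have [N NP] := gP (lexx 0) e2; have [N' NP'] := yl e2.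
rewrite -(subrKA (y (phi (maxn N N')))) [e]splitr; apply: normD_le.
  by rewrite distrC; have := NP (maxn N N'); rewrite later0; apply; rewrite leq_maxl.
by apply: NP'; rewrite leq_maxr.
Qed.

Lemma limit_in s : 0 <= s -> S (g s).
Proof.
move=> s0; apply: closedS => e e0; have [N NP] := gP s0 e0.
by exists (y (later (phi N) s)) => //; exact: NP.
Qed.

Lemma limit_visited s e n1 : 0 <= s -> 0 < e ->
  exists n, (n1 <= n)%N /\ `|y n - g s| <= e.
Proof.
move=> s0 e0; have [N NP] := gP s0 e0; exists (later (phi (maxn N n1)) s).
split; last by apply: NP; rewrite leq_maxl.
have [h _ _] := laterP (phi (maxn N n1)) s; apply: leq_trans h.
by apply: leq_trans (phi_ge _); rewrite leq_maxr.
Qed.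

(** In the limit [eta] and the rounding of [later] vanish from the window estimate. The remainder is
    purely quadratic, so the derivative can be read off. *)
Lemma limit_euler s s' : 0 <= s -> s <= s' -> s' - s <= 1 / 2 ->
  `|g s' - g s - (s' - s) *: F (g s)| <= C * (s' - s) ^+ 2.
Proof.
move=> s0 ss d2; set d := s' - s; have d0 : 0 <= d by rewrite subr_ge0.
have s'0 : 0 <= s' by exact: le_trans ss.
have C0 : 0 < C by exact: lt_le_trans C1.
pose A := 4 + B + K + 4 * C.
have A0 : 0 < A by rewrite /A; have := B1; have := C1; have := K0; lra.
apply/ler_addgt0Pl => e e0.
have [w [w0 w4 wA]] : exists w : R, [/\ 0 < w, 4 * w <= 1 & A * w <= e].
  exists (Num.min (1 / 4) (e / A)); split.
  - by rewrite lt_min !divr_gt0.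
  - have : Num.min (1 / 4) (e / A) <= 1 / 4 by rewrite ge_min lexx.
    lra.
  - by rewrite mulrC -ler_pdivlMr// ge_min lexx orbT.
have [N NP] := gP s0 w0; have [N' NP'] := gP s'0 w0; have [n1 [n01 small]] := small_tail w0.
pose j := maxn n1 (maxn N N').
have jn : (n1 <= phi j)%N by apply: leq_trans (phi_ge _); rewrite leq_maxl.
have {NP}Pk := NP j (leq_trans (leq_maxl N N') (leq_maxr n1 _)).
have {NP'}Pm := NP' j (leq_trans (leq_maxr N N') (leq_maxr n1 _)).
set k := later (phi j) s in Pk; set m := later (phi j) s' in Pm.
have [nk tk _] := laterP (phi j) s; rewrite -/k in nk tk.
have [nm tm _] := laterP (phi j) s'; rewrite -/m in nm tm.
have st i : (phi j <= i)%N -> t i.+1 - t i <= w.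
  by move=> ji; have [] := small i (leq_trans jn ji).
have tku := later_ub s0 (ltW w0) st; have tmu := later_ub s'0 (ltW w0) st.
rewrite -/k in tku; rewrite -/m in tmu.
have km : (k <= m)%N by exact: later_mono.
set p := t m - t k.
have pd : `|p - d| <= w.
  by rewrite ler_norml /p /d; apply/andP; split; lra.
have p0 : 0 <= p by rewrite subr_ge0 tmono.
have p1 : p <= 1.
  by move: pd; rewrite ler_norml => /andP[_]; move: d2 w4; rewrite -/d; lra.
have W := window (leq_trans n01 (leq_trans jn nk)) km p1; rewrite -/p in W.
have ek : eta k <= w by have [] := small k (leq_trans jn nk).
have Fk : `|F (y k) - F (g s)| <= K * w.
  by apply: le_trans (FL _ _) _ => //; [exact: limit_in|rewrite ler_wpM2l].
have -> : g s' - g s - d *: F (g s) =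
   (y m - y k - p *: F (y k)) - (y m - g s') + (y k - g s) +
   p *: (F (y k) - F (g s)) + (p - d) *: F (g s).
  by rewrite [p *: (_ - _)]scalerBr [(p - d) *: _]scalerBl; exact: euler_difference.
apply: le_trans (_ : ((C * p ^+ 2 + w) + w + w + 1 * (K * w)) + w * B <= _).
  apply: normD_le; last by rewrite normrZ; apply: ler_pM => //; apply: FB; exact: limit_in.
  apply: normD_le; last by rewrite normrZ ger0_norm//; apply: ler_pM.
  by apply: normD_le => //; apply: normB_le => //; apply: le_trans W _; rewrite lerD2l.
have pp : C * p ^+ 2 <= C * d ^+ 2 + C * (3 * w).
  rewrite -mulrDr ler_pM2l//; move: pd; rewrite ler_norml => /andP[_ pd].
  have : p * p <= (d + w) * (d + w) by apply: ler_pM => //; lra.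
  by rewrite !expr2; move: d2; rewrite -/d => d2; nra.
move: wA pp; rewrite /A; move: (C * p ^+ 2) (C * d ^+ 2) => u v.
have : 0 <= C * w by rewrite mulr_ge0// ltW.
rewrite (_ : (4 + B + K + 4 * C) * w = 4 * w + w * B + K * w + 4 * (C * w)); last by ring.
rewrite (_ : C * (3 * w) = 3 * (C * w)); last by ring.
by rewrite mul1r; move: (C * w) (w * B) (K * w) => z1 z2 z3; lra.
Qed.

(** Extends the shadowing of [g] from the indices [phi j] to every late index near [l], in
    particular to the indices at which returns start. *)
Lemma limit_approx T e : 0 <= T -> 0 < e -> exists k n1, 0 < k /\
  forall n, (n1 <= n)%N -> `|y n - l| <= k ->
  forall s, 0 <= s <= T -> `|y (later n s) - g s| <= e.
Proof.
move=> T0 e0; have e2 : 0 < e / 2 by rewrite divr_gt0.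
have [k [n1 [k0 close]]] := flow_close T0 e2.
have k2 : 0 < k / 2 by rewrite divr_gt0.
exists (k / 2), n1; split=> // n nn ynl s sT.
have s0 : 0 <= s by case/andP: sT.
have [N NP] := yl k2; have [N' NP'] := gP s0 e2.
pose j := maxn n1 (maxn N N').
have Pl := NP j (leq_trans (leq_maxl N N') (leq_maxr n1 _)).
have Pg := NP' j (leq_trans (leq_maxr N N') (leq_maxr n1 _)).
rewrite -(subrKA (y (later (phi j) s))) [e]splitr; apply: normD_le => //.
apply: close => //; first by apply: leq_trans (phi_ge _); rewrite leq_maxl.
by rewrite -(subrKA l) [k]splitr; apply: normD_le => //; rewrite distrC.
Qed.

(** After time [T] the pieces are near [l] again, hence follow [g] from its beginning. Waiting [T]
    and then [s] differs from waiting [s + T] only by the rounding of [later], a short move. *)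
Lemma limit_periodic T s : 0 < T -> g T = l -> 0 <= s -> g (s + T) = g s.
Proof.
move=> T0 gT s0; apply: norm_small_eq => e e0.
have BC : 0 < B + C + 1 by have := B1; have := C1; lra.
have e4 : 0 < e / 3 by rewrite divr_gt0.
have [k [n1 [k0 close]]] := limit_approx s0 e4.
have [w [w0 w1 we]] : exists w : R, [/\ 0 < w, 2 * w <= 1 & (B + C + 1) * (2 * w) <= e / 3].
  exists (Num.min (1 / 2) (e / 3 / (B + C + 1) / 2)); split.
  - by rewrite lt_min !divr_gt0.
  - have : Num.min (1 / 2) (e / 3 / (B + C + 1) / 2) <= 1 / 2 by rewrite ge_min lexx.
    lra.
  - rewrite mulrC -ler_pdivlMr// mulrC -ler_pdivlMr// ge_min lexx orbT//.
have [n2 [n02 small]] := small_tail w0.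
have [N NP] := gP (ltW T0) k0; have [N' NP'] := gP (addr_ge0 s0 (ltW T0)) e4.
pose j := maxn (maxn n1 n2) (maxn N N').
have PT := NP j (leq_trans (leq_maxl N N') (leq_maxr _ _)).
have Pg := NP' j (leq_trans (leq_maxr N N') (leq_maxr _ _)).
have jn1 : (n1 <= phi j)%N.
  exact: leq_trans (leq_maxl _ _) (leq_trans (leq_maxl _ _) (phi_ge _)).
have jn2 : (n2 <= phi j)%N.
  exact: leq_trans (leq_maxr _ _) (leq_trans (leq_maxl _ _) (phi_ge _)).
set n' := later (phi j) T in PT; rewrite gT in PT.
have [jn' tn' _] := laterP (phi j) T; rewrite -/n' in jn' tn'.
have {}close := close n' (leq_trans jn1 jn') PT s; rewrite s0 lexx in close.
have {}close := close isT.
have [n's tn's _] := laterP n' s; have [jm tm mmin] := laterP (phi j) (s + T).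
set m := later (phi j) (s + T) in Pg jm tm mmin.
have lem : (m <= later n' s)%N.
  by apply: mmin; [exact: leq_trans n's|lra].
have st i : (phi j <= i)%N -> t i.+1 - t i <= w.
  by move=> ji; have [] := small i (leq_trans jn2 ji).
have st' i : (n' <= i)%N -> t i.+1 - t i <= w.
  by move=> ji; apply: st; exact: leq_trans ji.
have tn'u := later_ub (ltW T0) (ltW w0) st; have tsu := later_ub s0 (ltW w0) st'.
rewrite -/n' in tn'u.
have mv : `|y (later n' s) - y m| <= (B + C + 1) * (2 * w).
  apply: window_move => //; first exact: leq_trans n02 (leq_trans jn2 jm).
  - by lra.
  - by have [_] := small m (leq_trans jn2 jm); lra.
have -> : g (s + T) - g s = (y (later n' s) - g s) - (y (later n' s) - y m) - (y m - g (s + T)).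
  exact: four_point.
apply: le_trans (_ : e / 3 + (B + C + 1) * (2 * w) + e / 3 <= _); last by lra.
by apply: normB_le => //; apply: normB_le.
Qed.

Lemma limit_lipschitz s s' : 0 <= s -> s <= s' -> s' - s <= 1 / 2 ->
  `|g s' - g s| <= (B + C) * (s' - s).
Proof.
move=> s0 ss d2; have H := limit_euler s0 ss d2.
rewrite -[g s' - g s](subrK ((s' - s) *: F (g s))).
have d0 : 0 <= s' - s by rewrite subr_ge0.
apply: (@le_trans _ _ (C * (s' - s) + (s' - s) * B)); last by rewrite [(B + C) * _]mulrDl addrC [B * _]mulrC.
apply: normD_le; last first.
  by rewrite normrZ ger0_norm//; apply: ler_pM => //; apply: FB; exact: limit_in.
apply: le_trans H _; rewrite ler_pM2l ?(lt_le_trans ltr01 C1)// expr2 ler_piMl//; lra.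
Qed.

(** The return durations may fail to converge. But the distance from [g s] to [l] attains its
    minimum on [[Tmin, Tmax]], and the durations of closer and closer returns make it arbitrarily
    small there, so the minimum is 0. *)
Lemma period_exists (Tmin Tmax : R) : 0 < Tmin ->
  (forall e n1, 0 < e -> exists n m, [/\ (n1 <= n <= m)%N, `|y n - l| <= e,
     `|y m - l| <= e & Tmin <= t m - t n <= Tmax]) ->
  exists2 T, 0 < T & g T = l.
Proof.
move=> Tm0 ret.
have Tmm : Tmin <= Tmax by have [n [m [_ _ _ /andP[]]]] := ret 1 0%N ltr01; exact: le_trans.
have cont : {within `[Tmin, Tmax], continuous (fun s => `|g s - l|)}.
  apply: continuous_in_subspaceT => x; rewrite inE/= in_itv/= => /andP[x1 _].
  apply/cvgrPdist_le => e e0.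
  have x0 : 0 < x by exact: lt_le_trans x1.
  have BC : 0 < B + C by have := B1; have := C1; lra.
  have m0 : 0 < Num.min (Num.min x (1 / 2)) (e / (B + C)).
    by rewrite !lt_min x0 !divr_gt0.
  near=> s.
  apply: le_trans (ler_dist_dist _ _) _; rewrite opprB subrKA.
  have sx : `|x - s| <= Num.min (Num.min x (1 / 2)) (e / (B + C)).
    by near: s; apply: filterS (nbhsx_ballx x _ m0) => s; exact: ltW.
  move: sx; rewrite !le_min => /andP[/andP[sx s2] se].
  move: sx s2; rewrite !ler_norml => /andP[sx1 sx2] /andP[s21 s22].
  have [xs|sx] := leP x s.
    rewrite distrC; apply: le_trans (limit_lipschitz _ xs _) _; [exact: ltW|lra|].
    by rewrite mulrC -ler_pdivlMr//; apply: le_trans se; rewrite distrC ler_norm.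
  apply: le_trans (limit_lipschitz _ (ltW sx) _) _; [lra|lra|].
  by rewrite mulrC -ler_pdivlMr//; apply: le_trans se; rewrite ler_norm.
have [c] := EVT_min Tmm cont; rewrite in_itv/= => /andP[c1 c2] cmin.
exists c; first exact: lt_le_trans c1.
apply: norm_small_eq => e e0.
have e3 : 0 < e / 3 by rewrite divr_gt0.
have BC : 0 < B + C + 1 by have := B1; have := C1; lra.
have Tmax0 : 0 <= Tmax by exact: le_trans (ltW Tm0) Tmm.
have [k [n1 [k0 close]]] := limit_approx Tmax0 e3.
have [w [w0 w1 we]] : exists w : R, [/\ 0 < w, w <= 1 & (B + C + 1) * w <= e / 3].
  exists (Num.min 1 (e / 3 / (B + C + 1))); split.
  - by rewrite lt_min ltr01 !divr_gt0.
  - by rewrite ge_min lexx.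
  - by rewrite mulrC -ler_pdivlMr// ge_min lexx orbT.
have [n2 [n02 small]] := small_tail w0.
have ke0 : 0 < Num.min k (e / 3) by rewrite lt_min k0.
have [n [m [/andP[nn nm] yn ym /andP[p1 p2]]]] := ret _ (maxn n1 n2) ke0.
set p := t m - t n in p1 p2.
have ynk : `|y n - l| <= k by apply: le_trans yn _; rewrite ge_min lexx.
have yme : `|y m - l| <= e / 3 by apply: le_trans ym _; rewrite ge_min lexx orbT.
have p0 : 0 <= p by exact: le_trans (ltW Tm0) p1.
have {}close := close n (leq_trans (leq_maxl _ _) nn) ynk p; rewrite p0 p2 in close.
have {}close := close isT.
have [nl tl lmin] := laterP n p.
have lm : (later n p <= m)%N by apply: lmin => //; rewrite /p addrC subrK.
have nn2 : (n2 <= later n p)%N by exact: leq_trans (leq_trans (leq_maxr _ _) nn) nl.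
have mv : `|y m - y (later n p)| <= (B + C + 1) * w.
  apply: window_move => //; first exact: leq_trans n02 nn2.
  - by move: tl; rewrite /p; lra.
  - by have [] := small _ nn2.
have : `|g c - l| <= `|g p - l| by apply: cmin; rewrite in_itv/= p1.
move/le_trans; apply.
have -> : g p - l = (y m - l) - (y m - y (later n p)) - (y (later n p) - g p).
  exact: four_point.
apply: le_trans (_ : e / 3 + (B + C + 1) * w + e / 3 <= _); last by lra.
by apply: normB_le => //; apply: normB_le.
Unshelve. all: by end_near.
Qed.

Lemma limit_periodicn T s k : 0 < T -> g T = l -> 0 <= s -> g (s + k%:R * T) = g s.
Proof.
move=> T0 gT s0; elim: k => [|k IH]; first by rewrite mul0r addr0.
rewrite -addn1 natrD mulrDl mul1r addrA limit_periodic// addr_ge0// mulr_ge0// ltW//.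
Qed.

Lemma limit_extension T : 0 < T -> g T = l -> exists gam : R -> E,
  [/\ gam 0 = l, forall s, gam (s + T) = gam s,
    forall s, exists2 s', 0 <= s' & gam s = g s' &
    forall s h, `|h| <= 1 / 2 -> `|gam (s + h) - gam s - h *: F (gam s)| <=
      (C + K * (B + C)) * h ^+ 2].
Proof.
move=> T0 gT.
have shift_pos s : exists k : nat, 0 <= s + k%:R * T.
  exists (Num.bound (`|s| / T)); have := archi_boundP (divr_ge0 (normr_ge0 s) (ltW T0)).
  rewrite ltr_pdivrMr// => H; have := ler_norm (- s); rewrite normrN; lra.
have /choice[kk kkP] := shift_pos.
pose gam s := g (s + (kk s)%:R * T).
have gamE s k : 0 <= s + k%:R * T -> gam s = g (s + k%:R * T).
  move=> sk; rewrite /gam; have [le|le] := leqP k (kk s).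
    by rewrite -(subnKC le) natrD mulrDl addrA limit_periodicn.
  by rewrite -(subnKC (ltnW le)) natrD mulrDl addrA [RHS]limit_periodicn//; exact: kkP.
have T0' k : 0 <= k%:R * T by rewrite mulr_ge0// ltW.
exists gam; split.
- by rewrite (gamE 0 0%N) ?mul0r ?addr0// limit0.
- move=> s; rewrite (gamE s (kk s).+1) ?(gamE (s + T) (kk s)).
  + by rewrite -addrA -[(kk s).+1%:R]natr1 mulrDl mul1r [T + _]addrC.
  + by rewrite -addrA addrCA addr_ge0// ltW.
  + by rewrite -natr1 mulrDl mul1r addrA addr_ge0// ltW.
- by move=> s; exists (s + (kk s)%:R * T).
move=> s h hh.
(* The margin 1 keeps [s + h] at a nonnegative time after the shift too. *)
have [k ks] : exists k : nat, 1 <= s + k%:R * T by have [k Hk] := shift_pos (s - 1); exists k; lra.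
move: hh; rewrite ler_norml => /andP[h1 h2].
have s0 : 0 <= s + k%:R * T by lra.
have sh0 : 0 <= s + h + k%:R * T by lra.
rewrite (gamE s k)// (gamE (s + h) k)//.
set a := s + k%:R * T in ks s0 *; have -> : s + h + k%:R * T = a + h by rewrite /a; ring.
have ah0 : 0 <= a + h by lra.
have KBC : 0 <= K * (B + C) by rewrite mulr_ge0//; have := B1; have := C1; lra.
have [hp|hn] := leP 0 h.
  have := limit_euler s0 (_ : a <= a + h) _; rewrite [a + h - a]addrAC subrr add0r.
  move=> /(_ _ _)/le_trans; apply; [by rewrite lerDl|lra|].
  by rewrite ler_wpM2r ?sqr_ge0// lerDl.
(* For [h < 0] the forward estimate is used from [a + h]; moving the base point of [F] back to [a]
   costs the extra [K * (B + C) * h ^+ 2]. *)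
have aha : a + h <= a by lra.
have d2 : a - (a + h) <= 1 / 2 by lra.
have H := limit_euler ah0 aha d2; have L := limit_lipschitz ah0 aha d2.
have dE : a - (a + h) = - h by ring.
rewrite dE in H L; rewrite sqrrN in H.
have -> : g (a + h) - g a - h *: F (g a) =
   - (g a - g (a + h) - (- h) *: F (g (a + h))) + (- h) *: (F (g a) - F (g (a + h))).
  rewrite scalerBr !scaleNr !opprK [- (_ - _ + _)]opprD opprB.
  by rewrite [X in _ = _ + X]addrC subrKA.
rewrite mulrDl; apply: normD_le; first by rewrite normrN.
rewrite normrZ; apply: (@le_trans _ _ (`|- h| * (K * `|g a - g (a + h)|))).
  by rewrite ler_wpM2l//; apply: FL; exact: limit_in.
rewrite gtr0_norm ?oppr_gt0//.
apply: (@le_trans _ _ (- h * (K * ((B + C) * - h)))); last by rewrite expr2; lra.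
by apply: ler_wpM2l; [rewrite oppr_ge0 ltW | apply: ler_wpM2l].
Qed.
End Limit.

(** The last clause puts the whole orbit, and not only [l], among the limit points; this is what
    makes the limit set a union of orbits. *)
Theorem periodic_trajectory (l : E) (Tmin Tmax : R) :
  (forall e n1, 0 < e -> exists n, (n1 <= n)%N /\ `|y n - l| <= e) ->
  0 < Tmin ->
  (forall e n1, 0 < e -> exists n m, [/\ (n1 <= n <= m)%N, `|y n - l| <= e,
     `|y m - l| <= e & Tmin <= t m - t n <= Tmax]) ->
  exists (gam : R -> E) (T : R), [/\ 0 < T, gam 0 = l,
    forall s, gam (s + T) = gam s,
    forall s, S (gam s) /\ is_derive s 1 gam (F (gam s)) &
    forall s e n1, 0 < e -> exists n, (n1 <= n)%N /\ `|y n - gam s| <= e].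
Proof.
move=> cl Tmin0 ret.
have : forall j : nat, exists n, (j <= n)%N /\ `|y n - l| <= j.+1%:R^-1.
  by move=> j; apply: cl; rewrite invr_gt0.
move=> /choice[phi phiP].
have yl e : 0 < e -> exists N, forall j, (N <= j)%N -> `|y (phi j) - l| <= e.
  move=> e0; exists (Num.bound e^-1) => j bj; apply: le_trans (phiP j).2 _.
  rewrite -[e]invrK lef_pV2 ?posrE ?invr_gt0//.
  have ei0 : 0 <= e^-1 by rewrite invr_ge0 ltW.
  apply: le_trans (ltW (archi_boundP ei0)) _; rewrite ler_nat.
  exact: leq_trans bj (leqnSn j).
have phi_ge j : (j <= phi j)%N := (phiP j).1.
have [g gP] := limit_exists phi_ge yl.
have [T T0 gT] := period_exists phi_ge yl gP Tmin0 ret.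
have [gam [gam0 gamT gamg gamd]] := limit_extension phi_ge yl gP T0 gT.
exists gam, T; split=> //; last first.
  by move=> s e n1 e0; have [s' s'0 ->] := gamg s; exact: (limit_visited phi_ge gP).
move=> s; split; first by have [s' s'0 ->] := gamg s; exact: (limit_in gP).
exact: euler_is_derive (gamd s).
Qed.
End FlowLimit.

(** * The vector field of the cyclic urn *)

Section PowerShares.
Variable R : realType.
Implicit Types beta a b c u x y : R.

Lemma powR_ratio_le beta x y : 1 <= beta -> 0 <= y <= x -> 0 < x ->
  y `^ beta <= x `^ beta * (y / x).
Proof.
move=> b1 /andP[y0 yx] x0; have yx0 : 0 <= y / x by rewrite divr_ge0// ltW.
have -> : y `^ beta = x `^ beta * (y / x) `^ beta.
  have xyx : x * (y / x) = y by rewrite mulrC divfK// gt_eqF.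
  by rewrite -powRM ?xyx// ltW.
rewrite ler_wpM2l ?powR_ge0//; have [->|n0] := eqVneq y 0.
  by rewrite mul0r powR0// gt_eqF// (lt_le_trans ltr01 b1).
apply: ge1r_powR => //; apply/andP; split; last by rewrite ler_pdivrMr// mul1r.
by rewrite divr_gt0// lt_neqAle eq_sym n0.
Qed.

(** Add the ratio bounds for [y] and [x - y]: the factors [y / x] and [(x - y) / x] sum to 1. *)
Lemma powR_superadd beta x y : 1 <= beta -> 0 <= y <= x ->
  (x - y) `^ beta <= x `^ beta - y `^ beta.
Proof.
move=> b1 /andP[y0 yx]; have b0 : beta != 0 by rewrite gt_eqF// (lt_le_trans ltr01 b1).
have [x0|x0] := leP x 0.
  have -> : x = 0 by lra.
  have -> : y = 0 by lra.
  by rewrite subr0 powR0// subr0.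
rewrite lerBrDr; apply: le_trans (lerD (powR_ratio_le b1 _ x0) (powR_ratio_le b1 _ x0)) _.
- by rewrite subr_ge0 yx lerBlDr lerDl.
- by rewrite y0.
by rewrite -mulrDr -mulrDl subrK divff ?mulr1// gt_eqF.
Qed.

Lemma bernoulli_le u n : 0 <= u <= 1 -> 1 - n%:R * (1 - u) <= u ^+ n.
Proof.
move=> /andP[u0 u1]; elim: n => [|n IH]; first by rewrite mul0r subr0 expr0.
rewrite exprS; apply: le_trans (ler_wpM2l u0 IH).
have n0 : 0 <= n%:R :> R by [].
have := mulr_ge0 n0 (sqr_ge0 (1 - u)); rewrite expr2 -natr1; move: (n%:R) => z; nra.
Qed.

(** Factor out the larger point [x], whose power is at most [x]. For the ratio [u = y / x], the
    power [beta] is at least [u ^+ n], and Bernoulli gives [1 - n * (1 - u) <= u ^+ n]. This works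
    up to the endpoint 0. *)
Lemma powR_lipschitz beta n x y : 1 <= beta -> beta <= n%:R -> 0 <= x <= 1 -> 0 <= y <= 1 ->
  `|x `^ beta - y `^ beta| <= n%:R * `|x - y|.
Proof.
move=> b1 bn; wlog yx : x y / y <= x => [th|].
  have [/th//|/ltW xy hx hy] := leP y x.
  by rewrite distrC [`|x - y|]distrC; apply: th.
move=> /andP[x0 x1] /andP[y0 y1].
rewrite ger0_norm ?subr_ge0; last first.
  by apply: ge0_ler_powR => //; rewrite ?nnegrE ?(le_trans ler01 b1).
rewrite ger0_norm ?subr_ge0//.
have b0 : beta != 0 by rewrite gt_eqF// (lt_le_trans ltr01 b1).
move: x0; rewrite le_eqVlt => /orP[/eqP x0|x0].
  have -> : y = x by lra.
  by rewrite !subrr mulr0.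
have hx : x `^ beta <= x by apply: ge1r_powR => //; rewrite x0.
have u0 : 0 <= y / x by rewrite divr_ge0// ltW.
have u1 : y / x <= 1 by rewrite ler_pdivrMr// mul1r.
have yE : y `^ beta = x `^ beta * (y / x) `^ beta.
  have xyx : x * (y / x) = y by rewrite mulrC divfK// gt_eqF.
  by rewrite -powRM ?xyx// ltW.
have ub : 1 - n%:R * (1 - y / x) <= (y / x) `^ beta.
  apply: le_trans (bernoulli_le _ _) _; first by rewrite u0.
  have n0 : (0 < n)%N by rewrite -(ltr_nat R); apply: lt_le_trans bn; exact: lt_le_trans b1.
  have [->|uu] := eqVneq (y / x) 0; first by rewrite expr0n gtn_eqF// powR0.
  by rewrite -powR_mulrn// ger_powR// u1 lt_neqAle eq_sym uu u0.
have ux : y = y / x * x by rewrite divfK// gt_eqF.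
rewrite yE -[X in X - _]mulr1 -mulrBr.
apply: (@le_trans _ _ (x `^ beta * (n%:R * (1 - y / x)))).
  by rewrite ler_wpM2l ?powR_ge0//; lra.
apply: (@le_trans _ _ (x * (n%:R * (1 - y / x)))).
  by rewrite ler_wpM2r// mulr_ge0// subr_ge0.
by rewrite mulrCA mulrBr mulr1 [x * (y / x)]mulrC -ux.
Qed.

(** The arguments are meant to be rotated: [pr beta b c a] and [pr beta c a b] belong to the other
    two colours. *)
Definition pr beta a b c := a `^ beta / (a `^ beta + b `^ beta + c `^ beta).

Lemma powR_sum_gt0 beta a b c : 0 <= a -> 0 <= b -> 0 <= c -> 0 < a + b + c ->
  0 < a `^ beta + b `^ beta + c `^ beta.
Proof.
move=> a0 b0 c0 s0; have pa := powR_ge0 a beta; have pb := powR_ge0 b beta.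
have pc := powR_ge0 c beta.
have [a1|a1] := ltP 0 a; first by have := powR_gt0 beta a1; lra.
have [b1|b1] := ltP 0 b; first by have := powR_gt0 beta b1; lra.
have c1 : 0 < c by lra.
by have := powR_gt0 beta c1; lra.
Qed.

Lemma pr_ge0 beta a b c : 0 <= pr beta a b c.
Proof. by rewrite /pr divr_ge0 ?addr_ge0 ?powR_ge0. Qed.

Lemma pr_sum beta a b c : 0 <= a -> 0 <= b -> 0 <= c -> 0 < a + b + c ->
  pr beta a b c + pr beta b c a + pr beta c a b = 1.
Proof.
move=> a0 b0 c0 s0; have := powR_sum_gt0 beta a0 b0 c0 s0; rewrite /pr.
move: (a `^ beta) (b `^ beta) (c `^ beta) => u v w s.
rewrite (_ : v + w + u = u + v + w) 1?(_ : w + u + v = u + v + w); [|ring|ring].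
by rewrite -!mulrDl divff// gt_eqF.
Qed.

Lemma pr_scale beta k a b c : 0 < k -> 0 <= a -> 0 <= b -> 0 <= c ->
  pr beta (k * a) (k * b) (k * c) = pr beta a b c.
Proof.
move=> k0 a0 b0 c0; have k0' := ltW k0.
rewrite /pr !powRM// -!mulrDr invfM mulrACA.
by rewrite divff ?mul1r// gt_eqF// powR_gt0.
Qed.

(** On the simplex some coordinate is at least 1/3, so the denominator is at least [s]; the powers
    themselves are Lipschitz. *)
Lemma pr_lipschitz beta : 1 <= beta -> exists K : R, 0 <= K /\
  forall a b c a' b' c', 0 <= a -> 0 <= b -> 0 <= c -> a + b + c = 1 ->
   0 <= a' -> 0 <= b' -> 0 <= c' -> a' + b' + c' = 1 ->
   `|pr beta a b c - pr beta a' b' c'| <= K * (`|a - a'| + `|b - b'| + `|c - c'|).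
Proof.
move=> b1; pose n := Num.bound beta.
have bn : beta <= n%:R by rewrite ltW// archi_boundP// (le_trans ler01 b1).
have b0 : 0 <= beta by exact: le_trans b1.
pose s : R := 3^-1 `^ beta; have s0 : 0 < s by rewrite powR_gt0.
exists (2 * (n%:R / s)); split; first by rewrite mulr_ge0// divr_ge0// ltW.
move=> a b c a' b' c' a0 b_0 c0 S a'0 b'0 c'0 S'.
have sS : s <= a `^ beta + b `^ beta + c `^ beta.
  have pa := powR_ge0 a beta; have pb := powR_ge0 b beta; have pc := powR_ge0 c beta.
  have mono z : 3^-1 <= z -> s <= z `^ beta.
    by move=> z3; apply: ge0_ler_powR => //; rewrite nnegrE//; apply: le_trans z3.
  have [a3|a3] := leP 3^-1 a; first by have := mono _ a3; lra.
  have [b3|b3] := leP 3^-1 b; first by have := mono _ b3; lra.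
  have c3 : 3^-1 <= c by lra.
  by have := mono _ c3; lra.
have S'0 : 0 < a' `^ beta + b' `^ beta + c' `^ beta by apply: powR_sum_gt0 => //; rewrite S'.
have la := @powR_lipschitz beta n a a' b1 bn; have lb := @powR_lipschitz beta n b b' b1 bn.
have lc := @powR_lipschitz beta n c c' b1 bn.
have {}la : `|a `^ beta - a' `^ beta| <= n%:R * `|a - a'|.
  by apply: la; apply/andP; move: a0 b_0 c0 S a'0 b'0 c'0 S'; clear; split; lra.
have {}lb : `|b `^ beta - b' `^ beta| <= n%:R * `|b - b'|.
  by apply: lb; apply/andP; move: a0 b_0 c0 S a'0 b'0 c'0 S'; clear; split; lra.
have {}lc : `|c `^ beta - c' `^ beta| <= n%:R * `|c - c'|.
  by apply: lc; apply/andP; move: a0 b_0 c0 S a'0 b'0 c'0 S'; clear; split; lra.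
have pa' := powR_ge0 a' beta; have pb' := powR_ge0 b' beta; have pc' := powR_ge0 c' beta.
rewrite /pr; move: (a `^ beta) (b `^ beta) (c `^ beta) (a' `^ beta) (b' `^ beta) (c' `^ beta) pa' pb' pc' la lb lc sS S'0.
clear -s0 => u v w u' v' w' pu pv pw lu lv lw sS S'0.
set T := u + v + w in sS *; set T' := u' + v' + w' in S'0 *.
have T0 : 0 < T by exact: lt_le_trans sS.
(* Every difference is divided by [T], which is at least [s], and the remaining ratio [u' / T'] is
   at most 1. *)
have -> : u / T - u' / T' = (u - u') / T + u' / T' * (((u' - u) + (v' - v) + (w' - w)) / T).
  by rewrite /T /T'; field; rewrite -/T -/T' !gt_eqF.
set W := _ + _ + `|c - c'|.
have n0 : 0 <= n%:R :> R by [].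
have q1 : `|u' / T'| <= 1.
  by rewrite ger0_norm ?(divr_ge0 pu (ltW S'0))// ler_pdivrMr// mul1r /T'; lra.
have iT : `|T^-1| <= s^-1.
  by rewrite gtr0_norm ?invr_gt0// lef_pV2.
have Wab : [/\ `|a - a'| <= W, 0 <= W & 0 <= `|b - b'| + `|c - c'|].
  by rewrite /W; split; rewrite ?addr_ge0//; rewrite -addrA lerDl addr_ge0.
have [W1 W2 _] := Wab.
apply: (@le_trans _ _ (n%:R * W * s^-1 + 1 * (n%:R * W * s^-1))); last first.
  by rewrite mul1r le_eqVlt; apply/orP; left; apply/eqP; ring.
apply: normD_le.
  by apply: normM_le => //; apply: le_trans lu _; rewrite ler_wpM2l.
apply: normM_le => //; apply: normM_le => //.
rewrite /W !mulrDr; apply: normD_le; last by rewrite distrC.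
by apply: normD_le; rewrite distrC.
Qed.

(* The rearrangement inequality [sum x_i f(x_i) >= sum x_i f(x_(i+1))] in
   quantitative form. *)
Lemma cyclic_rearrangement beta d a b c : 1 <= beta -> 0 < d -> 0 <= c ->
  c <= a -> c <= b -> (d <= a - c \/ d <= b - c) ->
  d / 2 * (d / 2) `^ beta <= a * (a `^ beta - b `^ beta) + b * (b `^ beta - c `^ beta)
    + c * (c `^ beta - a `^ beta).
Proof.
move=> b1 d0 c0 ca cb dabc; have bp : 0 <= beta by exact: le_trans b1.
have d2 : 0 <= d / 2 by rewrite divr_ge0// ltW.
pose f z := z `^ beta.
have mono x y : 0 <= x -> x <= y -> f x <= f y.
  by move=> x0 xy; apply: ge0_ler_powR => //; rewrite nnegrE//; apply: le_trans xy.
have gap x y : 0 <= y -> d / 2 <= x - y -> (d / 2) `^ beta <= f x - f y.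
  move=> y0 xy; apply: le_trans (powR_superadd b1 _); last by rewrite y0/=; lra.
  exact: (mono _ _ d2).
have fd0 : 0 <= (d / 2) `^ beta by exact: powR_ge0.
rewrite -!/(f _); have fca := mono _ _ c0 ca; have fcb := mono _ _ c0 cb.
have prod u v : d / 2 <= u -> (d / 2) `^ beta <= v -> d / 2 * (d / 2) `^ beta <= u * v.
  by move=> du dv; apply: ler_pM.
have [ab|ba] := leP b a.
  have fab := mono _ _ (le_trans c0 cb) ab.
  have -> : a * (f a - f b) + b * (f b - f c) + c * (f c - f a) =
    (a - c) * (f a - f b) + (b - c) * (f b - f c) by ring.
  have t1 : 0 <= (a - c) * (f a - f b) by apply: mulr_ge0; lra.
  have t2 : 0 <= (b - c) * (f b - f c) by apply: mulr_ge0; lra.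
  have [x|x] := leP (d / 2) (a - b).
    have ac : d / 2 <= a - c by lra.
    by apply: le_trans (prod (a - c) _ ac (gap _ _ (le_trans c0 cb) x)) _; rewrite lerDl.
  have y : d / 2 <= b - c by case: dabc; lra.
  by apply: le_trans (prod (b - c) _ y (gap _ _ c0 y)) _; rewrite lerDr.
have fab := mono _ _ (le_trans c0 ca) (ltW ba).
have -> : a * (f a - f b) + b * (f b - f c) + c * (f c - f a) =
  (a - c) * (f a - f c) + (b - a) * (f b - f c) by ring.
have t1 : 0 <= (a - c) * (f a - f c) by apply: mulr_ge0; lra.
have t2 : 0 <= (b - a) * (f b - f c) by apply: mulr_ge0; lra.
have [x|x] := leP (d / 2) (a - c).
  by apply: le_trans (prod (a - c) _ x (gap _ _ c0 x)) _; rewrite lerDl.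
have y : d / 2 <= b - a by case: dabc; lra.
have z : d / 2 <= b - c by lra.
by apply: le_trans (prod (b - a) _ y (gap _ _ c0 z)) _; rewrite lerDr.
Qed.

(** The pull towards the centre is radial and drops out of the cross product. What remains is a
    sixth of the cyclic sum [G] of [cyclic_rearrangement] over the sum of powers [T], and [T <= 3];
    hence [m / 18]. *)
Lemma rotation_gt0 beta d : 1 <= beta -> 0 < d -> exists b0 : R, 0 < b0 /\
  forall a b c, 0 <= a -> 0 <= b -> 0 <= c -> a + b + c = 1 ->
   (d <= `|a - 1 / 3| \/ d <= `|b - 1 / 3| \/ d <= `|c - 1 / 3|) ->
   b0 <= (b - 1 / 3) * ((pr beta a b c + pr beta b c a) / 2 - a)
       - (a - 1 / 3) * ((pr beta b c a + pr beta c a b) / 2 - b).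
Proof.
move=> b1 d0; have d2 : 0 < d / 2 by rewrite divr_gt0.
pose m := d / 2 * (d / 2) `^ beta; have m0 : 0 < m by rewrite mulr_gt0// powR_gt0.
exists (m / 18); split; first by rewrite divr_gt0.
move=> a b c a0 b0 c0 S far.
have S0 : 0 < a + b + c by rewrite S.
have T0 := powR_sum_gt0 beta a0 b0 c0 S0.
have le1 z : 0 <= z -> z <= 1 -> z `^ beta <= 1.
  move=> z0 z1; have [->|nz] := eqVneq z 0.
    by rewrite powR0// gt_eqF// (lt_le_trans ltr01 b1).
  by apply: (le_trans (ge1r_powR _ b1) z1); rewrite lt_neqAle eq_sym nz z0 z1.
have T3 : a `^ beta + b `^ beta + c `^ beta <= 3.
  have := le1 a a0; have := le1 b b0; have := le1 c c0; lra.
pose G u v w := u * (u `^ beta - v `^ beta) + v * (v `^ beta - w `^ beta)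
  + w * (w `^ beta - u `^ beta).
have Gm : m <= G a b c.
  have abs u : d <= `|u| -> d <= u \/ d <= - u.
    by case: (ger0P u) => _ ?; [left|right].
  (* By the cyclic symmetry of [G] the smallest coordinate may be put last. The mean is 1/3, so a
     deviation of [d] makes one of the others exceed the smallest by [d]. *)
  have key u v w : 0 <= w -> w <= u -> w <= v -> u + v + w = 1 ->
      (d <= `|u - 1 / 3| \/ d <= `|v - 1 / 3| \/ d <= `|w - 1 / 3|) -> m <= G u v w.
    move=> w0 wu wv uvw dist; apply: cyclic_rearrangement => //.
    move: w0 wu wv uvw dist; clear -abs d0 => w0 wu wv uvw dist.
    by case: dist => [/abs[|]|[/abs[|]|/abs[|]]] => ?; have [?|?] := leP u v;
      first [left; lra | right; lra].
  have [ca|ca] := leP c a; have [cb|cb] := leP c b.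
  - exact: key.
  - have -> : G a b c = G c a b by rewrite /G; ring.
    by apply: key => //; [exact: ltW|exact: le_trans (ltW cb) ca|lra|case: far => [|[]]; auto].
  - have -> : G a b c = G b c a by rewrite /G; ring.
    by apply: key => //; [exact: le_trans (ltW ca) cb|exact: ltW|lra|case: far => [|[]]; auto].
  have [ab|ab] := leP a b.
    have -> : G a b c = G b c a by rewrite /G; ring.
    by apply: key => //; [exact: ltW|lra|case: far => [|[]]; auto].
  have -> : G a b c = G c a b by rewrite /G; ring.
  by apply: key => //; [exact: ltW|exact: ltW|lra|case: far => [|[]]; auto].
have S1 : pr beta a b c + pr beta b c a + pr beta c a b = 1 by exact: pr_sum.
set T := a `^ beta + b `^ beta + c `^ beta in T0 T3.
have -> : (b - 1 / 3) * ((pr beta a b c + pr beta b c a) / 2 - a)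
       - (a - 1 / 3) * ((pr beta b c a + pr beta c a b) / 2 - b) =
   (a * (pr beta a b c - pr beta b c a) + b * (pr beta b c a - pr beta c a b)
     + c * (pr beta c a b - pr beta a b c)) / 6.
  have -> : c = 1 - a - b by lra.
  have -> : pr beta (1 - a - b) a b = 1 - pr beta a b (1 - a - b) - pr beta b (1 - a - b) a.
    have E : c = 1 - a - b by lra.
    by rewrite -E; lra.
  by field.
have -> : a * (pr beta a b c - pr beta b c a) + b * (pr beta b c a - pr beta c a b)
     + c * (pr beta c a b - pr beta a b c) = G a b c / T.
  rewrite /pr (_ : b `^ beta + c `^ beta + a `^ beta = T); last by rewrite /T; ring.
  rewrite (_ : c `^ beta + a `^ beta + b `^ beta = T); last by rewrite /T; ring.
  by rewrite -/T /G; ring.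
rewrite -mulrA -invfM ler_pdivlMr; last by rewrite mulr_gt0.
apply: le_trans Gm; rewrite mulrAC ler_pdivrMr// ler_pM2l//; lra.
Qed.

Lemma powR_expansion beta e : 0 < beta -> 0 < e -> exists r : R, 0 < r /\
  forall u, `|u| <= r -> `|(1 + u) `^ beta - 1 - beta * u| <= e * `|u|.
Proof.
move=> b0 e0.
have D : is_derive (1 : R) 1 (@powR R ^~ beta) (beta * 1 `^ (beta - 1)) by exact: is_derive1_powR.
rewrite powR1 mulr1 in D.
have [der val] := D; move: (der) => /cvg_ex[v vP].
have vE : v = beta.
  by rewrite -val /derive; apply/esym/cvg_lim.
rewrite vE in vP; move/cvgrPdist_le : vP => /(_ e e0) H.
have [r /= r0 rP] : exists2 r : R, 0 < r & forall h, `|h| < r -> h != 0 ->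
   `|beta - h^-1 *: ((h *: (1 : R) + 1) `^ beta - 1 `^ beta)| <= e.
  by move: H => [r /= r0 rP]; exists r => // h hr h0; apply: rP => //=; rewrite sub0r normrN.
exists (r / 2); split; first by rewrite divr_gt0.
move=> u ur; have [->|u0] := eqVneq u 0; first by rewrite addr0 powR1 subrr mulr0 subrr normr0 mulr0.
have ur' : `|u| < r by apply: le_lt_trans ur _; rewrite ltr_pdivrMr// ltr_pMr// ltr1n.
have := rP u ur' u0; rewrite powR1 /GRing.scale/= mulr1 [u + 1]addrC => h.
have -> : (1 + u) `^ beta - 1 - beta * u = - ((beta - u^-1 * ((1 + u) `^ beta - 1)) * u).
  by field.
by rewrite normrN normrM ler_wpM2r.
Qed.

(** After scaling by 3 the powers are expanded at 1. The deviations sum to zero, so the denominator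
    has no linear term, and the slope is [3 * beta / 3]. *)
Lemma center_expansion beta e : 0 < beta -> 0 < e -> exists r : R, [/\ 0 < r, r <= 1 / 9 &
  forall a b c, a + b + c = 1 -> `|a - 1 / 3| <= r -> `|b - 1 / 3| <= r -> `|c - 1 / 3| <= r ->
   `|pr beta a b c - 1 / 3 - beta * (a - 1 / 3)| <=
    e * (`|a - 1 / 3| + `|b - 1 / 3| + `|c - 1 / 3|)].
Proof.
move=> b0 e0; pose e1 := Num.min 1 (e / 5).
have e10 : 0 < e1 by rewrite lt_min ltr01 divr_gt0.
have e11 : e1 <= 1 by rewrite ge_min lexx.
have e15 : e1 * 5 <= e by rewrite -ler_pdivlMr// ge_min lexx orbT.
have [r [r0 rP]] := powR_expansion b0 e10.
(* In this order: the denominator stays above 2, [powR_expansion] applies, and [3 * beta] times a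
   deviation is at most 1. *)
pose r1 := Num.min (Num.min (1 / 9) (r / 3)) (1 / (3 * beta)).
exists r1; split.
- by rewrite !lt_min !divr_gt0// mulr_gt0.
- by rewrite !ge_min lexx.
move=> a b c S ar br cr.
have r19 : r1 <= 1 / 9 by rewrite !ge_min lexx.
have r1r : 3 * r1 <= r.
  have : r1 <= r / 3 by rewrite !ge_min lexx !orbT.
  lra.
have r1b : 3 * beta * r1 <= 1.
  by rewrite mulrC -ler_pdivlMr ?mulr_gt0// !ge_min lexx !orbT.
have ex z : `|z - 1 / 3| <= r1 -> exists2 ez, (3 * z) `^ beta = 1 + 3 * beta * (z - 1 / 3) + ez
    & `|ez| <= 3 * e1 * `|z - 1 / 3|.
  move=> zr; exists ((3 * z) `^ beta - 1 - 3 * beta * (z - 1 / 3)); first by ring.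
  have := rP (3 * (z - 1 / 3)); rewrite normrM ger0_norm// => /(_ ltac:(lra)).
  rewrite (_ : 1 + 3 * (z - 1 / 3) = 3 * z); last by field.
  by rewrite (_ : beta * (3 * (z - 1 / 3)) = 3 * beta * (z - 1 / 3)) 1?mulrA 1?[e1 * 3]mulrC//; ring.
have pos z : `|z - 1 / 3| <= r1 -> 0 <= z by rewrite ler_norml => /andP[]; lra.
have := pr_scale beta (ltr0n _ 3 : 0 < 3%:R) (pos a ar) (pos b br) (pos c cr) => <-.
have [ea Ea ea1] := ex a ar; have [eb Eb eb1] := ex b br; have [ec Ec ec1] := ex c cr.
rewrite /pr Ea Eb Ec.
set wa := a - 1 / 3 in ar Ea ea1 *; set wb := b - 1 / 3 in br Eb eb1 *; set wc := c - 1 / 3 in cr Ec ec1 *.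
have W0 : wa + wb + wc = 0 by rewrite /wa /wb /wc; move: S; clear; lra.
set W := `|wa| + `|wb| + `|wc|.
have na := normr_ge0 wa; have nb := normr_ge0 wb; have nc := normr_ge0 wc.
have Wge : 0 <= W by rewrite /W !addr_ge0.
have Wa : `|wa| <= W by rewrite /W -addrA lerDl addr_ge0.
have W3r : W <= 3 * r1 by rewrite /W; move: ar br cr; clear; lra.
have eE : `|ea + eb + ec| <= 3 * e1 * W.
  by rewrite /W !mulrDr; apply: normD_le => //; exact: normD_le.
set E := ea + eb + ec in eE.
have -> : 1 + 3 * beta * wa + ea + (1 + 3 * beta * wb + eb) + (1 + 3 * beta * wc + ec) = 3 + E.
  have -> : wc = - wa - wb by move: W0; clear; lra.
  by rewrite /E; ring.
have W3 : 3 * e1 * W <= 1.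
  apply: (@le_trans _ _ (3 * 1 * (3 * r1))); last by lra.
  by apply: ler_pM W3r; rewrite ?mulr_ge0 ?(ltW e10)//; rewrite ler_pM2l.
have E3 : 2 <= 3 + E by move: eE W3; rewrite ler_norml; clear => /andP[]; lra.
have E30 : 0 < 3 + E by move: E3; clear; lra.
have -> : (1 + 3 * beta * wa + ea) / (3 + E) - 1 / 3 - beta * wa =
   (3 * ea - E - 3 * beta * wa * E) / (3 * (3 + E)) by field; rewrite gt_eqF.
rewrite normrM normfV [`|3 * (3 + E)|]gtr0_norm ?mulr_gt0// ler_pdivrMr ?mulr_gt0//.
have bw : `|3 * beta * wa| <= 1.
  rewrite normrM ger0_norm ?mulr_ge0 ?(ltW b0)//; apply: le_trans r1b.
  by rewrite ler_wpM2l// mulr_ge0// ltW.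
apply: (@le_trans _ _ (3 * (3 * e1 * W) + 3 * e1 * W + 1 * (3 * e1 * W))).
  apply: normB_le; last exact: normM_le.
  apply: normB_le => //; rewrite normrM ger0_norm// ler_pM2l//.
  by apply: le_trans ea1 _; rewrite ler_wpM2l ?mulr_ge0 ?(ltW e10).
apply: (@le_trans _ _ (e * W * (3 * 2))); last first.
  by apply: ler_wpM2l; [rewrite mulr_ge0 ?(ltW e0)// addr_ge0// addr_ge0 | rewrite ler_pM2l].
have : e1 * 5 * W <= e * W by apply: ler_wpM2r.
have : 0 <= e1 * W by rewrite mulr_ge0 ?(ltW e10).
rewrite (_ : 3 * (3 * e1 * W) + 3 * e1 * W + 1 * (3 * e1 * W) = 15 * (e1 * W)); last by ring.
rewrite (_ : e1 * 5 * W = 5 * (e1 * W)); last by ring.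
rewrite (_ : e * W * (3 * 2) = 6 * (e * W)); last by ring.
by move: (e1 * W) (e * W); clear => z1 z2; lra.
Qed.

(** The outward push is computed from [center_expansion]. That the shares are close to 1/3 serves
    the second-moment bound in [log_drift]. *)
Lemma drift_center beta e : 0 < beta -> 0 < e -> exists r : R, 0 < r /\
  forall a b c, a + b + c = 1 ->
  let v := (a - 1 / 3) ^+ 2 + (b - 1 / 3) ^+ 2 + (c - 1 / 3) ^+ 2 in
  let p := (pr beta a b c + pr beta b c a) / 2 in
  let q := (pr beta b c a + pr beta c a b) / 2 in
  let s := (pr beta c a b + pr beta a b c) / 2 in
  v <= r ->
  `|p * (a - 1 / 3) + q * (b - 1 / 3) + s * (c - 1 / 3) - beta / 4 * v| <= e * v /\
  [/\ `|p - 1 / 3| <= e, `|q - 1 / 3| <= e & `|s - 1 / 3| <= e].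
Proof.
move=> b0 e0; have e3 : 0 < e / 3 by rewrite divr_gt0.
have [r [r0 _ rP]] := center_expansion b0 e3.
pose r1 := Num.min r (e / (3 * (beta + e / 3))).
have r10 : 0 < r1.
  by rewrite lt_min r0 divr_gt0// mulr_gt0// addr_gt0.
have r1r : r1 <= r by rewrite ge_min lexx.
have r1e : (beta + e / 3) * (3 * r1) <= e.
  rewrite mulrCA mulrA mulrC -ler_pdivlMr ?mulr_gt0 ?addr_gt0//.
  by rewrite ge_min lexx orbT.
exists (r1 ^+ 2); split; first by rewrite exprn_gt0.
move=> a b c S v p q s vr.
have Sb : b + c + a = 1 by rewrite -S; ring.
have Sc : c + a + b = 1 by rewrite -S; ring.
have rPb := rP b c a Sb; have rPc := rP c a b Sc; have rPa := rP a b c S.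
set wa := a - 1 / 3 in rPa rPb rPc v vr *; set wb := b - 1 / 3 in rPa rPb rPc v vr *.
set wc := c - 1 / 3 in rPa rPb rPc v vr *.
have W0 : wa + wb + wc = 0.
  have -> : wa + wb + wc = a + b + c - 1 by rewrite /wa /wb /wc; field.
  by rewrite S subrr.
have sq z : z ^+ 2 <= v -> `|z| <= r1.
  move=> zv; rewrite -(ger0_norm (ltW r10)) -ler_sqr ?nnegrE//.
  by rewrite !real_normK ?num_real//; apply: le_trans vr.
have a2 := sqr_ge0 wa; have b2 := sqr_ge0 wb; have c2 := sqr_ge0 wc.
have ar : `|wa| <= r1 by apply: sq; rewrite /v; move: a2 b2 c2; clear; lra.
have br : `|wb| <= r1 by apply: sq; rewrite /v; move: a2 b2 c2; clear; lra.
have cr : `|wc| <= r1 by apply: sq; rewrite /v; move: a2 b2 c2; clear; lra.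
have {}rPa := rPa (le_trans ar r1r) (le_trans br r1r) (le_trans cr r1r).
have {}rPb := rPb (le_trans br r1r) (le_trans cr r1r) (le_trans ar r1r).
have {}rPc := rPc (le_trans cr r1r) (le_trans ar r1r) (le_trans br r1r).
set W := `|wa| + `|wb| + `|wc| in rPa.
rewrite (_ : _ + _ + `|wa| = W) in rPb; last by rewrite /W; ring.
rewrite (_ : _ + _ + `|wb| = W) in rPc; last by rewrite /W; ring.
have W2 : W * W <= 3 * v.
  rewrite /W /v -[wa ^+ 2]real_normK ?num_real// -[wb ^+ 2]real_normK ?num_real//.
  rewrite -[wc ^+ 2]real_normK ?num_real// !expr2.
  move: `|wa| `|wb| `|wc| => x y z.
  have := sqr_ge0 (x - y); have := sqr_ge0 (y - z); have := sqr_ge0 (z - x).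
  by rewrite !expr2; lra.
have W3 : W <= 3 * r1 by rewrite /W; move: ar br cr; clear; lra.
have Wge : 0 <= W by rewrite /W !addr_ge0.
set A := pr beta a b c in rPa p s *; set B := pr beta b c a in rPb p q *.
set C := pr beta c a b in rPc q s *.
split.
  have -> : p * wa + q * wb + s * wc - beta / 4 * v =
    ((A - 1 / 3 - beta * wa) * (wa + wc) + (B - 1 / 3 - beta * wb) * (wa + wb)
     + (C - 1 / 3 - beta * wc) * (wb + wc)) / 2.
    have -> : wc = - wa - wb by move: W0; clear; lra.
    rewrite /p /q /s /v (_ : wc = - wa - wb); last by move: W0; clear; lra.
    by field.
  rewrite normrM [`|2^-1|]ger0_norm// ler_pdivrMr//.
  apply: (@le_trans _ _ (e / 3 * (`|wa| + `|wc|) * W + e / 3 * (`|wa| + `|wb|) * W + e / 3 * (`|wb| + `|wc|) * W)).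
    have pw' z x y : `|z| <= e / 3 * W -> `|z * (x + y)| <= e / 3 * (`|x| + `|y|) * W.
      move=> zW; rewrite [leRHS]mulrAC; apply: normM_le => //; exact: ler_normD.
    by apply: normD_le; [apply: normD_le|]; apply: pw'.
  have -> : e / 3 * (`|wa| + `|wc|) * W + e / 3 * (`|wa| + `|wb|) * W + e / 3 * (`|wb| + `|wc|) * W = e / 3 * 2 * (W * W).
    by rewrite /W; ring.
  have : e / 3 * 2 * (W * W) <= e / 3 * 2 * (3 * v) by rewrite ler_pM2l// mulr_gt0.
  lra.
have near z w : `|z - 1 / 3 - beta * w| <= e / 3 * W -> `|w| <= W ->
    `|z - 1 / 3| <= (beta + e / 3) * (3 * r1).
  move=> h1 h2; rewrite -[z - 1 / 3](subrK (beta * w)).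
  apply: (@le_trans _ _ (e / 3 * W + beta * W)).
    by apply: normD_le => //; rewrite normrM gtr0_norm// ler_pM2l.
  rewrite -mulrDl addrC ler_pM2l// addr_gt0//.
have na := normr_ge0 wa; have nb := normr_ge0 wb; have nc := normr_ge0 wc.
have [Wa Wb Wc] : [/\ `|wa| <= W, `|wb| <= W & `|wc| <= W].
  by rewrite /W; move: na nb nc; clear; split; lra.
have Aw : `|A - 1 / 3| <= e by apply: le_trans (near _ _ rPa Wa) r1e.
have Bw : `|B - 1 / 3| <= e by apply: le_trans (near _ _ rPb Wb) r1e.
have Cw : `|C - 1 / 3| <= e by apply: le_trans (near _ _ rPc Wc) r1e.
have avg x y : `|x - 1 / 3| <= e -> `|y - 1 / 3| <= e -> `|(x + y) / 2 - 1 / 3| <= e.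
  by rewrite !ler_norml; clear => /andP[? ?] /andP[? ?]; apply/andP; split; lra.
by split; exact: avg.
Qed.
End PowerShares.

(** * Hitting probabilities on the tree of histories *)

Section Tree.
Context (R : realType) (d : measure_display) (Omega : measurableType d).
Context (P : probability Omega R) (A : 'M[R]_3) (beta : R) (x0 : 'cV[nat]_3).
Context (x : nat -> Omega -> 'cV[nat]_3) (Hx : urn_process P A beta x0 x).

(* A word lists the colours drawn so far, the latest one first. *)
Definition state (w : seq 'I_3) : 'cV[nat]_3 := foldr (fun i c => c + delta_mx i 0) x0 w.

Fixpoint cylinder (w : seq 'I_3) : set Omega :=
  if w is i :: w' then cylinder w' `&` [set o | x (size w').+1 o = x (size w') o + delta_mx i 0]
  else setT.

Definition share i w : R := urn_share A beta (real_vec (state w)) i 0.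

Lemma cylinder_state w o : cylinder w o -> x (size w) o = state w.
Proof.
have [_ x0P _ _] := Hx; elim: w => [|i w IH]/=; first by rewrite x0P.
by move=> [/IH <- ->].
Qed.

Lemma measurable_history n B : history x n B -> measurable B.
Proof.
have [mx _ _ _] := Hx; rewrite /history.
apply: smallest_sub; first exact: sigma_algebra_measurable.
move=> _ [k [i [Y [_ ->]]]]; rewrite -[X in measurable X]setTI.
exact: mx.
Qed.

Lemma history_le n m : (n <= m)%N -> history x n `<=` history x m.
Proof.
move=> nm; apply: sub_sigma_algebra2 => _ [k [i [Y [kn ->]]]].
by exists k, i, Y; split=> //; exact: leq_trans nm.
Qed.

Lemma history_cylinder w : history x (size w) (cylinder w).
Proof.
elim: w => [|i w IH]/=.
  exact: (@measurableT _ (g_sigma_algebraType [set B | exists k (i : 'I_3) (Y : set nat),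
         (k <= 0)%N /\ B = [set w | Y (x k w i 0)]])).
set G := [set B | exists k (i : 'I_3) (Y : set nat),
         (k <= (size w).+1)%N /\ B = [set w | Y (x k w i 0)]].
(* On the cylinder the earlier state is the constant [state w], so the increment condition becomes a
   finite intersection of generators of the history. *)
have -> : cylinder w `&` [set o | x (size w).+1 o = x (size w) o + delta_mx i 0] =
   cylinder w `&` \bigcap_(j in [set: 'I_3]) [set o | [set state (i :: w) j 0] (x (size w).+1 o j 0)].
  apply/seteqP; split=> o [cw h]; split=> //.
    by move=> j _ /=; rewrite h (cylinder_state cw).
  rewrite /=; apply/matrixP => j k; rewrite ord1 (h j Logic.I)/=.
  by rewrite /= (cylinder_state cw).
have mc : @measurable _ (g_sigma_algebraType G) (cylinder w).
  exact: (history_le (leqnSn _)).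
apply: (@measurableI _ (g_sigma_algebraType G)) => //.
apply: (@fin_bigcap_measurable _ (g_sigma_algebraType G)) => // j _.
apply: sub_sigma_algebra; exists (size w).+1, j; by eexists.
Qed.

Lemma measurable_cylinder w : measurable (cylinder w).
Proof. exact: (measurable_history (@history_cylinder w)). Qed.

(** The cylinder belongs to the history, and the conditional probability is constant on it. *)
Lemma prob_cylinder i w : P (cylinder (i :: w)) = ((share i w)%:E * P (cylinder w))%E.
Proof.
have [_ _ _ /(_ (size w) i)[_ _ cond]] := Hx.
rewrite /= setIC cond; last exact: history_cylinder.
rewrite (eq_integral (fun=> (share i w)%:E)).
  by rewrite integral_cst//; exact: measurable_cylinder.
by move=> o; rewrite inE => cw; rewrite /share (cylinder_state cw).
Qed.

Section Hitting.
Context (Bad Dead : pred (seq 'I_3)) (M : seq 'I_3 -> R).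
Context (M0 : forall w, 0 <= M w).
Context (MBad : forall w, Bad w -> 1 <= M w).
Context (supermart : forall w, ~~ Bad w -> ~~ Dead w ->
  \sum_(i < 3) share i w * M (i :: w) <= M w).

(** Badness is tested before deadness, and both stop the recursion; so the drift condition is called
    upon only at words that are neither. *)
Fixpoint hit (k : nat) (w : seq 'I_3) : set Omega :=
  if Bad w then cylinder w else if Dead w then set0 else
  if k is k'.+1 then \big[setU/set0]_(i < 3) hit k' (i :: w) else set0.

Lemma measurable_hit k w : measurable (hit k w).
Proof.
elim: k w => [|k IH] w /=; case: ifP => _; do ?case: ifP => _ //;
  try exact: measurable_cylinder.
by apply: bigsetU_measurable => i _; exact: IH.
Qed.

(** Maximal inequality for nonnegative supermartingales: the event splits over the next colour, and
    the drift condition recombines the three inductive bounds. *)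
Lemma hit_le k w : (P (hit k w) <= (M w)%:E * P (cylinder w))%E.
Proof.
elim: k w => [|k IH] w /=; case: ifPn => [/MBad M1|nb].
- by rewrite -[leLHS]mul1e lee_wpmul2r// lee_fin.
- by case: ifP => _; rewrite measure0 mule_ge0// lee_fin.
- by rewrite -[leLHS]mul1e lee_wpmul2r// lee_fin.
case: ifPn => [_|nd]; first by rewrite measure0 mule_ge0// lee_fin.
have := supermart nb nd; rewrite !big_ord_recl !big_ord0 addr0 => sm.
rewrite setU0; apply: le_trans (measureU2 _ _ _) _; try exact: measurable_hit.
  by apply: measurableU; exact: measurable_hit.
apply: (@le_trans _ _ (P (hit k (ord0 :: w)) + (P (hit k (lift ord0 ord0 :: w))
   + P (hit k (lift ord0 (lift ord0 ord0) :: w))))%E).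
  by rewrite leeD2l// measureU2//; exact: measurable_hit.
have bnd i : (P (hit k (i :: w)) <= (share i w * M (i :: w))%:E * P (cylinder w))%E.
  apply: le_trans (IH _) _; rewrite [P (cylinder _)]prob_cylinder.
  by rewrite muleA -EFinM [M _ * _]mulrC.
apply: le_trans (leeD (bnd _) (leeD (bnd _) (bnd _))) _.
have fP : P (cylinder w) \is a fin_num by exact: fin_num_measure (measurable_cylinder w).
rewrite -(fineK fP) -!EFinM -!EFinD lee_fin -!mulrDl ler_wpM2r//.
exact: fine_ge0.
Qed.

Definition hitting w : set Omega := \bigcup_k hit k w.

Lemma measurable_hitting w : measurable (hitting w).
Proof. by apply: bigcup_measurable => k _; exact: measurable_hit. Qed.

Lemma hit_mono k w : hit k w `<=` hit k.+1 w.
Proof.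
elim: k w => [|k IH] w o; first by rewrite /=; case: ifP => // _; case: ifP.
rewrite [hit k.+1 w]/= [hit k.+2 w]/=; case: ifP => // _; case: ifP => // _.
by rewrite -!bigcup_mkord_ord => -[i i3 /IH ?]; exists i.
Qed.

Lemma hitting_le w : (P (hitting w) <= (M w)%:E * P (cylinder w))%E.
Proof.
have cv := @nondecreasing_cvg_mu _ _ _ P (fun k => hit k w) (measurable_hit^~ w)
  (measurable_hitting w) _.
have {}cv : P (hit k w) @[k --> \oo] --> P (hitting w).
  apply: cv; apply/nondecreasing_seqP => k; rewrite subsetEset; exact: hit_mono.
rewrite -(cvg_lim _ cv)//; apply: lime_le; first by apply/cvg_ex; eexists; exact: cv.
by apply: nearW => k; exact: hit_le.
Qed.

(** The branch of the tree of words that the outcome [o] follows. *)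
Definition path_of (o : Omega) (W : nat -> seq 'I_3) := W 0%N = [::] /\
  forall n, (exists i, W n.+1 = i :: W n) /\ cylinder (W n) o.

Lemma path_size o W n : path_of o W -> size (W n) = n.
Proof.
move=> [W0 WS]; elim: n => [|n IH]; first by rewrite W0.
by have [[i ->] _] := WS n; rewrite /= IH.
Qed.

Lemma path_hitting o W n k : path_of o W ->
  (forall j, (j < k)%N -> ~~ Dead (W (n + j)%N)) -> Bad (W (n + k)%N) ->
  hitting (W n) o.
Proof.
move=> [W0 WS] dead bad; exists k => //; elim: k n dead bad => [|k IH] n dead bad.
  by rewrite /= -[in Bad _](addn0 n) bad; case: (WS n).
rewrite /=; case: ifP => _; first by case: (WS n).
rewrite ifN; last by have := dead 0%N isT; rewrite addn0.
have [[i iE] _] := WS n; rewrite -bigcup_mkord_ord.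
exists i; first exact: ltn_ord.
rewrite inord_val -iE; apply: IH; last by rewrite addSnnS.
by move=> j jk; rewrite addSnnS; apply: dead.
Qed.
End Hitting.

Lemma negligible_words (N : seq 'I_3 -> set Omega) :
  (forall w, P.-negligible (N w)) -> P.-negligible (\bigcup_w N w).
Proof.
move=> negN; pose F n := if unpickle n is Some w then N w else set0.
have sub : \bigcup_w N w `<=` \bigcup_n F n.
  by move=> o [w _ Nw]; exists (pickle w) => //; rewrite /F pickleK.
apply: negligibleS sub _; apply: negligible_bigcup => n; rewrite /F.
by case: (unpickle n) => [w|]; [exact: negN|exact: negligible_set0].
Qed.

Lemma cylinder_disjoint i j w : i != j -> cylinder (i :: w) `&` cylinder (j :: w) = set0.
Proof.
move=> ij; apply/seteqP; split=> // o [[cw xi] [_ xj]].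
move: xi; rewrite /= xj => /matrixP/(_ i 0); rewrite !mxE !eqxx/= (negbTE ij)/=.
by move=> /eqP; rewrite eqn_add2l.
Qed.

(** An outcome whose increments are not all unit vectors follows no branch. As the shares sum to 1,
    the three children of a word carry its whole probability; each of the countably many words thus
    loses only a null set. *)
Lemma ae_path : (forall w, \sum_(i < 3) share i w = 1) ->
  {ae P, forall o, exists W, path_of o W}.
Proof.
move=> sum1.
pose U w := cylinder (ord0 :: w) `|` (cylinder (lift ord0 ord0 :: w)
  `|` cylinder (lift ord0 (lift ord0 ord0) :: w)).
pose N w := cylinder w `\` U w.
have mc := measurable_cylinder.
have negN w : P.-negligible (N w).
  have mU : measurable (U w) by do 2?[apply: measurableU]; exact: mc.
  exists (N w); split=> //; first exact: measurableD.
  have PU : P (U w) = P (cylinder w).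
    rewrite /U measureU//; [|by apply: measurableU| ]; last first.
      by rewrite setIUr !cylinder_disjoint// setU0.
    rewrite measureU//; last by rewrite cylinder_disjoint.
    have fP : P (cylinder w) \is a fin_num by exact: fin_num_measure (mc w).
    transitivity (P (cylinder (ord0 :: w)) + (P (cylinder (lift ord0 ord0 :: w))
      + P (cylinder (lift ord0 (lift ord0 ord0) :: w))))%E; first by [].
    rewrite !prob_cylinder -(fineK fP) -!EFinM -!EFinD -!mulrDl.
    have := sum1 w; rewrite !big_ord_recl big_ord0 addr0 => ->.
    by rewrite mul1r.
  rewrite measureD// -?ge0_fin_numE// ?fin_num_measure//.
  have -> : cylinder w `&` U w = U w.
    by apply/setIidPr => o [[]|[[]|[]]].
  transitivity (P (cylinder w) - P (U w))%E; first by [].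
  by rewrite PU subee// fin_num_measure.
apply: negligibleS (negligible_words negN) => o /= noW.
apply: contrapT => oN; apply: noW.
have ext w : exists i, cylinder w o -> cylinder (i :: w) o.
  have [cw|] := pselect (cylinder w o); last by exists ord0.
  apply: contrapT => h; apply: oN; exists w => //; split=> // -[|[|]] cw';
    by apply: h; eexists=> _; exact: cw'.
move: ext => /choice[f fP].
exists (fix W n := if n is n'.+1 then f (W n') :: W n' else [::]); split=> // n.
split; first by eexists.
by elim: n => // n IH; exact: fP.
Qed.
End Tree.

(** * The cyclic urn in terms of words *)

Notation i0 := (@ord0 2).
Notation i1 := (lift (@ord0 2) (@ord0 1)).
Notation i2 := (lift (@ord0 2) (lift (@ord0 1) (@ord0 0))).

Lemma sum3 (V : nmodType) (F : 'I_3 -> V) : \sum_(i < 3) F i = F i0 + (F i1 + F i2).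
Proof. by rewrite !big_ord_recl big_ord0 addr0. Qed.

Lemma ord3P (Q : 'I_3 -> Prop) : Q i0 -> Q i1 -> Q i2 -> forall i, Q i.
Proof.
move=> q0 q1 q2 i; case: (unliftP ord0 i) => [j|] ->//.
case: (unliftP ord0 j) => [k|] ->//; by rewrite (ord1 k).
Qed.

Section CyclicShare.
Variable R : realType.
Implicit Types (beta : R) (v : 'cV[R]_3).

Definition avg beta (a b c : R) := (pr beta a b c + pr beta b c a) / 2.

Definition next_share beta v : 'I_3 -> R :=
  let a := v i0 0 in let b := v i1 0 in let c := v i2 0 in
  fun i => nth 0 [:: avg beta a b c; avg beta b c a; avg beta c a b] i.

Lemma urn_shareE beta v i : urn_share (cyclic_matrix R) beta v i 0 = next_share beta v i.
Proof.
have uE : [/\ urn_u (cyclic_matrix R) beta v i0 0 = v i0 0 `^ beta + v i1 0 `^ beta,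
   urn_u (cyclic_matrix R) beta v i1 0 = v i1 0 `^ beta + v i2 0 `^ beta &
   urn_u (cyclic_matrix R) beta v i2 0 = v i2 0 `^ beta + v i0 0 `^ beta].
  by split; rewrite /urn_u !mxE sum3 !mxE /=; ring.
have [u0 u1 u2] := uE; rewrite /urn_share mxE sum3 u0 u1 u2.
rewrite /next_share /avg /pr; move: (v i0 0 `^ beta) (v i1 0 `^ beta) (v i2 0 `^ beta) u0 u1 u2.
move=> a b c u0 u1 u2.
have -> : a + b + (b + c + (c + a)) = 2 * (a + b + c) by ring.
rewrite (_ : b + c + a = a + b + c); last by ring.
rewrite (_ : c + a + b = a + b + c); last by ring.
rewrite invfM; move: i; apply: ord3P; rewrite ?u0 ?u1 ?u2 /=; ring.
Qed.
End CyclicShare.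

Section UrnWords.
Context (R : realType) (x0 : 'cV[nat]_3) (beta : R).
Context (n0_gt0 : (0 < ball_count x0)%N).
Local Notation n0 := (ball_count x0).
Local Notation st := (state x0).

Definition total (w : seq 'I_3) : R := (size w + n0)%N%:R.
Definition prop_vec w : 'cV[R]_3 := (total w)^-1 *: real_vec (st w).
Definition prop (i : 'I_3) w : R := prop_vec w i 0.
Definition gain w : R := (total w + 1)^-1.
Definition dist2 w : R := (prop i0 w - 1 / 3) ^+ 2 + (prop i1 w - 1 / 3) ^+ 2 + (prop i2 w - 1 / 3) ^+ 2.
Local Notation sh := (share (cyclic_matrix R) beta x0).

Lemma total_gt0 w : 0 < total w.
Proof. by rewrite ltr0n addn_gt0 n0_gt0 orbT. Qed.

Lemma total_cons i w : total (i :: w) = total w + 1.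
Proof. by rewrite /total /= addSn -addn1 natrD. Qed.

Lemma gain_gt0 w : 0 < gain w.
Proof. by rewrite invr_gt0 addr_gt0// total_gt0. Qed.

Lemma propE i w : prop i w = (st w i 0)%:R / total w.
Proof. by rewrite /prop !mxE mulrC. Qed.

Lemma prop_ge0 i w : 0 <= prop i w.
Proof. by rewrite propE divr_ge0// ltW// total_gt0. Qed.

Lemma ball_count_state w : ball_count (st w) = (size w + n0)%N.
Proof.
elim: w => //= i w IH; rewrite addSn -IH /ball_count -[RHS]addn1.
rewrite (eq_bigr (fun j => st w j 0%R + (j == i))%N).
  rewrite big_split/=; congr addn; rewrite (bigD1 i)//= eqxx big1 ?addn0//.
  by move=> j /negbTE ->.
by move=> j _; rewrite !mxE eqxx andbT; case: (j == i).
Qed.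

Lemma prop_sum w : prop i0 w + prop i1 w + prop i2 w = 1.
Proof.
rewrite !propE -!mulrDl -!natrD -addnA.
have H : ball_count (st w) = (st w i0 0%R + (st w i1 0%R + st w i2 0%R))%N by exact: sum3.
by rewrite -H ball_count_state divff// gt_eqF// total_gt0.
Qed.

Lemma prop_cons i j w : prop j (i :: w) = prop j w + gain w * ((i == j)%:R - prop j w).
Proof.
rewrite !propE total_cons /= !mxE eqxx andbT eq_sym natrD /gain.
have t0 := total_gt0 w.
move: (total w) t0 (st w j 0) => T t0 k; case: (i == j); field;
  by rewrite !gt_eqF// addr_gt0.
Qed.

(** Shares are invariant under scaling, so counts may be replaced by proportions. *)
Lemma share_next i w : sh i w = next_share beta (prop_vec w) i.
Proof.
rewrite /share urn_shareE /next_share -/(prop i0 w) -/(prop i1 w) -/(prop i2 w) !propE.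
have t0 := total_gt0 w; have t1 : 0 < (total w)^-1 by rewrite invr_gt0.
by rewrite /avg ![_ / total w]mulrC !pr_scale// !mxE.
Qed.

Lemma sh0 w : sh i0 w = avg beta (prop i0 w) (prop i1 w) (prop i2 w).
Proof. by rewrite share_next. Qed.
Lemma sh1 w : sh i1 w = avg beta (prop i1 w) (prop i2 w) (prop i0 w).
Proof. by rewrite share_next. Qed.
Lemma sh2 w : sh i2 w = avg beta (prop i2 w) (prop i0 w) (prop i1 w).
Proof. by rewrite share_next. Qed.

Lemma share_ge0 i w : 0 <= sh i w.
Proof.
move: i; apply: ord3P; rewrite ?sh0 ?sh1 ?sh2; apply: divr_ge0 => //; apply: addr_ge0; exact: pr_ge0.
Qed.

Lemma share_sum w : sh i0 w + sh i1 w + sh i2 w = 1.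
Proof.
rewrite sh0 sh1 sh2 /avg; have S := prop_sum w.
have := pr_sum beta (prop_ge0 i0 w) (prop_ge0 i1 w) (prop_ge0 i2 w).
by rewrite S ltr01 => /(_ isT); lra.
Qed.

(** The new deviation is [1 - gain w] times the old one plus [gain w] times the vector from the
    centre to a corner, of squared length 2/3. Since deviations sum to zero, the inner product is a
    single coordinate. *)
Lemma dist2_cons i w : dist2 (i :: w) = (1 - gain w) ^+ 2 * dist2 w
  + 2 * gain w * (1 - gain w) * (prop i w - 1 / 3) + 2 / 3 * gain w ^+ 2.
Proof.
rewrite /dist2 !prop_cons; move: (prop_sum w) (gain w).
move: i; apply: ord3P; rewrite /=; move: (prop i0 w) (prop i1 w) (prop i2 w) => a b c S g;
  (have -> : c = 1 - a - b by rewrite -S; ring).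
all: by rewrite /=; field.
Qed.

Lemma dist2_ge0 w : 0 <= dist2 w.
Proof. by rewrite /dist2 !addr_ge0// sqr_ge0. Qed.

Definition mean_dev w := sh i0 w * (prop i0 w - 1 / 3) + sh i1 w * (prop i1 w - 1 / 3)
  + sh i2 w * (prop i2 w - 1 / 3).

Lemma dist2_mean w : \sum_(i < 3) sh i w * dist2 (i :: w) =
  (1 - gain w) ^+ 2 * dist2 w + 2 * gain w * (1 - gain w) * mean_dev w + 2 / 3 * gain w ^+ 2.
Proof.
rewrite sum3 !dist2_cons /mean_dev; have := share_sum w.
move: (sh i0 w) (sh i1 w) (sh i2 w) => p q s S.
have -> : s = 1 - p - q by rewrite -S; ring.
ring.
Qed.

Lemma mean_dev_center e : 0 < beta -> 0 < e -> exists r : R, 0 < r /\ forall w, dist2 w <= r ->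
  `|mean_dev w - beta / 4 * dist2 w| <= e * dist2 w /\ forall i, `|sh i w - 1 / 3| <= e.
Proof.
move=> b0 e0; have [r [r0 rP]] := drift_center b0 e0; exists r; split=> // w wr.
have := rP _ _ _ (prop_sum w) wr; rewrite -!/(avg _ _ _ _) -sh0 -sh1 -sh2 => -[H [H0 H1 H2]].
by split=> //; exact: ord3P.
Qed.
End UrnWords.

(** * Convergence to the centre below the critical exponent *)

Section ReachCenter.
Context (R : realType) (d : measure_display) (Omega : measurableType d).
Context (P : probability Omega R) (beta : R) (x0 : 'cV[nat]_3).
Context (x : nat -> Omega -> 'cV[nat]_3).
Context (Hx : urn_process P (cyclic_matrix R) beta x0 x) (b0 : 0 < beta).
Local Notation n0 := (ball_count x0).
Local Notation st := (state x0).
Local Notation sh := (share (cyclic_matrix R) beta x0).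
Local Notation cyl := (cylinder x).

Lemma n0_gt0 : (0 < n0)%N. Proof. by case: Hx. Qed.

Lemma avg_gt0 (a b c : R) : 0 <= a -> 0 <= b -> 0 <= c -> (0 < a \/ 0 < b) -> 0 < avg beta a b c.
Proof.
move=> a0 b_0 c0 ab; have s0 : 0 < a + b + c by case: ab; lra.
have T := powR_sum_gt0 beta a0 b_0 c0 s0.
have s1 : 0 < b + c + a by lra.
have T' := powR_sum_gt0 beta b_0 c0 a0 s1.
have p1 := pr_ge0 beta a b c; have p2 := pr_ge0 beta b c a.
rewrite /avg divr_gt0//; case: ab => h.
  by rewrite ltr_pwDl// /pr divr_gt0// powR_gt0.
by rewrite ltr_wpDl// /pr divr_gt0// powR_gt0.
Qed.

Lemma prop_gt0 i w : (0 < st w i 0%R)%N -> 0 < prop R x0 i w.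
Proof. by move=> h; rewrite propE; apply: divr_gt0; [rewrite ltr0n | apply: total_gt0; exact: n0_gt0]. Qed.

(** In the cyclic matrix, colour [i] is reinforced by itself and by [next_colour i]. *)
Definition next_colour (i : 'I_3) : 'I_3 := nth i0 [:: i1; i2; i0] i.

Lemma share_gt0 i w : (0 < st w i 0%R)%N \/ (0 < st w (next_colour i) 0%R)%N -> 0 < sh i w.
Proof.
have p j : 0 <= prop R x0 j w by rewrite prop_ge0// n0_gt0.
move: i; apply: ord3P => h; rewrite ?sh0 ?sh1 ?sh2 ?n0_gt0//; apply: avg_gt0 => //;
  by case: h => /prop_gt0; [left|right].
Qed.

Lemma cylinder_cons_gt0 i w : (0 < P (cyl w))%E ->
  (0 < st w i 0%R)%N \/ (0 < st w (next_colour i) 0%R)%N -> (0 < P (cyl (i :: w)))%E.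
Proof. by move=> Pw h; rewrite (prob_cylinder Hx) mule_gt0// lte_fin share_gt0. Qed.

Lemma state_cons_ge i j w : (st w j 0%R <= st (i :: w) j 0%R)%N.
Proof. by rewrite /= !mxE leq_addr. Qed.

Lemma state_cons_gt0 i w : (0 < st (i :: w) i 0%R)%N.
Proof. by rewrite /= !mxE !eqxx/= addn_gt0 orbT. Qed.

Definition all_positive w := forall j, (0 < st w j 0%R)%N.

(** From a colour [j] that is present, draw the colour whose successor is [j], then the colour whose
    successor is the one just drawn. *)
Lemma reach_all_positive : exists w, (0 < P (cyl w))%E /\ all_positive w.
Proof.
have P0 : (0 < P (cyl [::]))%E by rewrite /= probability_setT.
have [j jp] : exists j, (0 < st [::] j 0%R)%N.
  apply/not_existsP => h; have := n0_gt0; rewrite /ball_count big1// => i _.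
  by have := h i; case: (x0 i 0%R) => // n /(_ isT).
pose a := next_colour (next_colour j); pose b := next_colour j.
have nb : next_colour a = j by rewrite /a; move: {jp b} j {a}; exact: ord3P.
have na : next_colour b = a by [].
have P1 : (0 < P (cyl [:: a]))%E by apply: cylinder_cons_gt0 => //; right; rewrite nb.
have P2 : (0 < P (cyl [:: b; a]))%E.
  by apply: cylinder_cons_gt0 => //; right; rewrite na; exact: state_cons_gt0.
exists [:: b; a]; split=> // k.
have : k = j \/ k = a \/ k = b.
  rewrite /a /b; move: k; move: {jp nb na P1 P2 a b} j; apply: ord3P; apply: ord3P; by [left|right; left|right; right].
case=> [->|[->|->]].
- by apply: leq_trans jp _; apply: leq_trans (state_cons_ge a j [::]) (state_cons_ge _ _ _).
- by apply: leq_trans (state_cons_gt0 a [::]) (state_cons_ge _ _ _).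
- exact: state_cons_gt0.
Qed.

Lemma add_many i k w : (0 < P (cyl w))%E -> all_positive w ->
  let w' := nseq k i ++ w in
  [/\ (0 < P (cyl w'))%E, all_positive w', st w' i 0 = (st w i 0%R + k)%N &
    forall j, j != i -> st w' j 0 = st w j 0].
Proof.
move=> Pw pos /=; elim: k => [|k [IH1 IH2 IH3 IH4]] /=; first by split; rewrite ?addn0.
split.
- by apply: cylinder_cons_gt0 => //; left.
- by move=> j; apply: leq_trans (IH2 j) (state_cons_ge _ _ _).
- by rewrite !mxE !eqxx/= IH3 addnS -[RHS]addn1.
- by move=> j ji; rewrite !mxE (negbTE ji)/= IH4// addr0.
Qed.

Lemma reach_center N : exists w, [/\ (0 < P (cyl w))%E, (N <= size w)%N & dist2 R x0 w = 0].
Proof.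
have [w [Pw pos]] := reach_all_positive.
(* A common target above the three counts, so that the truncated differences are exact; [N] and [n0]
   make the word long enough. *)
pose m := (st w i0 0%R + st w i1 0%R + st w i2 0%R + N + n0)%N.
have [P1 pos1 s1 o1] := add_many i0 (m - st w i0 0%R) Pw pos.
set w1 := _ ++ w in P1 pos1 s1 o1.
have [P2 pos2 s2 o2] := add_many i1 (m - st w i1 0%R) P1 pos1.
set w2 := _ ++ w1 in P2 pos2 s2 o2.
have [P3 pos3 s3 o3] := add_many i2 (m - st w i2 0%R) P2 pos2.
set w3 := _ ++ w2 in P3 pos3 s3 o3.
have e0 : st w3 i0 0 = m by rewrite o3// o2// s1 subnKC// /m -!addnA leq_addr.
have e1 : st w3 i1 0 = m by rewrite o3// s2 o1// subnKC// /m [(_ + st w i1 0%R)%N]addnC -!addnA leq_addr.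
have e2 : st w3 i2 0 = m.
  by rewrite s3 o2// o1// subnKC// /m [(_ + st w i2 0%R)%N]addnC -!addnA leq_addr.
have tot : (size w3 + n0 = m + (m + m))%N.
  rewrite -(ball_count_state x0); transitivity (st w3 i0 0%R + (st w3 i1 0%R + st w3 i2 0%R))%N.
    exact: sum3.
  by rewrite e0 e1 e2.
exists w3; split=> //.
  rewrite -(leq_add2r n0) tot; apply: leq_trans (leq_addr _ _).
  by rewrite /m -addnA leq_addl.
have m0 : (0 < m)%N by rewrite /m !addn_gt0 n0_gt0 orbT.
have mR : 0 < m%:R :> R by rewrite ltr0n.
clearbody m.
have pE i : st w3 i 0 = m -> prop R x0 i w3 = 1 / 3.
  move=> e; rewrite propE e /total tot !natrD; move: (m%:R : R) mR => z z0.
  have -> : z + (z + z) = 3 * z by ring.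
  by field; rewrite gt_eqF.
by rewrite /dist2 !pE// subrr expr0n/= !addr0.
Qed.
End ReachCenter.

(** * Norms, the harmonic clock and measurability along paths *)

Section Vectors.
Context (R : realType).

Lemma norm_cV_le (v : 'cV[R]_3) (e : R) : 0 <= e -> (`|v| <= e) = [forall i, `|v i 0| <= e].
Proof.
move=> e0; rewrite {1}/Num.Def.normr/= mx_normrE.
apply/idP/forallP => [h i|h].
  apply: le_trans h; exact: (le_bigmax _ (fun ij : 'I_3 * 'I_1 => `|v ij.1 ij.2|) (i, 0)).
by apply/bigmax_leP; split=> // -[i j] _ /=; rewrite (ord1 j).
Qed.

Lemma cvgn_epsilon (V : normedModType R) (y : nat -> V) (l : V) :
  (y @ \oo --> l) <-> (forall e, 0 < e -> exists N, forall n, (N <= n)%N -> `|y n - l| <= e).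
Proof.
split=> [/cvgrPdist_le h e e0|h].
  by have [N _ NP] := h e e0; exists N => n Nn; rewrite distrC; exact: NP.
apply/cvgrPdist_le => e e0; have [N NP] := h e e0.
by exists N => // n /= Nn; rewrite distrC; exact: NP.
Qed.

Lemma harmonic_unbounded (m : nat) (A : R) :
  exists n, A <= \sum_(k < n) (k + m).+1%:R^-1.
Proof.
have dv : series (@harmonic R) x @[x --> \oo] --> +oo.
  apply: nondecreasing_dvgn_lt; last exact: dvg_harmonic.
  by apply: nondecreasing_series => n _ _; rewrite invr_ge0.
move/cvgryPge : dv => /(_ (A + series harmonic m))[n _ nP].
have := nP (maxn n m) (leq_maxl _ _) => {nP}.
rewrite /series/= => H; exists (maxn n m - m)%N; move: H.
rewrite [leRHS](big_cat_nat (n := m))//= ?leq_maxr// [leRHS]addrC lerD2r.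
rewrite -{1}[m]add0n big_addn big_mkord => /le_trans; apply.
by rewrite le_eqVlt; apply/orP; left; apply/eqP/eq_bigr => k _; rewrite /harmonic.
Qed.
End Vectors.

(** As [lam >= 1], the new factor is at most [lam * (1 + c' * g)], and
    [(1 + c' * g) * (1 - c' * g) <= 1]: the growth uses up a part [c'] of the contraction rate. The
    condition on [q] holds for [g = 1 / (n + 1)] and [q = 1 / n]; the decrease of [2 * q] absorbs
    the variance of a draw. *)
Lemma contraction_step (R : realFieldType) (c c' g v mu lam q : R) :
  0 <= c' -> c' <= c -> c' <= 1 / 3 -> 0 <= g -> g <= 1 / 2 -> 0 <= v -> 1 <= lam ->
  mu <= (1 - c) * v -> g * (1 + g) <= q ->
  (lam + c' * g) * ((1 - g) ^+ 2 * v + 2 * g * (1 - g) * mu + 2 / 3 * g ^+ 2 + 2 * g)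
    <= lam * (v + 2 * q).
Proof.
move=> c'0 c'c c'3 g0 g2 v0 lam1 muv gq.
have g1 : 0 <= 1 - g by lra.
have s1 : 2 * g * (1 - g) * mu <= 2 * g * (1 - g) * ((1 - c) * v).
  by apply: ler_wpM2l muv; rewrite !mulr_ge0.
have c0 : 0 <= c by lra.
have s2 : (1 - g) ^+ 2 * v + 2 * g * (1 - g) * ((1 - c) * v) <= v * (1 - c' * g).
  have : 0 <= v * (g * g) by rewrite !mulr_ge0.
  have : 0 <= v * (g * (c * (1 - 2 * g))) by rewrite !mulr_ge0//; lra.
  have : 0 <= v * (g * (c - c')) by rewrite !mulr_ge0//; lra.
  by rewrite expr2; lra.
set Z := _ + _ + _ + 2 * g; have Z1 : Z <= v * (1 - c' * g) + g * (2 + g).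
  have gg : 0 <= g * g by rewrite mulr_ge0.
  rewrite /Z (_ : v * (1 - c' * g) + g * (2 + g) = v * (1 - c' * g) + (g * g + 2 * g)); last by ring.
  rewrite -addrA; apply: lerD; first exact: le_trans (lerD (lexx _) s1) s2.
  by rewrite expr2; lra.
have cg : 0 <= c' * g by rewrite mulr_ge0.
have Z2 : 0 <= v * (1 - c' * g) + g * (2 + g).
  apply: addr_ge0; apply: mulr_ge0 => //; last by rewrite addr_ge0.
  have := ler_pM c'0 g0 c'3 g2; lra.
apply: (@le_trans _ _ ((lam * (1 + c' * g)) * (v * (1 - c' * g) + g * (2 + g)))).
  apply: (@le_trans _ _ ((lam + c' * g) * (v * (1 - c' * g) + g * (2 + g)))).
    by rewrite ler_wpM2l// addr_ge0//; lra.
  rewrite ler_wpM2r// mulrDr mulr1 lerD2l -[leLHS]mul1r ler_wpM2r//.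
rewrite -mulrA ler_wpM2l; [|lra|]; first by lra.
have : (1 + c' * g) * (v * (1 - c' * g)) <= v.
  have : 0 <= v * (c' * g) * (c' * g) by rewrite !mulr_ge0.
  lra.
have : (1 + c' * g) * (g * (2 + g)) <= 2 * (g * (1 + g)).
  have : 0 <= g * g * (1 / 3 - c') by rewrite !mulr_ge0//; lra.
  have : 0 <= g * g * c' * (1 / 2 - g) by rewrite !mulr_ge0//; lra.
  have : 0 <= g * g by rewrite mulr_ge0.
  lra.
lra.
Qed.

Section Paths.
Context (R : realType) (d : measure_display) (Omega : measurableType d).
Context (P : probability Omega R) (A : 'M[R]_3) (beta : R) (x0 : 'cV[nat]_3).
Context (x : nat -> Omega -> 'cV[nat]_3) (Hx : urn_process P A beta x0 x).

Lemma proportions_path o W n : path_of x o W -> proportions x0 x n o = prop_vec R x0 (W n).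
Proof.
move=> pW; have sW := path_size n pW; rewrite /proportions /prop_vec /total sW.
by have [_ /(_ n)[_ /(cylinder_state Hx)]] := pW; rewrite sW => ->.
Qed.

Lemma path_unique o W w : path_of x o W -> cylinder x w o -> W (size w) = w.
Proof.
move=> [W0 WS]; elim: w => [//|i w IH] cw.
have [[j jE] cj] := WS (size w); have Ww := IH cw.1; rewrite Ww in jE.
have [_ cj1] := WS (size w).+1; rewrite jE in cj1 *.
have [->//|ji] := eqVneq j i.
by have /seteqP[/(_ o)] := cylinder_disjoint x w ji; case.
Qed.

Lemma measurable_event n (Q : 'cV[nat]_3 -> bool) : measurable [set o | Q (x n o)].
Proof.
have [mx _ _ _] := Hx.
have -> : [set o | Q (x n o)] = \bigcup_k [set o | (if unpickle k is Some c then Q c && (x n o == c) else false)].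
  apply/seteqP; split=> o /=.
    by move=> q; exists (pickle (x n o)) => //=; rewrite pickleK q eqxx.
  by move=> [k _ /=]; case: unpickle => // c /andP[q /eqP ->].
apply: bigcup_measurable => k _; case: unpickle => [c|]; last first.
  by rewrite (_ : mkset _ = set0)//; apply/seteqP; split.
have [q|q] := boolP (Q c); last first.
  by rewrite (_ : mkset _ = set0)//; apply/seteqP; split.
have -> : [set o | true && (x n o == c)] = \bigcap_(i in [set: 'I_3]) ((fun o => x n o i 0) @^-1` [set c i 0]).
  apply/seteqP; split=> o /=; first by move=> /eqP xE i _ /=; rewrite xE.
  by move=> h; apply/eqP/matrixP => i j; rewrite (ord1 j); exact: (h i Logic.I).
by apply: fin_bigcap_measurable => // i _; rewrite -[X in measurable X]setTI; exact: mx.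
Qed.

Lemma measurable_cvg (l : 'cV[R]_3) :
  measurable [set o | (fun n => proportions x0 x n o) @ \oo --> l].
Proof.
pose B k n o := `|proportions x0 x n o - l| <= k.+1%:R^-1 :> R.
have -> : [set o | (fun n => proportions x0 x n o) @ \oo --> l] =
    \bigcap_k \bigcup_N \bigcap_n [set o | (N <= n)%N ==> B k n o].
  apply/seteqP; split=> o /=.
    move=> /cvgn_epsilon h k _; have [|N NP] := h k.+1%:R^-1; first by rewrite invr_gt0.
    by exists N => // n _ /=; apply/implyP; exact: NP.
  move=> h; apply/cvgn_epsilon => e e0.
  have [N _ NP] := h (Num.bound e^-1) Logic.I; exists N => n Nn.
  have := NP n Logic.I; rewrite /= Nn /= => /le_trans; apply.
  have ei0 : 0 <= e^-1 by rewrite invr_ge0 ltW.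
  rewrite -[leRHS]invrK lef_pV2 ?posrE ?invr_gt0//.
  by apply: le_trans (ltW (archi_boundP ei0)) _; rewrite ler_nat.
apply: bigcap_measurable => // k _; apply: bigcup_measurable => N _.
apply: bigcap_measurable => // n _.
exact: (@measurable_event n (fun c => (N <= n)%N ==>
  (`|((n + ball_count x0)%N%:R)^-1 *: real_vec c - l| <= k.+1%:R^-1))).
Qed.
End Paths.

Section Converges.
Context (R : realType) (d : measure_display) (Omega : measurableType d).
Context (P : probability Omega R) (beta : R) (x0 : 'cV[nat]_3).
Context (x : nat -> Omega -> 'cV[nat]_3).
Context (Hx : urn_process P (cyclic_matrix R) beta x0 x) (b0 : 0 < beta) (b4 : beta < 4).
Local Notation n0 := (ball_count x0).
Local Notation sh := (share (cyclic_matrix R) beta x0).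
Local Notation v := (dist2 R x0).

Theorem converges_with_positive_probability :
  (0 < P [set w | (fun n => proportions x0 x n w) @ \oo --> (const_mx (1 / 3)%R : 'cV[R]_3)])%E.
Proof.
have n0p := n0_gt0 Hx.
(* Half of the spectral gap; the other half pays for the linearisation error. *)
pose c : R := (1 - beta / 4) / 2; have c0 : 0 < c by have := b4; rewrite /c; lra.
have [r [r0 rP]] := mean_dev_center n0p b0 c0.
pose c' : R := Num.min c (1 / 3).
have c'0 : 0 < c' by rewrite lt_min c0 divr_gt0.
(* At this length [2 / total <= r / 2], so [M w0 <= 1 / 2]. *)
have [w0 [Pw0 sw0 vw0]] := reach_center Hx (Num.bound (4 / r)).
pose lam n : R := 1 + c' * \sum_(size w0 <= k < n) (k + n0).+1%:R^-1.
have lam1 n : 1 <= lam n.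
  by rewrite lerDl mulr_ge0 ?(ltW c'0)// sumr_ge0// => i _; rewrite invr_ge0.
pose M w := lam (size w) * (v w + 2 * (total R x0 w)^-1) / r.
(* Words that are not bad satisfy [v w <= r / lam (size w)]. Words shorter than [w0] are dead
   because [lam] does not yet grow by [c' * gain] there. *)
pose Bad w := 1 <= M w; pose Dead (w : seq 'I_3) := (size w < size w0)%N.
have tp := total_gt0 R n0p.
have q0 w : 0 <= v w + 2 * (total R x0 w)^-1.
  by rewrite addr_ge0 ?dist2_ge0// mulr_ge0// invr_ge0 ltW.
have M0 w : 0 <= M w.
  by rewrite divr_ge0 ?(ltW r0)// mulr_ge0// (le_trans ler01).
have small w : ~~ Bad w -> v w <= r / lam (size w).
  rewrite -ltNge ltr_pdivrMr// mul1r => Mr; have l0 := lt_le_trans ltr01 (lam1 (size w)).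
  rewrite ler_pdivlMr// mulrC; apply: le_trans (ltW Mr); rewrite ler_pM2l// lerDl.
  by rewrite mulr_ge0// invr_ge0 ltW.
have sm w : ~~ Bad w -> ~~ Dead w -> \sum_(i < 3) sh i w * M (i :: w) <= M w.
  move=> nb; rewrite -leqNgt => nd.
  have vr : v w <= r.
    apply: le_trans (small _ nb) _; rewrite ler_pdivrMr ?(lt_le_trans ltr01)//.
    by rewrite ler_peMr// ltW.
  have [mu _] := rP w vr.
  have -> : \sum_(i < 3) sh i w * M (i :: w) = lam (size w).+1 *
     (\sum_(i < 3) sh i w * v (i :: w) + 2 * gain R x0 w) / r.
    rewrite !sum3 /M !total_cons -/(gain R x0 w) /=.
    have := share_sum beta n0p w; move: (sh i0 w) (sh i1 w) (sh i2 w) => p q s S.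
    have -> : s = 1 - p - q by rewrite -S; ring.
    by rewrite /gain; ring.
  rewrite ler_pM2r ?invr_gt0// dist2_mean//.
  have -> : lam (size w).+1 = lam (size w) + c' * gain R x0 w.
    rewrite /lam big_nat_recr//= mulrDr addrA; congr (_ + _ * _).
    by rewrite /gain /total natr1.
  have g0 := gain_gt0 R n0p w.
  apply: (@contraction_step _ c) => //; rewrite ?(ltW c'0) ?(ltW g0) ?dist2_ge0//.
  - by rewrite ge_min lexx.
  - by rewrite ge_min lexx orbT.
  - rewrite /gain div1r lef_pV2 ?posrE ?addr_gt0//.
    have : 1 <= total R x0 w by rewrite ler1n addn_gt0 n0p orbT.
    lra.
  - move: mu; rewrite ler_norml => /andP[_]; rewrite /c; lra.
  - have t0 := tp w; rewrite /gain; move: (total R x0 w) t0 => T T0.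
    rewrite -subr_ge0 (_ : T^-1 - _ = T^-1 * (T + 1)^-1 ^+ 2).
      by rewrite mulr_ge0 ?invr_ge0 ?sqr_ge0// ltW.
    by field; rewrite !gt_eqF// addr_gt0.
have MB w : Bad w -> 1 <= M w by [].
have hle := hitting_le Hx M0 MB sm w0.
set H := hitting _ _ _ _ in hle; set E := [set w | _].
have mH : measurable H by exact: (measurable_hitting Hx).
have mE : measurable E by exact: (measurable_cvg Hx).
have mC : measurable (cylinder x w0) by exact: (measurable_cylinder Hx).
have fC : P (cylinder x w0) \is a fin_num by exact: fin_num_measure mC.
have M2 : M w0 <= 1 / 2.
  rewrite /M /lam big_geq// mulr0 addr0 mul1r vw0 add0r ler_pdivrMr//.
  have h4 : 4 / r <= total R x0 w0.
    apply: le_trans (ltW (archi_boundP _)) _; first by rewrite divr_ge0// ltW.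
    by rewrite ler_nat (leq_trans sw0)// leq_addr.
  rewrite ler_pdivrMr// in h4; rewrite ler_pdivrMr//.
  by move: h4; rewrite mulrC; lra.
have PD : (0 < P (cylinder x w0 `\` H))%E.
  rewrite measureD//; last by rewrite -ge0_fin_numE.
  have le2 : (P (cylinder x w0 `&` H) <= (1 / 2)%:E * P (cylinder x w0))%E.
    apply: le_trans (le_trans hle _); first by apply: le_measure; rewrite ?inE//; exact: measurableI.
    by apply: lee_wpmul2r => //; rewrite lee_fin.
  have lt2 : ((1 / 2)%:E * P (cylinder x w0) < P (cylinder x w0))%E.
    rewrite -(fineK fC) -EFinM lte_fin gtr_pMl; first lra.
    by rewrite -lte_fin fineK.
  by rewrite sube_gt0; exact: le_lt_trans le2 lt2.
have [Z [mZ PZ sZ]] := ae_path Hx (fun w => etrans (sum3 _) (etrans (addrA _ _ _) (share_sum beta n0p w))).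
have sub : cylinder x w0 `\` H `<=` E `|` Z.
  move=> o [cw nH]; have [oZ|oZ] := pselect (Z o); first by right.
  left; have [W pW] : exists W, path_of x o W.
    by apply: contrapT => nW; apply: oZ; exact: sZ.
  have nBad n : (size w0 <= n)%N -> ~~ Bad (W n).
    move=> wn; apply/negP => bad; apply: nH; rewrite /H -(path_unique pW cw).
    apply: (path_hitting pW (k := n - size w0)); last by rewrite subnKC.
    by move=> j _; rewrite /Dead (path_size _ pW) -leqNgt leq_addr.
  apply/cvgn_epsilon => e e0.
  have [m mP] := @harmonic_unbounded R (size w0 + n0) (r / (e ^+ 2) / c').
  exists (m + size w0)%N => n mn; rewrite (proportions_path Hx n pW) norm_cV_le ?(ltW e0)//.
  have wn : (size w0 <= n)%N by apply: leq_trans mn; exact: leq_addl.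
  have := small _ (nBad n wn); rewrite (path_size n pW) => vn.
  have lamn : r / e ^+ 2 <= lam n.
    apply: (@le_trans _ _ (c' * \sum_(size w0 <= k < n) (k + n0).+1%:R^-1)); last by rewrite lerDr.
    rewrite -ler_pdivrMl// mulrC; apply: le_trans mP _.
    rewrite -[X in \sum_(X <= _ < _) _]add0n big_addn.
    rewrite [leRHS](big_cat_nat (n := m))//=; last by rewrite leq_subRL// addnC.
    rewrite big_mkord; apply: (@le_trans _ _ (\sum_(i < m) (i + size w0 + n0).+1%:R^-1)).
      by apply: ler_sum => k _; rewrite addnA.
    by rewrite lerDl sumr_ge0// => i _; rewrite invr_ge0.
  have e20 : 0 < e ^+ 2 by rewrite exprn_gt0.
  have ve : v (W n) <= e ^+ 2.
    apply: le_trans vn _; rewrite ler_pdivrMr ?(lt_le_trans ltr01)//.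
    by rewrite mulrC -ler_pdivrMr.
  apply/forallP => i.
  have -> : (prop_vec R x0 (W n) - const_mx (1 / 3)%R) i 0 = prop R x0 i (W n) - 1 / 3.
    by rewrite /prop !mxE.
  rewrite -ler_sqr ?nnegrE ?(ltW e0)// real_normK ?num_real//; apply: le_trans ve.
  have a0 := sqr_ge0 (prop R x0 i0 (W n) - 1 / 3); have a1 := sqr_ge0 (prop R x0 i1 (W n) - 1 / 3).
  have a2 := sqr_ge0 (prop R x0 i2 (W n) - 1 / 3).
  by move: i; apply: ord3P; rewrite /dist2; move: a0 a1 a2;
    move: (_ ^+ 2) (_ ^+ 2) (_ ^+ 2) => *; lra.
have : (P (cylinder x w0 `\` H) <= P E + P Z)%E.
  apply: le_trans (le_measure P _ _ sub) (measureU2 _ mE mZ).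
    by rewrite inE; exact: measurableD.
  by rewrite inE; exact: measurableU.
rewrite [X in (_ + X)%E](_ : _ = 0%E) ?adde0; last exact: PZ.
exact: lt_le_trans PD.
Qed.
End Converges.

(** * The logarithm of the squared distance above the critical exponent *)

Lemma ln_quadratic_lower (R : realType) (e : R) : 0 < e -> exists dl : R, [/\ 0 < dl, dl <= 1 / 2 &
  forall X, `|X| <= dl -> X - (1 / 2 + e) * X ^+ 2 <= ln (1 + X)].
Proof.
move=> e0; pose a := 1 + 2 * e; have a0 : 0 < a by rewrite /a; lra.
exists (Num.min (1 / 2) (2 * e / a)); split.
- by rewrite lt_min !divr_gt0// mulr_gt0.
- by rewrite ge_min lexx.
move=> X; rewrite le_min => /andP[X2]; rewrite ler_pdivlMr// => Xe.
pose f (z : R) := ln (1 + z) - z + (1 / 2 + e) * z ^+ 2.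
pose df (z : R) := (1 + z)^-1 - 1 + (1 / 2 + e) * (z *+ 2).
suff : 0 <= f X by rewrite /f; lra.
have f0 : f 0 = 0 by rewrite /f addr0 ln1 subrr expr0n/= mulr0 addr0.
have der (z : R) : -1 < z -> is_derive z (1 : R) f (df z).
  move=> z1; have p : 0 < 1 + z by lra.
  have h1 : is_derive z (1 : R) (cst 1 + id : R -> R) (1 : R).
    by apply: is_derive_eq; rewrite add0r.
  have h2 : is_derive z (1 : R) (@ln R \o (cst 1 + id : R -> R)) ((1 + z)^-1).
    apply: is_derive_eq; first exact: (is_derive1_comp (is_derive1_ln p) h1).
    by rewrite mulr1.
  have h3 : is_derive z (1 : R) ((1 / 2 + e) *: (id ^+ 2 : R -> R)) ((1 / 2 + e) * (z *+ 2)).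
    apply: is_derive_eq; rewrite /GRing.scale/= expr1 mulr1.
    by rewrite mulr_natl.
  have -> : f = (@ln R \o (cst 1 + id : R -> R)) - id + (1 / 2 + e) *: (id ^+ 2 : R -> R).
    by apply/funext.
  exact: (is_deriveD (is_deriveB h2 (is_derive_id z 1)) h3).
have cont (u v : R) : -1 < u -> {within `[u, v], continuous f}.
  move=> u1; apply: derivable_within_continuous => z; rewrite in_itv/= => /andP[uz _].
  by have [] := der z (lt_le_trans u1 uz).
(* While [|z| <= 2 * e / a] the derivative has the sign of [z], so 0 is a minimum of [f]. *)
have dfz (z : R) : -1 < z -> df z * (1 + z) = z * (2 * e + a * z).
  move=> z1; have p : 1 + z != 0 by rewrite gt_eqF//; lra.
  by rewrite /df /a; field.
have [X0|X0] := leP 0 X.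
  have [||c cX] := @MVT_segment R f df 0 X X0.
  - by move=> z; rewrite in_itv/= => /andP[z0 _]; apply: der; lra.
  - by apply: cont; lra.
  rewrite in_itv/= in cX; case/andP: cX => c0 cX.
  rewrite f0 !subr0 => ->; apply: mulr_ge0 => //.
  have p : 0 < 1 + c by lra.
  rewrite -(pmulr_lge0 _ p) dfz; last lra.
  by rewrite mulr_ge0// addr_ge0 ?mulr_ge0 ?(ltW e0)// ltW.
rewrite ltr0_norm// in X2 Xe.
have [||c cX] := @MVT_segment R f df X 0 (ltW X0).
- by move=> z; rewrite in_itv/= => /andP[z0 _]; apply: der; lra.
- by apply: cont; lra.
rewrite in_itv/= in cX; case/andP: cX => Xc c0.
rewrite f0 sub0r sub0r => E; suff : df c * - X <= 0 by lra.
have p : 0 < 1 + c by lra.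
apply: mulr_le0_ge0; last by lra.
rewrite -(pmulr_lle0 _ p) dfz; last lra.
apply: mulr_le0_ge0 => //.
have : a * (- c) <= a * (- X) by rewrite ler_pM2l//; lra.
lra.
Qed.

Section LogDrift.
Context (R : realType).

(* Discriminant condition: [27 K <= 2 c] makes the quadratic form in
   [(v, g)] on the right nonnegative. *)
Lemma drift_quadratic (c B K e g v : R) : 0 < c -> 1 <= B -> 0 < K -> 27 * K <= 2 * c ->
  K <= 1 / 12 -> 0 < e -> 9 * e <= K -> e <= 1 -> 0 < g -> (12 * B + 6) * g <= c / 2 ->
  (6 * B + 6) * g <= e -> 9 * g <= K -> 0 <= v ->
  (1 / 2 + e) * (4 * g ^+ 2 * ((1 / 3 + e) * v) + 4 * g * (B * v) * (2 * g * v + g ^+ 2)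
     + (2 * g * v + g ^+ 2) ^+ 2)
  <= (v + K * g) * (g * c * v + g ^+ 2 * (2 / 3 - 2 * K)).
Proof.
move=> c0 B1 K0 Kc K12 e0 eK e1 g0 gc ge gK v0.
have gv : 0 <= g * v by rewrite mulr_ge0// ltW.
have ggv : 0 <= g * (g * v) by rewrite mulr_ge0// ltW.
have g3 : 0 <= g * (g * g) by rewrite !mulr_ge0// ltW.
have gvv : 0 <= g * (v * v) by rewrite !mulr_ge0// ltW.
pose T := 8 * B * (g ^+ 2 * v ^+ 2) + 4 * B * (g ^+ 3 * v) + 4 * (g ^+ 2 * v ^+ 2)
  + 4 * (g ^+ 3 * v) + g ^+ 4.
have [B0 gp] : 0 <= B /\ 0 <= g by move: B1 g0; clear; split; lra.
have T0 : 0 <= T by rewrite /T !addr_ge0 ?mulr_ge0 ?exprn_ge0.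
have step1 : (1 / 2 + e) * (4 * g ^+ 2 * ((1 / 3 + e) * v) + 4 * g * (B * v) * (2 * g * v + g ^+ 2)
     + (2 * g * v + g ^+ 2) ^+ 2) <= (2 / 3 + 8 * e) * (g * (g * v)) + 3 / 2 * T.
  rewrite (_ : _ + (2 * g * v + g ^+ 2) ^+ 2 = (4 / 3 + 4 * e) * (g * (g * v)) + T); last first.
    by rewrite /T; field.
  rewrite mulrDr; apply: lerD.
    rewrite mulrA ler_wpM2r//; have : e * e <= e * 1 by rewrite ler_pM2l.
    lra.
  by rewrite ler_wpM2r//; lra.
apply: le_trans step1 _.
have T1 : 3 / 2 * T <= (12 * B + 6) * g * (g * (v * v)) + (6 * B + 6) * g * (g * (g * v))
   + 3 / 2 * g * (g * (g * g)).
  by rewrite le_eqVlt; apply/orP; left; apply/eqP; rewrite /T; field.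
have t1 : (12 * B + 6) * g * (g * (v * v)) <= c / 2 * (g * (v * v)) by rewrite ler_wpM2r.
have t2 : (6 * B + 6) * g * (g * (g * v)) <= e * (g * (g * v)) by rewrite ler_wpM2r.
have t3 : 3 / 2 * g * (g * (g * g)) <= K / 6 * (g * (g * g)).
  by rewrite ler_wpM2r//; lra.
apply: (@le_trans _ _ ((2 / 3 + 9 * e) * (g * (g * v)) + c / 2 * (g * (v * v)) + K / 6 * (g * (g * g)))).
  by move: T1 t1 t2 t3; move: (3 / 2 * T) => T' *; lra.
have k1 : K * (1 / 2) * (g * (g * g)) <= K * (2 / 3 - 2 * K) * (g * (g * g)).
  by rewrite ler_wpM2r// ler_pM2l//; lra.
have e9 : 9 * e * (g * (g * v)) <= K * (g * (g * v)) by rewrite ler_wpM2r.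
have Kcgv : 0 <= K * c * (g * (g * v)) by rewrite !mulr_ge0// ltW.
suff sq : 3 * K * (g * (g * v)) <= c / 2 * (g * (v * v)) + K / 3 * (g * (g * g)).
  rewrite (_ : (v + K * g) * _ = c * (g * (v * v)) + (2 / 3 - 2 * K) * (g * (g * v)) + K * c * (g * (g * v)) + K * (2 / 3 - 2 * K) * (g * (g * g))); last by field.
  lra.
have : 0 <= g * (c / 2 * v ^+ 2 - 3 * K * (g * v) + K / 3 * g ^+ 2); last by rewrite !expr2; lra.
apply: mulr_ge0; first exact: ltW.
have key : 0 <= 2 * c * (c / 2 * v ^+ 2 - 3 * K * (g * v) + K / 3 * g ^+ 2).
  rewrite (_ : 2 * c * _ = (c * v - 3 * K * g) ^+ 2 + (K * (2 * c - 27 * K) / 3) * g ^+ 2); last by field.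
  apply: addr_ge0; first exact: sqr_ge0.
  apply: mulr_ge0; last exact: sqr_ge0.
  by rewrite divr_ge0// mulr_ge0 ?subr_ge0// ltW.
by rewrite pmulr_rge0 in key; last by rewrite mulr_gt0.
Qed.
(* With [X = r i / q - 1], [ln (1 + X) >= X - (1 / 2 + e) X^2] reduces the claim to
   [drift_quadratic]; [s] is chosen so that [q] is [v + K / n] and [r i] its value
   after colour [i] is drawn. *)
Lemma log_drift (c B : R) : 0 < c -> 1 <= B -> exists K e g0 : R, [/\ 0 < K, K <= 1, 0 < e & 0 < g0] /\
  forall (g s v m : R) (w p : 'I_3 -> R), 0 < g -> g <= g0 -> s * (1 - g) = g ->
   v = w i0 ^+ 2 + w i1 ^+ 2 + w i2 ^+ 2 -> 
   (forall i, 0 <= p i <= 1 / 3 + e) -> p i0 + p i1 + p i2 = 1 ->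
   m = p i0 * w i0 + p i1 * w i1 + p i2 * w i2 -> (1 + c) * v <= m <= B * v ->
   let q := v + K * s in
   let r i := (1 - g) ^+ 2 * v + 2 * g * (1 - g) * w i + 2 / 3 * g ^+ 2 + K * g in
   0 < q /\ ln q <= p i0 * ln (r i0) + p i1 * ln (r i1) + p i2 * ln (r i2).
Proof.
move=> c0 B1.
pose K := Num.min (1 / 12) (2 * c / 27).
have K0 : 0 < K by rewrite lt_min !divr_gt0// mulr_gt0.
have K12 : K <= 1 / 12 by rewrite ge_min lexx.
have Kc : 27 * K <= 2 * c by rewrite mulrC -ler_pdivlMr// ge_min lexx orbT.
clearbody K.
pose e := K / 9; have e0 : 0 < e by rewrite divr_gt0.
have eK : 9 * e <= K by rewrite /e; lra.
clearbody e.
have e1 : e <= 1 by lra.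
have [dl [dl0 dl2 lnP]] := ln_quadratic_lower e0.
have [g0 [g00 [[ga gb gd] [ge gf gh gi]]]] : exists g0 : R, 0 < g0 /\ 
   [/\ (12 * B + 6) * g0 <= c / 2, (6 * B + 6) * g0 <= e & 9 * g0 <= K] /\
   [/\ 4 * g0 <= dl ^+ 2 * K, 4 * g0 <= dl, 2 * g0 <= dl * K & 2 * (1 + c) * g0 <= c].
  have Bp : 0 < 12 * B + 6 by lra.
  have Bq : 0 < 6 * B + 6 by lra.
  have cp : 0 < 2 * (1 + c) by lra.
  have dK : 0 < dl ^+ 2 * K by rewrite mulr_gt0// exprn_gt0.
  have dK' : 0 < dl * K by rewrite mulr_gt0.
  exists (Num.min (c / 2 / (12 * B + 6)) (Num.min (e / (6 * B + 6)) (Num.min (K / 9) (Num.min (dl ^+ 2 * K / 4) (Num.min (dl / 4) (Num.min (dl * K / 2) (c / (2 * (1 + c))))))))).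
  split; first by rewrite !lt_min !divr_gt0.
  by split; split; rewrite mulrC -ler_pdivlMr// !ge_min lexx ?orbT.
exists K, e, g0; split; first by split=> //; lra.
move=> g s v m w p gp gg sg vE pB pS mE /andP[m1 m2] q r.
have mul a : 0 <= a -> a * g <= a * g0 by move=> a0; rewrite ler_wpM2l.
have {}ga : (12 * B + 6) * g <= c / 2 by apply: le_trans (mul _ _) ga; lra.
have {}gb : (6 * B + 6) * g <= e by apply: le_trans (mul _ _) gb; lra.
have {}gd : 9 * g <= K by apply: le_trans (mul _ _) gd.
have {}ge : 4 * g <= dl ^+ 2 * K by apply: le_trans (mul _ _) ge.
have {}gf : 4 * g <= dl by apply: le_trans (mul _ _) gf.
have {}gh : 2 * g <= dl * K by apply: le_trans (mul _ _) gh.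
have {}gi : 2 * (1 + c) * g <= c by apply: le_trans (mul _ _) gi; lra.
have {mul gg g00} g2 : g <= 1 / 2 by lra.
have v0 : 0 <= v by rewrite vE !addr_ge0// sqr_ge0.
have s0 : 0 < s by rewrite -(pmulr_lgt0 _ (_ : 0 < 1 - g)) ?sg//; lra.
have sgs : s = g + s * g by move: sg; clear; lra.
have gs : g <= s by rewrite sgs lerDl mulr_ge0// ltW.
have s2 : s <= 2 * g by have : s * g <= s * (1 / 2); [rewrite ler_pM2l | lra].
have Kg0 : 0 < K * g by rewrite mulr_gt0.
have qge : v + K * g <= q by rewrite /q lerD2l ler_pM2l.
have q0 : 0 < q by apply: lt_le_trans qge; rewrite ltr_wpDl.
split=> //.
pose a := 2 * g * (1 - g); pose rho := - (2 * g - g ^+ 2) * v + 2 / 3 * g ^+ 2 - K * (g * s).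
have a0 : 0 <= a by rewrite /a !mulr_ge0 ?(ltW gp)//; move: g2; clear; lra.
have a2 : a <= 2 * g by rewrite /a ler_piMr ?mulr_ge0 ?(ltW gp)//; move: gp; clear; lra.
have rE i : r i = q + (a * w i + rho).
  rewrite /r /q /a /rho; suff : K * g = K * s - K * (g * s) by move=> ->; ring.
  by rewrite {1}sgs; ring.
have aE : a = 2 * g * (1 - g) by [].
have rhoE : rho = - (2 * g - g ^+ 2) * v + 2 / 3 * g ^+ 2 - K * (g * s) by [].
clearbody a rho.
have aa : a ^+ 2 <= 4 * g ^+ 2.
  by rewrite (_ : 4 * g ^+ 2 = (2 * g) ^+ 2) ?ler_sqr ?nnegrE ?(le_trans a0)//; ring.
have g20 : 0 <= g ^+ 2 by exact: sqr_ge0.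
have gv : 0 <= g * v by rewrite mulr_ge0// ltW.
have ggv : 0 <= g ^+ 2 * v by rewrite mulr_ge0.
have Kgs0 : 0 <= K * (g * s) by rewrite !mulr_ge0// ltW.
have Kgs : K * (g * s) <= K * (2 * g ^+ 2).
  by rewrite ler_pM2l// expr2 mulrCA ler_pM2l.
have Kgg : K * (2 * g ^+ 2) <= 1 / 12 * (2 * g ^+ 2) by rewrite ler_wpM2r// mulr_ge0.
have ggv1 : g ^+ 2 * v <= g * v by rewrite expr2 -mulrA ler_piMl//; move: g2; clear; lra.
have rhoB : `|rho| <= 2 * g * v + g ^+ 2.
  rewrite rhoE mulNr mulrBl ler_norml; move: Kgs0 Kgs Kgg g20 gv ggv ggv1.
  by clear; move=> *; apply/andP; split; lra.
have q1 : 0 < v + K * g by rewrite ltr_wpDl.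
have wv i : w i ^+ 2 <= v.
  have x0 := sqr_ge0 (w i0); have x1 := sqr_ge0 (w i1); have x2 := sqr_ge0 (w i2).
  rewrite vE; move: x0 x1 x2; move: i; clear.
  by apply: ord3P => /=; move: (w i0 ^+ 2) (w i1 ^+ 2) (w i2 ^+ 2) => *; lra.
(* The term [K * g] keeps relative increments small even at the centre:
   [4 * v * (K * g) <= (v + K * g) ^+ 2] bounds the part linear in [w i]. *)
have XB i : `|a * w i + rho| <= dl * q.
  apply: (@le_trans _ _ (dl * (v + K * g))); last by rewrite ler_pM2l.
  rewrite (_ : dl * (v + K * g) = dl / 2 * (v + K * g) + dl / 2 * (v + K * g)); last by field.
  apply: normD_le.
    have d2 : 0 <= dl / 2 * (v + K * g) by rewrite mulr_ge0 ?divr_ge0// ltW.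
    rewrite -(ger0_norm d2) -ler_sqr ?nnegrE// !real_normK ?num_real// exprMn [leRHS]exprMn.
    apply: (@le_trans _ _ (4 * g ^+ 2 * v)).
      by apply: ler_pM; rewrite ?sqr_ge0.
    apply: (@le_trans _ _ (dl ^+ 2 * K * (g * v))).
      by rewrite (_ : 4 * g ^+ 2 * v = 4 * g * (g * v)); [rewrite ler_wpM2r | ring].
    have sq := sqr_ge0 (v - K * g).
    rewrite (_ : (dl / 2) ^+ 2 * (v + K * g) ^+ 2 = dl ^+ 2 * K * (g * v) + (dl / 2) ^+ 2 * (v - K * g) ^+ 2); last by field.
    by rewrite lerDl mulr_ge0 ?sqr_ge0.
  apply: le_trans rhoB _.
  have : 4 * g * v <= dl * v by rewrite ler_wpM2r.
  have : 2 * g * g <= dl * K * g by rewrite ler_pM2r.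
  by rewrite expr2; clear; lra.
pose X i := (a * w i + rho) / q.
have Xdl i : `|X i| <= dl.
  by rewrite /X normrM normfV (gtr0_norm q0) ler_pdivrMr.
have lnr i : ln (r i) = ln q + ln (1 + X i).
  have X1 : 0 < 1 + X i.
    by have := Xdl i; rewrite ler_norml => /andP[lo _]; move: lo dl2; clear; lra.
  rewrite rE -lnM ?posrE//; congr ln.
  by rewrite /X mulrDr mulr1 [q * _]mulrC divfK// gt_eqF.
rewrite !lnr.
have pX i : p i * (ln q + ln (1 + X i)) >= p i * ln q + p i * (X i - (1 / 2 + e) * X i ^+ 2).
  rewrite -mulrDr; apply: ler_wpM2l; first by have /andP[] := pB i.
  by rewrite lerD2l; exact: lnP.
have := lerD (lerD (pX i0) (pX i1)) (pX i2); apply: le_trans.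
have sumE (x0 x1 x2 l : R) : p i0 * l + p i0 * x0 + (p i1 * l + p i1 * x1) + (p i2 * l + p i2 * x2) =
  l * (p i0 + p i1 + p i2) + (p i0 * x0 + p i1 * x1 + p i2 * x2) by ring.
rewrite sumE pS mulr1 lerDl.
have subE (x0 x1 x2 y0 y1 y2 k : R) : p i0 * (x0 - k * y0) + p i1 * (x1 - k * y1) + p i2 * (x2 - k * y2) =
  p i0 * x0 + p i1 * x1 + p i2 * x2 - k * (p i0 * y0 + p i1 * y1 + p i2 * y2) by ring.
rewrite subE subr_ge0.
have EX : p i0 * X i0 + p i1 * X i1 + p i2 * X i2 = (a * m + rho) / q.
  have -> : a * m + rho = a * m + rho * (p i0 + p i1 + p i2) by rewrite pS mulr1.
  by rewrite /X mE; ring.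
have EX2 : p i0 * X i0 ^+ 2 + p i1 * X i1 ^+ 2 + p i2 * X i2 ^+ 2 =
    (a ^+ 2 * (p i0 * w i0 ^+ 2 + p i1 * w i1 ^+ 2 + p i2 * w i2 ^+ 2) + 2 * a * rho * m + rho ^+ 2) / q ^+ 2.
  have -> : rho ^+ 2 = rho ^+ 2 * (p i0 + p i1 + p i2) by rewrite pS mulr1.
  by rewrite /X mE; field; rewrite gt_eqF.
rewrite EX EX2.
have m0 : 0 <= m by apply: le_trans m1; rewrite mulr_ge0// addr_ge0// ltW.
have Bv0 : 0 <= B * v by exact: le_trans m2.
have pw i : p i * w i ^+ 2 <= (1 / 3 + e) * w i ^+ 2.
  by rewrite ler_wpM2r ?sqr_ge0//; have /andP[] := pB i.
(* Second moment. Half of its main term [4 / 3 * g ^+ 2 * v] equals [v] times the variance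
   [2 / 3 * g ^+ 2] in the first moment: the leading terms cancel, and [drift_quadratic] settles the
   rest. *)
have num2 : a ^+ 2 * (p i0 * w i0 ^+ 2 + p i1 * w i1 ^+ 2 + p i2 * w i2 ^+ 2) + 2 * a * rho * m + rho ^+ 2
   <= 4 * g ^+ 2 * ((1 / 3 + e) * v) + 4 * g * (B * v) * (2 * g * v + g ^+ 2) + (2 * g * v + g ^+ 2) ^+ 2.
  apply: lerD; last first.
    by rewrite -[rho ^+ 2]real_normK ?num_real// ler_sqr ?nnegrE// (le_trans _ rhoB).
  apply: lerD.
    apply: ler_pM; rewrite ?sqr_ge0//.
    - have pw0 i : 0 <= p i * w i ^+ 2 by rewrite mulr_ge0 ?sqr_ge0//; have /andP[] := pB i.
      by rewrite !addr_ge0.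
    - by rewrite vE !mulrDr; apply: lerD => //; apply: lerD.
  apply: le_trans (ler_norm _) _.
  rewrite (_ : 4 * g * (B * v) * (2 * g * v + g ^+ 2) = 2 * (2 * g) * (2 * g * v + g ^+ 2) * (B * v)); last by ring.
  apply: normM_le; last by rewrite ger0_norm.
  apply: normM_le => //; rewrite ger0_norm ?mulr_ge0// ler_pM2l//.
(* First moment: outward drift, plus the variance of the draw, minus the decrease of [K * s], which
   is at most [2 * K * g ^+ 2]. *)
have num1 : g * c * v + g ^+ 2 * (2 / 3 - 2 * K) <= a * m + rho.
  have am : a * ((1 + c) * v) <= a * m by rewrite ler_wpM2l.
  have gcv : 2 * (1 + c) * g * (g * v) <= c * (g * v) by rewrite ler_wpM2r.
  rewrite rhoE; move: am Kgs gcv g20 ggv; rewrite aE !expr2; clear; lra.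
have E10 : 0 <= g * c * v + g ^+ 2 * (2 / 3 - 2 * K).
  apply: addr_ge0; first by rewrite !mulr_ge0// ltW.
  by rewrite mulr_ge0//; move: K12; clear; lra.
have dq := drift_quadratic c0 B1 K0 Kc K12 e0 eK e1 gp ga gb gd v0.
rewrite mulrA ler_pdivrMr ?exprn_gt0//.
rewrite (_ : (a * m + rho) / q * q ^+ 2 = q * (a * m + rho)); last by field; rewrite gt_eqF.
have e2 : 0 <= 1 / 2 + e by move: e0; clear; lra.
apply: le_trans (ler_wpM2l e2 num2) _; apply: le_trans dq _.
by apply: ler_pM => //; exact: ltW.
Qed.
End LogDrift.

Lemma negligible_of_le (d : measure_display) (T : measurableType d) (R : realType)
    (P : probability T R) (N : set T) :
  (forall e : R, 0 < e -> exists H, [/\ measurable H, N `<=` H & (P H <= e%:E)%E]) ->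
  P.-negligible N.
Proof.
move=> h; have hk k : exists H, [/\ measurable H, N `<=` H & (P H <= (k.+1%:R^-1)%:E)%E].
  by apply: h; rewrite invr_gt0.
move: hk => /choice[H HP]; exists (\bigcap_k H k).
have mH : measurable (\bigcap_k H k) by apply: bigcap_measurable => // k _; have [] := HP k.
split=> //; last by move=> o No k _; have [_ + _] := HP k; apply.
apply/eqP; rewrite eq_le measure_ge0 andbT; apply/lee_addgt0Pr => e e0; rewrite add0e.
have ei0 : 0 <= e^-1 by rewrite invr_ge0 ltW.
have [mk _ Pk] := HP (Num.bound e^-1); apply: le_trans (le_trans _ Pk) _.
  by apply: le_measure; rewrite ?inE//; exact: bigcap_inf.
rewrite lee_fin -[leRHS]invrK lef_pV2 ?posrE ?invr_gt0//.
by apply: le_trans (ltW (archi_boundP ei0)) _; rewrite ler_nat.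
Qed.

(** * Noise and repulsion above the critical exponent *)

Section Noise.
Context (R : realType) (d : measure_display) (Omega : measurableType d).
Context (P : probability Omega R) (beta : R) (x0 : 'cV[nat]_3).
Context (x : nat -> Omega -> 'cV[nat]_3).
Context (Hx : urn_process P (cyclic_matrix R) beta x0 x).
Local Notation n0 := (ball_count x0).
Local Notation sh := (share (cyclic_matrix R) beta x0).

(** The martingale part of the proportion of colour [j], accumulated from draw [n] on; a late start
    makes its variance small. *)
Fixpoint noise (n : nat) (j : 'I_3) (w : seq 'I_3) : R :=
  if w is i :: w' then
    noise n j w' + (n <= size w')%N%:R * (gain R x0 w' * ((i == j)%:R - sh j w'))
  else 0.

(* [noise^2 + 1 / n] is a supermartingale, because [g^2 + 1 / (n + 1) <= 1 / n] for
   the gain [g = 1 / (n + 1)]. *)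
Lemma noise_negligible (j : 'I_3) (e : R) : 0 < e ->
  P.-negligible [set o | exists W, path_of x o W /\
    forall n, exists m, e <= `|noise n j (W m)|].
Proof.
move=> e0; have n0p := n0_gt0 Hx; have e20 : 0 < e ^+ 2 by rewrite exprn_gt0.
apply: negligible_of_le => a a0.
(* This start makes [M [::] <= a]. Before index [n] the noise has not begun, so [C] is frozen
   there. *)
pose n := Num.bound (a * e ^+ 2)^-1.
pose C (w : seq 'I_3) : R := (maxn (size w) n + n0)%N%:R^-1.
pose M w := (noise n j w ^+ 2 + C w) / e ^+ 2.
pose Bad w := 1 <= M w.
have C0 w : 0 <= C w by rewrite invr_ge0.
have M0 w : 0 <= M w by rewrite divr_ge0 ?addr_ge0 ?sqr_ge0// ltW.
have sm w : ~~ Bad w -> ~~ (fun=> false) w -> \sum_(i < 3) sh i w * M (i :: w) <= M w.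
  move=> _ _; have := share_sum beta n0p w; have s0 : 0 <= sh j w by exact: share_ge0.
  have [nw|nw] := leqP n (size w); last first.
    have E i : M (i :: w) = M w.
      by rewrite /M /= leqNgt nw mul0r addr0 /C /= !(maxn_idPr _)// ltnW.
    under eq_bigr do rewrite E.
    by rewrite -mulr_suml sum3 addrA => ->; rewrite mul1r.
  have ME i : M (i :: w) = ((noise n j w + gain R x0 w * ((i == j)%:R - sh j w)) ^+ 2 + gain R x0 w) / e ^+ 2.
    rewrite /M /= nw mul1r /C /= (maxn_idPl _) 1?leqW// /gain /total.
    by rewrite addSn natr1.
  under eq_bigr do rewrite ME.
  have CE : C w = (total R x0 w)^-1 by rewrite /C (maxn_idPl _).
  rewrite /M CE; set g := gain R x0 w; set D := noise n j w.
  rewrite [X in X -> _](_ : _ = (\sum_(i < 3) sh i w = 1)); last by rewrite sum3 addrA.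
  move=> S.
  have E : \sum_(i < 3) sh i w * (i == j)%:R = sh j w.
    rewrite (bigD1 j)//= eqxx mulr1 big1 ?addr0// => i /negbTE ->; exact: mulr0.
  have -> : \sum_(i < 3) sh i w * (((D + g * ((i == j)%:R - sh j w)) ^+ 2 + g) / e ^+ 2) =
     (D ^+ 2 + g ^+ 2 * (sh j w * (1 - sh j w)) + g) / e ^+ 2.
    rewrite (eq_bigr (fun i => ((D ^+ 2 - 2 * D * g * sh j w + g ^+ 2 * sh j w ^+ 2 + g) * sh i w
       + (2 * D * g + g ^+ 2 - 2 * g ^+ 2 * sh j w) * (sh i w * (i == j)%:R)) / e ^+ 2)).
      by rewrite -mulr_suml big_split/= -!mulr_sumr S E; congr (_ / _); ring.
    by move=> i _; rewrite mulrA; congr (_ / _); case: (i == j) => /=; ring.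
  rewrite ler_pM2r ?invr_gt0// -addrA lerD2l.
  have s1 : sh j w * (1 - sh j w) <= 1.
    by have := sqr_ge0 (sh j w - 1 / 2); rewrite expr2; lra.
  apply: (@le_trans _ _ (g ^+ 2 + g)); first by rewrite lerD2r ler_piMr// sqr_ge0.
  have t0 := total_gt0 R n0p w; rewrite /g /gain; move: (total R x0 w) t0 => T T0.
  rewrite -subr_ge0 (_ : T^-1 - _ = T^-1 * (T + 1)^-1 ^+ 2).
    by rewrite mulr_ge0 ?invr_ge0 ?sqr_ge0// ltW.
  by field; rewrite !gt_eqF// addr_gt0.
exists (hitting x Bad (fun=> false) [::]); split.
- exact: (measurable_hitting Hx).
- move=> o [W [pW h]]; have [m em] := h n.
  have [W0 _] := pW; rewrite -W0.
  apply: (path_hitting pW (k := m)) => //; rewrite add0n /Bad /M ler_pdivlMr// mul1r.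
  apply: ler_wpDr => //; rewrite -[leRHS]real_normK ?num_real//.
  by rewrite ler_sqr ?nnegrE// ltW.
- have MB w : Bad w -> 1 <= M w by [].
  apply: le_trans (hitting_le Hx M0 MB sm [::]) _.
  rewrite /= probability_setT mule1 lee_fin /M /= expr0n/= add0r /C /= max0n.
  have ae0 : 0 < a * e ^+ 2 by rewrite mulr_gt0.
  have nn0 : 0 < (n + n0)%N%:R :> R by rewrite ltr0n addn_gt0 n0p orbT.
  rewrite ler_pdivrMr// -[leRHS]invrK lef_pV2 ?posrE ?invr_gt0//.
  apply: le_trans (ltW (archi_boundP _)) _; first by rewrite invr_ge0 ltW.
  by rewrite ler_nat leq_addr.
Qed.

Lemma noise_shift o W n j k i : path_of x o W -> (n <= k)%N ->
  noise n j (W (k + i)%N) - noise n j (W k) = noise 0 j (W (k + i)%N) - noise 0 j (W k).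
Proof.
move=> pW nk; elim: i => [|i IH]; first by rewrite addn0 !subrr.
have sW := path_size (k + i) pW; rewrite addnS.
have [_ /(_ (k + i)%N)[[c ->] _]] := pW.
by rewrite /= sW (leq_trans nk (leq_addr _ _)) addrAC IH [RHS]addrAC.
Qed.

(** Almost surely some tail [noise n] stays below any given threshold. By [noise_shift], the
    increments of [noise 0] after [n] are then at most twice the threshold. *)
Lemma ae_noise : {ae P, forall o, forall W, path_of x o W -> forall j e, 0 < e ->
  exists n, forall k m, (n <= k <= m)%N -> `|noise 0 j (W m) - noise 0 j (W k)| <= e}.
Proof.
pose N j k := [set o | exists W, path_of x o W /\
    forall n, exists m, k.+1%:R^-1 <= `|noise n j (W m)|].
have neg : P.-negligible (\bigcup_k (N i0 k `|` (N i1 k `|` N i2 k))).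
  apply: negligible_bigcup => k; do 2?apply: negligibleU; apply: noise_negligible;
    by rewrite invr_gt0.
apply: negligibleS neg => o /= h; apply: contrapT => oN; apply: h => W pW j e e0.
have ei0 : 0 <= (e / 2)^-1 by rewrite invr_ge0 divr_ge0// ltW.
pose k := Num.bound (e / 2)^-1.
have ke : k.+1%:R^-1 <= e / 2.
  rewrite -[leRHS]invrK lef_pV2 ?posrE ?invr_gt0 ?divr_gt0//.
  by apply: le_trans (ltW (archi_boundP ei0)) _; rewrite ler_nat.
have {oN} : ~ N j k o.
  move=> Nj; apply: oN; exists k => //; move: j Nj.
  by apply: ord3P; [left | right; left | right; right].
move=> nN; have [n nP] : exists n, forall m, `|noise n j (W m)| < k.+1%:R^-1.
  apply: contrapT => h; apply: nN; exists W; split=> // n; apply: contrapT => h2.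
  by apply: h; exists n => m; rewrite ltNge; apply/negP => h3; apply: h2; exists m.
exists n => i m /andP[ni im]; rewrite -(subnKC im) -(noise_shift j _ pW ni) subnKC//.
apply: le_trans (ler_normB _ _) _; rewrite [leRHS](_ : e = e / 2 + e / 2); last by field.
by apply: lerD; apply: le_trans ke; exact: ltW.
Qed.
End Noise.

(** * The centre is almost surely not the limit *)

Section NonConvergence.
Context (R : realType) (d : measure_display) (Omega : measurableType d).
Context (P : probability Omega R) (beta : R) (x0 : 'cV[nat]_3).
Context (x : nat -> Omega -> 'cV[nat]_3).
Context (Hx : urn_process P (cyclic_matrix R) beta x0 x) (b4 : 4 < beta).
Local Notation n0 := (ball_count x0).
Local Notation sh := (share (cyclic_matrix R) beta x0).
Local Notation v := (dist2 R x0).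

Lemma dist2_le3 (n0p : (0 < n0)%N) w : v w <= 3.
Proof.
have p0 j : 0 <= prop R x0 j w by exact: prop_ge0.
have S : prop R x0 i0 w + prop R x0 i1 w + prop R x0 i2 w = 1 by exact: prop_sum.
have h j : prop R x0 j w <= 1 -> (prop R x0 j w - 1 / 3) ^+ 2 <= 1.
  move=> p1; rewrite -real_normK ?num_real// expr_le1// ler_norml.
  have := p0 j => p0j; apply/andP; split; lra.
have p1 j : prop R x0 j w <= 1.
  have := p0 i0; have := p0 i1; have := p0 i2; move: j S; apply: ord3P; lra.
rewrite /dist2; have := h _ (p1 i0); have := h _ (p1 i1); have := h _ (p1 i2); lra.
Qed.

Lemma ae_away_from_center : {ae P, forall o, forall W, path_of x o W ->
  ~ forall e, 0 < e -> exists N, forall n, (N <= n)%N -> v (W n) <= e}.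
Proof.
have n0p := n0_gt0 Hx; have bp : 0 < beta by apply: lt_trans b4.
pose c : R := (beta / 4 - 1) / 2; have c0 : 0 < c by have := b4; rewrite /c; lra.
have bE : beta / 4 = 1 + 2 * c by rewrite /c; field.
clearbody c.
pose B : R := beta / 4 + c; have B1 : 1 <= B by rewrite /B bE; lra.
have [K [e [g0 [[K0 K1 e0 g00] ldP]]]] := log_drift c0 B1.
have ce0 : 0 < Num.min c e by rewrite lt_min c0.
have [r [r0 rP]] := mean_dev_center n0p bp ce0.
pose N1 := Num.bound g0^-1.
have tp := total_gt0 R n0p.
have T1 w : 1 <= total R x0 w by rewrite ler1n addn_gt0 n0p orbT.
pose q w := v w + K / total R x0 w.
have q0 w : 0 < q w by rewrite ltr_wpDl ?dist2_ge0// divr_gt0.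
have q4 w : q w <= 4.
  have : K / total R x0 w <= 1 by rewrite ler_pdivrMr// mul1r (le_trans K1).
  by have := dist2_le3 n0p w; rewrite /q; lra.
(* The logarithmic drift is available near the centre and for small gains; all other words are
   dead. *)
pose Dead w := ~~ ((v w <= r) && (N1 <= size w)%N).
have drift w : ~~ Dead w -> ln (q w) <= \sum_(i < 3) sh i w * ln (q (i :: w)).
  rewrite negbK => /andP[vr Nw]; have [mu shP] := rP w vr.
  have gle : gain R x0 w <= g0.
    rewrite /gain -[leRHS]invrK lef_pV2 ?posrE ?invr_gt0 ?addr_gt0//.
    apply: le_trans (ltW (archi_boundP _)) _; first by rewrite invr_ge0 ltW.
    by rewrite /total natr1 ler_nat (leq_trans Nw)// leqW// leq_addr.
  have sg : (total R x0 w)^-1 * (1 - gain R x0 w) = gain R x0 w.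
    have t0 := tp w; rewrite /gain; move: (total R x0 w) t0 => T T0.
    by field; rewrite !gt_eqF// addr_gt0.
  have shB i : 0 <= sh i w <= 1 / 3 + e.
    rewrite share_ge0//= ; have := shP i; rewrite ler_norml le_min => /andP[_ /andP[_]].
    lra.
  have muB : (1 + c) * v w <= mean_dev x0 beta w <= B * v w.
    move: mu; rewrite ler_norml /B bE => /andP[lo up].
    have : Num.min c e * v w <= c * v w by rewrite ler_wpM2r ?dist2_ge0// ge_min lexx.
    move: (Num.min c e * v w) lo up => z lo up zc.
    rewrite !mulrDl -mulrA mul1r in lo up *.
    by move: (c * v w) lo up zc => z' *; apply/andP; split; lra.
  have [_] := ldP _ _ _ _ (fun i => prop R x0 i w - 1 / 3) (fun i => sh i w)
    (gain_gt0 R n0p w) gle sg erefl shB (share_sum beta n0p w) erefl muB.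
  have qc i : q (i :: w) = (1 - gain R x0 w) ^+ 2 * v w + 2 * gain R x0 w * (1 - gain R x0 w) *
     (prop R x0 i w - 1 / 3) + 2 / 3 * gain R x0 w ^+ 2 + K * gain R x0 w.
    by rewrite /q dist2_cons// total_cons.
  by rewrite sum3 !qc addrA.
(* A path to the centre is never dead after some word [w]; there are countably many choices of
   [w]. *)
pose N w := [set o | exists W, [/\ path_of x o W, W (size w) = w,
  forall n, (size w <= n)%N -> ~~ Dead (W n) & forall e, 0 < e -> exists N, forall n, (N <= n)%N -> v (W n) <= e]].
have neg : P.-negligible (\bigcup_w N w).
  apply: negligible_words => w; apply: negligible_of_le => eps eps0.
  pose a : R := (`|ln 4 - ln (q w)| + 1) / eps.
  have a0 : 0 < a by rewrite divr_gt0// ltr_wpDl.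
  (* [M] is nonnegative because [q <= 4]. A path to the centre has [q] tending to 0, so it meets
     [q <= 4 * expR (- a)], where [M >= 1]; and [a] is so large that [M w <= eps]. *)
  pose M w := (ln 4 - ln (q w)) / a; pose Bad w := 1 <= M w.
  have M0 u : 0 <= M u.
    by rewrite divr_ge0 ?(ltW a0)// subr_ge0 ler_ln ?posrE.
  have sm u : ~~ Bad u -> ~~ Dead u -> \sum_(i < 3) sh i u * M (i :: u) <= M u.
    move=> _ /drift; have := share_sum beta n0p u; rewrite !sum3 /M => S h.
    rewrite (_ : _ + _ = ((sh i0 u + sh i1 u + sh i2 u) * ln 4 - (sh i0 u * ln (q (i0 :: u)) +
      (sh i1 u * ln (q (i1 :: u)) + sh i2 u * ln (q (i2 :: u))))) / a); last by ring.
    by rewrite S mul1r ler_pM2r ?invr_gt0// lerD2l lerN2.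
  have MB u : Bad u -> 1 <= M u by [].
  exists (hitting x Bad Dead w); split.
  - exact: (measurable_hitting Hx).
  - move=> o [W [pW Ww nd cv]].
    pose z := 4 * expR (- a); have z0 : 0 < z / 2 by rewrite divr_gt0// mulr_gt0// expR_gt0.
    have [m mP] := cv _ z0; pose m2 := maxn (size w) (maxn m (Num.bound (z / 2)^-1)).
    have qz : q (W m2) <= z.
      rewrite /q (_ : z = z / 2 + z / 2); last by field.
      apply: lerD; first by apply: mP; rewrite !leq_max leqnn orbT.
      apply: (@le_trans _ _ (total R x0 (W m2))^-1).
        by rewrite ler_piMl// invr_ge0 ltW.
      rewrite -[leRHS]invrK lef_pV2 ?posrE ?invr_gt0//.
      apply: le_trans (ltW (archi_boundP _)) _; first by rewrite invr_ge0 ltW.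
      rewrite ler_nat (path_size _ pW); apply: leq_trans (leq_addr _ _).
      by rewrite !leq_max leqnn !orbT.
    have sm2 : (size w <= m2)%N by rewrite leq_maxl.
    rewrite -Ww; apply: (path_hitting pW (k := m2 - size w)).
      by move=> j _; apply: nd; exact: leq_addr.
    rewrite subnKC// /Bad /M ler_pdivlMr// mul1r lerBrDr -lerBrDl.
    apply: le_trans (_ : ln z <= _); first by rewrite ler_ln ?posrE// mulr_gt0// expR_gt0.
    by rewrite /z lnM ?posrE ?expR_gt0// expRK.
  - apply: le_trans (hitting_le Hx M0 MB sm w) _.
    apply: (@le_trans _ _ ((M w)%:E * 1)%E).
      by apply: lee_wpmul2l; rewrite ?lee_fin//; apply: probability_le1; exact: (measurable_cylinder Hx).
    rewrite mule1 lee_fin /M /a invf_div mulrA ler_pdivrMr; last by rewrite ltr_wpDl//; exact: ltr01.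
    rewrite mulrC ler_pM2l//; apply: le_trans (ler_norm _) _; by rewrite lerDl.
apply: negligibleS neg => o /= h; apply: contrapT => oN; apply: h => W pW cv.
have [m mP] := cv r r0; pose n := maxn m N1; apply: oN; exists (W n) => //.
exists W; split=> //; first by rewrite (path_size _ pW).
move=> k; rewrite (path_size _ pW) => nk; rewrite negbK (path_size _ pW).
rewrite mP/=; first by apply: leq_trans nk; rewrite leq_maxr.
by apply: leq_trans nk; rewrite leq_maxl.
Qed.
End NonConvergence.

(** * Limit sets *)

Section Clusters.
Context (R : realType).
Implicit Types (u : nat -> 'cV[R]_3) (l v : 'cV[R]_3).

(** Subsequential limits without extraction functions, which makes diagonal arguments direct; see
    [limit_setP]. *)
Definition cluster_point u l := forall (e : R) n1, 0 < e ->
  exists n, (n1 <= n)%N /\ `|u n - l| <= e.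

Lemma limit_setP u l : limit_set u l <-> cluster_point u l.
Proof.
split=> [[phi [phiM phil]] e n1 e0|cl].
  have [N NP] := (cvgn_epsilon _ _).1 phil e e0; exists (phi (maxn N n1)).
  have phi_ge n : (n <= phi n)%N.
    by elim: n => // n IH; apply: leq_ltn_trans IH (phiM _ _ _).
  split; first by apply: leq_trans (phi_ge _); exact: leq_maxr.
  exact: (NP _ (leq_maxl _ _)).
have : forall p : nat * nat, exists n, (p.1 < n)%N /\ `|u n - l| <= p.2.+1%:R^-1.
  by move=> p; have [|n] := cl p.2.+1%:R^-1 p.1.+1; [rewrite invr_gt0 | exists n].
move=> /choice[f fP]; pose phi := fix phi k := if k is k'.+1 then f (phi k', k) else f (0%N, 0%N).
have phiS n : (phi n < phi n.+1)%N by have [] := fP (phi n, n.+1).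
have phil n : `|u (phi n) - l| <= n.+1%:R^-1.
  by case: n => [|n]; [have [] := fP (0, 0)%N | have [] := fP (phi n, n.+1)].
exists phi; split.
  move=> m n; elim: n => // n IH; rewrite ltnS leq_eqVlt => /orP[/eqP ->//|/IH].
  by move=> /ltn_trans; apply.
apply/cvgn_epsilon => e e0; exists (Num.bound e^-1) => n nb.
apply: le_trans (phil n) _; rewrite -[leRHS]invrK lef_pV2 ?posrE ?invr_gt0//.
apply: le_trans (ltW (archi_boundP _)) _; first by rewrite invr_ge0 ltW.
by rewrite ler_nat leqW.
Qed.

Lemma norm_coord_le v i : `|v i 0| <= `|v|.
Proof. by have := norm_cV_le v (normr_ge0 v); rewrite lexx => /esym/forallP. Qed.

Lemma simplex_le1 v : simplex v -> forall i, 0 <= v i 0 <= 1.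
Proof.
move=> [v0 v1] i; rewrite v0/= -v1 (bigD1 i)//= lerDl sumr_ge0//.
Qed.

Lemma simplex_cluster u : (forall n, simplex (u n)) -> exists l, cluster_point u l.
Proof.
move=> uS; pose A := [set v : 'rV[R]_3 | forall i, `[0, 1]%classic (v ord0 i)].
have cA : compact A by apply: (@rV_compact R 3 (fun=> `[0, 1]%classic)) => i; exact: segment_compact.
pose G := (fun n => (u n)^T) @ \oo.
have GA : G A.
  exists 0%N => // n _ i; rewrite /= mxE in_itv/=; exact: simplex_le1 (uS n) i.
have [p [_ pc]] := cA G _ GA.
exists p^T => e n1 e0.
have := pc [set v | exists n, (n1 <= n)%N /\ v = (u n)^T] [set v | `|v^T - p^T| <= e].
case.
- by exists n1 => // n /= nn; exists n.
- apply/nbhs_ballP; exists e => //= v; rewrite /ball/= => pv.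
  rewrite norm_cV_le ?(ltW e0)//; apply/forallP => i; rewrite !mxE.
  by have [_ /(_ 0 i)] := pv; rewrite /ball/= distrC => /ltW.
- by move=> _ [[n [nn ->]]] /=; rewrite trmxK => h; exists n.
Qed.

Lemma cluster_closed (Z : set 'cV[R]_3) u l : closed Z -> (forall n, Z (u n)) ->
  cluster_point u l -> Z l.
Proof.
move=> cZ Zu cl; apply: cZ => B /nbhs_ballP[e /= e0 eB].
have [|n [_ nl]] := cl (e / 2) 0%N; first by rewrite divr_gt0.
exists (u n); split=> //; apply: eB; rewrite -ball_normE/= distrC.
by apply: le_lt_trans nl _; rewrite ltr_pdivrMr// ltr_pMr// ltrDl.
Qed.

Lemma simplex_cluster_closed u l : (forall n, simplex (u n)) -> cluster_point u l -> simplex l.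
Proof.
move=> uS cl.
have h (f : 'cV[R]_3 -> R) (K : R) : 0 < K -> (forall v, `|f v - f l| <= K * `|v - l|) ->
    (forall n, 0 <= f (u n)) -> 0 <= f l.
  move=> K0 fL f0; rewrite leNgt; apply/negP => fl.
  have [|n [_ nl]] := cl (- f l / (2 * K)) 0%N; first by rewrite divr_gt0 ?mulr_gt0// oppr_gt0.
  have := fL (u n); have := f0 n; have := ler_norm (f (u n) - f l).
  have : K * `|u n - l| <= - f l / 2.
    apply: le_trans (ler_wpM2l (ltW K0) nl) _; rewrite le_eqVlt; apply/orP; left.
    by apply/eqP; field; rewrite gt_eqF.
  lra.
have sumL v : `|\sum_i v i 0 - \sum_i l i 0| <= 3 * `|v - l|.
  have c i : `|v i 0 - l i 0| <= `|v - l| by have := norm_coord_le (v - l) i; rewrite !mxE.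
  rewrite -sumrB sum3 (_ : 3 * `|v - l| = `|v - l| + (`|v - l| + `|v - l|)); last by ring.
  apply: le_trans (ler_normD _ _) (lerD (c _) _).
  exact: le_trans (ler_normD _ _) (lerD (c _) (c _)).
split.
  move=> i; apply: (h (fun v => v i 0) 1) => // [v|n]; last by have [] := uS n.
  by rewrite mul1r; have := norm_coord_le (v - l) i; rewrite !mxE.
apply/eqP; rewrite eq_le; apply/andP; split; rewrite -subr_ge0.
  apply: (h (fun v => 1 - \sum_i v i 0) 3) => // [v|n]; last by have [_ ->] := uS n; rewrite subrr.
  by rewrite opprB addrC addrA subrK distrC.
apply: (h (fun v => \sum_i v i 0 - 1) 3) => // [v|n]; last by have [_ ->] := uS n; rewrite subrr.
by rewrite opprB addrA subrK.
Qed.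

Lemma cluster_trans u w l : (forall n, cluster_point u (w n)) -> cluster_point w l -> cluster_point u l.
Proof.
move=> uw wl e n1 e0; have e2 : 0 < e / 2 by rewrite divr_gt0.
have [n [_ nl]] := wl _ 0%N e2; have [m [mn mw]] := uw n _ n1 e2.
exists m; split=> //; rewrite -[_ - l](subrKA (w n)).
by apply: le_trans (ler_normD _ _) _; rewrite [leRHS](_ : e = e / 2 + e / 2); [exact: lerD | field].
Qed.

Lemma cluster_near u w l : (forall e, 0 < e -> exists N, forall n, (N <= n)%N -> `|w n - u n| <= e) ->
  cluster_point u l -> cluster_point w l.
Proof.
move=> uw ul e n1 e0; have e2 : 0 < e / 2 by rewrite divr_gt0.
have [N NP] := uw _ e2; have [n [nn nl]] := ul _ (maxn N n1) e2; exists n.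
move: nn; rewrite geq_max => /andP[Nn n1n]; split=> //; rewrite -[_ - l](subrKA (u n)).
apply: le_trans (ler_normD _ _) _; rewrite [leRHS](_ : e = e / 2 + e / 2); last by field.
by apply: lerD => //; exact: NP.
Qed.

Lemma invn_small (e : R) : 0 < e -> exists N, forall n, (N <= n)%N -> n.+1%:R^-1 <= e.
Proof.
move=> e0; exists (Num.bound e^-1) => n nb.
rewrite -[leRHS]invrK lef_pV2 ?posrE ?invr_gt0//.
apply: le_trans (ltW (archi_boundP _)) _; first by rewrite invr_ge0 ltW.
by rewrite ler_nat leqW.
Qed.

(** A relatively clopen part [B] and its complement [B'] in the limit set are a distance [e] apart
    by compactness. Late terms are within [e / 4] of the limit set and move by at most [e / 4], so
    once near [B] they remain near [B] and never approach a point of [B']. *)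
Lemma connected_limit_set u : (forall n, simplex (u n)) ->
  (forall e, 0 < e -> exists N, forall n, (N <= n)%N -> `|u n.+1 - u n| <= e) ->
  connected (limit_set u).
Proof.
move=> uS step B [p Bp] [U oU BU] [Z cZ BZ].
apply/seteqP; split; first by rewrite BU => v [].
move=> q qL; apply: contrapT => nBq.
have clB : forall w l, (forall n, B (w n)) -> cluster_point w l -> B l.
  move=> w l Bw wl; rewrite BZ; split.
    apply/limit_setP; apply: cluster_trans wl => n; apply/limit_setP.
    by have := Bw n; rewrite BU => -[].
  by apply: cluster_closed wl => // n; have := Bw n; rewrite BZ => -[].
pose B' := limit_set u `\` B.
have clB' : forall w l, (forall n, B' (w n)) -> cluster_point w l -> B' l.
  move=> w l Bw wl; split.
    by apply/limit_setP; apply: cluster_trans wl => n; apply/limit_setP; have [] := Bw n.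
  rewrite BU => -[_ Ul]; have : (~` U) l; last by [].
  apply: (cluster_closed _ _ wl); first exact: open_closedC.
  by move=> n Un; have [wL] := Bw n; apply; rewrite BU.
have [e e0 sep] : exists2 e : R, 0 < e & forall b c, B b -> B' c -> e <= `|b - c|.
  apply: contrapT => h.
  have : forall n : nat, exists bc : 'cV[R]_3 * 'cV[R]_3, [/\ B bc.1, B' bc.2 & `|bc.2 - bc.1| <= n.+1%:R^-1].
    move=> n; apply: contrapT => h2; apply: h; exists n.+1%:R^-1; first by rewrite invr_gt0.
    move=> b c Bb Bc; rewrite leNgt; apply/negP => lt; apply: h2; exists (b, c).
    by split=> //=; rewrite distrC ltW.
  move=> /choice[w wP].
  have [l wl] : exists l, cluster_point (fun n => (w n).1) l.
    apply: simplex_cluster => n; have [+ _ _] := wP n; rewrite BU => -[/limit_setP + _].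
    exact: simplex_cluster_closed.
  have Bl : B l by apply: clB wl => n; have [] := wP n.
  have [//] : B' l; apply: (clB' (fun n => (w n).2)); first by move=> n; have [] := wP n.
  apply: cluster_near wl => e /invn_small[N NP]; exists N => n /NP; apply: le_trans.
  by have [] := wP n.
have e4 : 0 < e / 4 by rewrite divr_gt0.
have [N near] : exists N, forall n, (N <= n)%N -> exists l, limit_set u l /\ `|u n - l| <= e / 4.
  apply: contrapT => h.
  have : forall N : nat, exists n, (N <= n)%N /\ forall l, limit_set u l -> e / 4 < `|u n - l|.
    move=> N; apply: contrapT => h2; apply: h; exists N => n Nn; apply: contrapT => h3.
    apply: h2; exists n; split=> // l ul; rewrite ltNge; apply/negP => le; apply: h3.
    by exists l.
  move=> /choice[f fP]; have [l fl] := simplex_cluster (fun n => uS (f n)).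
  have ul : limit_set u l.
    apply/limit_setP => e' n1 e'0; have [n [nn nl]] := fl _ n1 e'0; exists (f n).
    by split=> //; apply: leq_trans nn _; have [] := fP n.
  have [n [_]] := fl _ 0%N e4; have [_ /(_ _ ul)] := fP n.
  by move=> /lt_le_trans h1 /h1; rewrite ltxx.
have [N2 st] := step _ e4.
have far (a b c : 'cV[R]_3) : `|a - b| <= e / 4 -> `|a - c| <= e / 4 -> e <= `|b - c| -> False.
  rewrite distrC => h1 h2; rewrite -(subrKA a) => /le_trans/(_ (ler_normD _ _)).
  lra.
have far3 (a a' b c : 'cV[R]_3) : `|a' - a| <= e / 4 -> `|a - b| <= e / 4 -> `|a' - c| <= e / 4 -> e <= `|b - c| -> False.
  move=> h0; rewrite distrC => h1 h2; rewrite -(subrKA a) -[X in `|_ + X|](subrKA a').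
  move=> /le_trans/(_ (ler_normD _ _)) h3.
  have := ler_normD (a - a') (a' - c); rewrite distrC in h0; lra.
have pL : limit_set u p by move: Bp; rewrite BU => -[].
have [n [nn nl]] := (limit_setP _ _).1 pL _ (maxn N N2) e4.
have stay i : exists l, B l /\ `|u (n + i)%N - l| <= e / 4.
  elim: i => [|i [l [Bl ml]]]; first by exists p; rewrite addn0.
  rewrite addnS; have := leq_trans nn (leq_addr i n); move: (n + i)%N ml => m ml mN.
  have [l' [l'L ml']] := near m.+1 (leq_trans (leq_trans (leq_maxl _ _) mN) (leqnSn _)).
  exists l'; split=> //; apply: contrapT => nBl'.
  apply: (far3 (u m) (u m.+1) l l') => //; last by apply: sep.
  by apply: st; apply: leq_trans mN; rewrite leq_maxr.
have [m [nm mq]] := (limit_setP _ _).1 qL _ n e4.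
have [l [Bl ml]] := stay (m - n)%N; rewrite subnKC// in ml.
by apply: (far (u m) l q) => //; apply: sep.
Qed.
End Clusters.

(** * Bounds on the field over the simplex *)

Section CyclicField.
Context (R : realType) (beta : R) (beta1 : 1 <= beta).
Implicit Types v w : 'cV[R]_3.
Local Notation F := (urn_field (cyclic_matrix R) beta).

Lemma cV_subE v w i : (v - w) i 0 = v i 0 - w i 0.
Proof. by rewrite [LHS]mxE [X in _ + X]mxE. Qed.

Lemma cV_scaleE (a : R) v i : (a *: v) i 0 = a * v i 0.
Proof. by rewrite mxE. Qed.

Lemma urn_fieldE v i : F v i 0 = next_share beta v i - v i 0.
Proof. by rewrite -urn_shareE /urn_field cV_subE. Qed.

Lemma simplex3 v : simplex v -> [/\ 0 <= v i0 0, 0 <= v i1 0, 0 <= v i2 0 & v i0 0 + v i1 0 + v i2 0 = 1].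
Proof. by move=> [v0]; rewrite sum3 addrA. Qed.

Lemma next_share_simplex v i : simplex v -> 0 <= next_share beta v i <= 1.
Proof.
move=> /simplex3[a0 b0 c0 S]; rewrite /next_share.
have := pr_sum beta a0 b0 c0; rewrite S ltr01 => /(_ isT).
have := pr_ge0 beta (v i0 0) (v i1 0) (v i2 0); have := pr_ge0 beta (v i1 0) (v i2 0) (v i0 0).
have := pr_ge0 beta (v i2 0) (v i0 0) (v i1 0); rewrite /avg.
move: (pr _ _ _ _) (pr _ _ _ _) (pr _ _ _ _) => p q r p0 q0 r0 s.
by move: i; apply: ord3P => /=; apply/andP; split; lra.
Qed.

Lemma urn_field_le1 v : simplex v -> `|F v| <= 1.
Proof.
move=> vS; rewrite norm_cV_le//; apply/forallP => i; rewrite urn_fieldE ler_norml.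
have /andP[? ?] := next_share_simplex i vS; have /andP[? ?] := simplex_le1 vS i.
by apply/andP; split; lra.
Qed.

Lemma urn_field_lipschitz : exists K : R, 0 <= K /\ forall v w, simplex v -> simplex w ->
  `|F v - F w| <= K * `|v - w|.
Proof.
have [K [K0 KP]] := pr_lipschitz beta1; exists (3 * K + 1); split; first lra.
move=> v w vS wS; have [v0 v1 v2 vs] := simplex3 vS; have [w0 w1 w2 ws] := simplex3 wS.
have c i : `|v i 0 - w i 0| <= `|v - w| by have := norm_coord_le (v - w) i; rewrite !mxE.
have h0 := KP _ _ _ _ _ _ v0 v1 v2 vs w0 w1 w2 ws.
have h1 : `|pr beta (v i1 0) (v i2 0) (v i0 0) - pr beta (w i1 0) (w i2 0) (w i0 0)| <= K * (3 * `|v - w|).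
  apply: le_trans (KP _ _ _ _ _ _ v1 v2 v0 _ w1 w2 w0 _) _; [lra | lra |].
  by apply: ler_wpM2l => //; have := c i0; have := c i1; have := c i2; lra.
have h2 : `|pr beta (v i2 0) (v i0 0) (v i1 0) - pr beta (w i2 0) (w i0 0) (w i1 0)| <= K * (3 * `|v - w|).
  apply: le_trans (KP _ _ _ _ _ _ v2 v0 v1 _ w2 w0 w1 _) _; [lra | lra |].
  by apply: ler_wpM2l => //; have := c i0; have := c i1; have := c i2; lra.
have {}h0 : `|pr beta (v i0 0) (v i1 0) (v i2 0) - pr beta (w i0 0) (w i1 0) (w i2 0)| <= K * (3 * `|v - w|).
  apply: le_trans h0 _.
  by apply: ler_wpM2l => //; have := c i0; have := c i1; have := c i2; lra.
rewrite norm_cV_le; last by rewrite mulr_ge0//; lra.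
have av (p q p' q' z : R) : `|p - p'| <= z -> `|q - q'| <= z -> `|(p + q) / 2 - (p' + q') / 2| <= z.
  by rewrite !ler_norml => /andP[? ?] /andP[? ?]; apply/andP; split; lra.
apply/forallP => i; rewrite cV_subE !urn_fieldE (_ : _ - _ - _ = (next_share beta v i - next_share beta w i) - (v i 0 - w i 0)); last by ring.
rewrite mulrDl mul1r [3 * K]mulrC -mulrA; apply: normB_le => //.
by move: i; apply: ord3P; apply: av.
Qed.
End CyclicField.

(** * A periodic orbit through every limit point *)

Section Orbits.
Context (R : realType) (beta : R) (beta1 : 1 <= beta).
Local Notation F := (urn_field (cyclic_matrix R) beta).
Context (y : nat -> 'cV[R]_3) (t eta : nat -> R) (C dl : R) (n0 : nat).
Context (yS : forall n, simplex (y n)) (C1 : 1 <= C).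
Context (tmono : {homo t : k m / (k <= m)%N >-> k <= m}).
Context (tunb : forall A, exists k, A <= t k).
Context (tstep : forall e, 0 < e ->
  exists n1, forall k, (n1 <= k)%N -> t k.+1 - t k <= e).
Context (eta0 : forall e, 0 < e -> exists n1, forall k, (n1 <= k)%N -> eta k <= e).
Context (window : forall k m, (n0 <= k)%N -> (k <= m)%N -> t m - t k <= 1 ->
  `|y m - y k - (t m - t k) *: F (y k)| <= C * (t m - t k) ^+ 2 + eta k).
Context (dl0 : 0 < dl) (away : forall n, (n0 <= n)%N -> exists i, dl <= `|y n i 0 - 1 / 3|).

Lemma cluster_away l : cluster_point y l -> exists i, dl / 2 <= `|l i 0 - 1 / 3|.
Proof.
move=> cl; have d2 : 0 < dl / 2 by have := dl0; move=> h; rewrite divr_gt0.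
have [n [nn nl]] := cl _ n0 d2; have [i iP] := away nn; exists i.
have h := norm_coord_le (y n - l) i; rewrite !mxE in h.
rewrite -(subrKA (l i 0)) in iP; have := le_trans iP (ler_normD _ _); lra.
Qed.

Lemma rotation_field_gt0 (e : R) : 0 < e -> exists b : R, 0 < b /\ forall v : 'cV[R]_3, simplex v ->
  (exists i, e <= `|v i 0 - 1 / 3|) ->
  b <= (v i1 0 - 1 / 3) * F v i0 0 - (v i0 0 - 1 / 3) * F v i1 0.
Proof.
move=> e0; have [b [b0 bP]] := rotation_gt0 beta1 e0; exists b; split=> // v vS [i iP].
have [v0 v1 v2 vs] := simplex3 vS; rewrite !urn_fieldE; apply: bP => //.
by move: i iP; apply: ord3P; [left | right; left | right; right].
Qed.

(** Planar coordinates for [return_times]: the deviations of colours [i1] and [i0], in this order so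
    that the rotation is positive, in the orthogonal frame along [l]. The frame is not normalised,
    so [l] itself has coordinates [(L0, 0)]. The third colour is recovered from the sum, which gives
    the inverse bound [inv]. *)
Lemma limit_recurrence l : cluster_point y l -> exists Tmin Tmax : R, 0 < Tmin /\
  forall e n1, 0 < e -> exists n m, [/\ (n1 <= n <= m)%N, `|y n - l| <= e,
    `|y m - l| <= e & Tmin <= t m - t n <= Tmax].
Proof.
move=> cl; have lS := simplex_cluster_closed yS cl.
have [b [b0 bP]] := rotation_field_gt0 dl0.
have [K [K0 KP]] := urn_field_lipschitz beta1.
pose lx := l i1 0 - 1 / 3; pose ly := l i0 0 - 1 / 3; pose L0 := lx ^+ 2 + ly ^+ 2.
have L00 : 0 < L0.
  rewrite lt_neqAle addr_ge0 ?sqr_ge0// andbT eq_sym paddr_eq0 ?sqr_ge0// !sqrf_eq0.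
  apply/negP => /andP[/eqP x0 /eqP z0]; have [i iP] := cluster_away cl.
  have [_ _ _ ls] := simplex3 lS.
  have z2 : l i2 0 - 1 / 3 = 0 by rewrite /lx /ly in x0 z0; lra.
  have d2 : 0 < dl / 2 by have := dl0; move=> h; rewrite divr_gt0.
  by move: i iP; apply: ord3P; rewrite -?/lx -?/ly ?x0 ?z0 ?z2 normr0 leNgt d2.
have unit3 (v : 'cV[R]_3) i : simplex v -> `|v i 0 - 1 / 3| <= 1.
  by move=> vS; have /andP[? ?] := simplex_le1 vS i; rewrite ler_norml; apply/andP; split; lra.
have lx1 : `|lx| <= 1 by exact: unit3.
have ly1 : `|ly| <= 1 by exact: unit3.
pose rot (a c : R) : R := lx * a + ly * c; pose rot' (a c : R) : R := - ly * a + lx * c.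
have ly1' : `|- ly| <= 1 by rewrite normrN.
have rotB (a c z : R) : `|a| <= z -> `|c| <= z -> `|rot a c| <= 2 * z /\ `|rot' a c| <= 2 * z.
  move=> az cz; rewrite (_ : 2 * z = 1 * z + 1 * z); last by ring.
  by split; apply: normD_le; apply: normM_le.
pose X (v : 'cV[R]_3) : R := rot (v i1 0 - 1 / 3) (v i0 0 - 1 / 3); pose Y (v : 'cV[R]_3) : R := rot' (v i1 0 - 1 / 3) (v i0 0 - 1 / 3).
pose f (v : 'cV[R]_3) : R := rot (F v i1 0) (F v i0 0); pose g (v : 'cV[R]_3) : R := rot' (F v i1 0) (F v i0 0).
have inv (v w : 'cV[R]_3) : simplex v -> simplex w -> `|v - w| <= 2 / L0 * (`|X v - X w| + `|Y v - Y w|).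
  move=> /simplex3[_ _ _ vs] /simplex3[_ _ _ ws].
  set s := `|X v - X w| + _; have s0 : 0 <= s by rewrite addr_ge0.
  have L0n : L0 != 0 by rewrite gt_eqF.
  have e1 : v i1 0 - w i1 0 = (lx * (X v - X w) - ly * (Y v - Y w)) / L0.
    by rewrite /X /Y /rot /rot' -[LHS](mulfK L0n); congr (_ / _); rewrite {1}/L0; ring.
  have e2 : v i0 0 - w i0 0 = (ly * (X v - X w) + lx * (Y v - Y w)) / L0.
    by rewrite /X /Y /rot /rot' -[LHS](mulfK L0n); congr (_ / _); rewrite {1}/L0; ring.
  have n1 : `|v i1 0 - w i1 0| <= s / L0.
    rewrite e1 normrM normfV (gtr0_norm L00) ler_pM2r ?invr_gt0//.
    by apply: normB_le; rewrite -[leRHS]mul1r; apply: normM_le.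
  have n2 : `|v i0 0 - w i0 0| <= s / L0.
    rewrite e2 normrM normfV (gtr0_norm L00) ler_pM2r ?invr_gt0//.
    by apply: normD_le; rewrite -[leRHS]mul1r; apply: normM_le.
  have n3 : `|v i2 0 - w i2 0| <= s / L0 + s / L0.
    rewrite (_ : _ - _ = - (v i1 0 - w i1 0) - (v i0 0 - w i0 0)); last by lra.
    by apply: normB_le; rewrite ?normrN.
  have sL : 0 <= s / L0 by rewrite divr_ge0// ltW.
  rewrite (_ : 2 / L0 * s = s / L0 + s / L0); last by field.
  rewrite norm_cV_le ?addr_ge0//; apply/forallP => i; rewrite !mxE.
  by move: i; apply: ord3P => //; lra.
have Xl : X l = L0 by rewrite /X /rot -/lx -/ly /L0 !expr2.
have Yl : Y l = 0 by rewrite /Y /rot' -/lx -/ly mulNr mulrC addNr.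
have XYL (v w : 'cV[R]_3) : `|X v - X w| <= 2 * `|v - w| /\ `|Y v - Y w| <= 2 * `|v - w|.
  have -> : X v - X w = rot (v i1 0 - w i1 0) (v i0 0 - w i0 0) by rewrite /X /rot; ring.
  have -> : Y v - Y w = rot' (v i1 0 - w i1 0) (v i0 0 - w i0 0) by rewrite /Y /rot'; ring.
  by apply: rotB; [have := norm_coord_le (v - w) i1 | have := norm_coord_le (v - w) i0]; rewrite !mxE.
have fgL (v w : 'cV[R]_3) : simplex v -> simplex w ->
   `|f v - f w| <= 4 * K / L0 * (`|X v - X w| + `|Y v - Y w|) /\
   `|g v - g w| <= 4 * K / L0 * (`|X v - X w| + `|Y v - Y w|).
  move=> vS wS; have bnd : 2 * (K * `|v - w|) <= 4 * K / L0 * (`|X v - X w| + `|Y v - Y w|).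
    rewrite (_ : 4 * K / L0 * _ = 2 * (K * (2 / L0 * (`|X v - X w| + `|Y v - Y w|)))); last by field; rewrite gt_eqF.
    by rewrite ler_pM2l// ler_wpM2l// inv.
  have -> : f v - f w = rot ((F v - F w) i1 0) ((F v - F w) i0 0) by rewrite /f /rot !cV_subE; ring.
  have -> : g v - g w = rot' ((F v - F w) i1 0) ((F v - F w) i0 0) by rewrite /g /rot' !cV_subE; ring.
  have Kc i := le_trans (norm_coord_le (F v - F w) i) (KP _ _ vS wS).
  by have [h1 h2] := rotB _ _ _ (Kc i1) (Kc i0); split; apply: le_trans bnd.
have W0 k m (j : 'I_3) : (n0 <= k)%N -> (k <= m)%N -> t m - t k <= 1 ->
   `|y m j 0 - y k j 0 - (t m - t k) * F (y k) j 0| <= C * (t m - t k) ^+ 2 + eta k.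
  move=> nk km tm; have h := le_trans (norm_coord_le _ j) (window nk km tm).
  by rewrite 2!cV_subE cV_scaleE in h.
pose C2 := 2 * C; pose eta2 k := 2 * eta k.
have W2 : euler_window C2 t eta2 (X \o y) (f \o y) n0 /\ euler_window C2 t eta2 (Y \o y) (g \o y) n0.
  have h k m : (n0 <= k)%N -> (k <= m)%N -> t m - t k <= 1 -> 
     `|X (y m) - X (y k) - (t m - t k) * f (y k)| <= C2 * (t m - t k) ^+ 2 + eta2 k /\
     `|Y (y m) - Y (y k) - (t m - t k) * g (y k)| <= C2 * (t m - t k) ^+ 2 + eta2 k.
    move=> nk km tm; rewrite (_ : C2 * _ + _ = 2 * (C * (t m - t k) ^+ 2 + eta k)); last by rewrite /C2 /eta2; ring.
    have [h1 h2] := rotB _ _ _ (W0 k m i1 nk km tm) (W0 k m i0 nk km tm); split.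
      by apply: le_trans h1; rewrite le_eqVlt /X /f /rot; apply/orP; left; apply/eqP; congr (`|_|); ring.
    by apply: le_trans h2; rewrite le_eqVlt /Y /g /rot'; apply/orP; left; apply/eqP; congr (`|_|); ring.
  by split=> k m nk km tm; have [] := h k m nk km tm.
have Bp : 1 <= 2 :> R by lra.
have C2p : 1 <= C2 by have := C1; rewrite /C2; lra.
have K2p : 0 <= 4 * K / L0 by rewrite divr_ge0 ?mulr_ge0// ltW.
have XYB k : `|X (y k)| <= 2 /\ `|Y (y k)| <= 2.
  by have := rotB _ _ _ (unit3 _ i1 (yS k)) (unit3 _ i0 (yS k)); rewrite mulr1.
have fgB k : `|f (y k)| <= 2 /\ `|g (y k)| <= 2.
  have u i := le_trans (norm_coord_le (F (y k)) i) (urn_field_le1 beta (yS k)).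
  by have := rotB _ _ _ (u i1) (u i0); rewrite mulr1.
have cross n : (n0 <= n)%N -> L0 * b <= X (y n) * g (y n) - Y (y n) * f (y n).
  move=> nn; rewrite (_ : X _ * _ - _ = L0 * ((y n i1 0 - 1 / 3) * F (y n) i0 0 - (y n i0 0 - 1 / 3) * F (y n) i1 0)).
    by rewrite ler_pM2l//; apply: bP => //; exact: away.
  by rewrite /X /Y /f /g /rot /rot' /L0; ring.
have eta2P e : 0 < e -> exists n1, forall k, (n1 <= k)%N -> eta2 k <= e.
  move=> e0; have [|n1 nP] := eta0 (_ : 0 < e / 2); first by rewrite divr_gt0.
  by exists n1 => k /nP; rewrite /eta2; lra.
have [Tmin [Tmax [T0 ret]]] := return_times Bp C2p (mulr_gt0 L00 b0) K2p tmono tunb tstep eta2P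
  W2.1 W2.2 (fun k => (XYB k).1) (fun k => (XYB k).2) (fun k => (fgB k).1) (fun k => (fgB k).2)
  (fun n m => (fgL _ _ (yS n) (yS m)).1) (fun n m => (fgL _ _ (yS n) (yS m)).2) cross L00.
exists Tmin, Tmax; split=> // e n1 e0.
have near (v : 'cV[R]_3) (e' : R) : `|v - l| <= e' / 2 -> `|X v - L0| <= e' /\ `|Y v| <= e'.
  by move=> vl; rewrite -Xl -[Y v]subr0 -Yl; have [? ?] := XYL v l; split; lra.
have visits : forall (e : R) n1, 0 < e -> exists n, (n1 <= n)%N /\ near_axis (X \o y) (Y \o y) L0 e n.
  move=> e' n1' e'0; have [|n [nn nl]] := cl (e' / 2) n1'; first by rewrite divr_gt0.
  by exists n; split=> //; exact: near nl.
have e10 : 0 < e * L0 / 4 by rewrite divr_gt0// mulr_gt0.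
have back n : near_axis (X \o y) (Y \o y) L0 (e * L0 / 4) n -> `|y n - l| <= e.
  move=> [hX hY]; apply: le_trans (inv _ _ (yS n) lS) _; rewrite Xl Yl subr0.
  apply: (@le_trans _ _ (2 / L0 * (e * L0 / 4 + e * L0 / 4))).
    by apply: ler_wpM2l (lerD hX hY); rewrite divr_ge0// ltW.
  by rewrite le_eqVlt; apply/orP; left; apply/eqP; field; rewrite gt_eqF.
have [n [m [nm /back nl /back ml T]]] := ret visits _ n1 e10.
by exists n, m.
Qed.

Lemma cV_complete (u : nat -> 'cV[R]_3) :
  (forall e, 0 < e -> exists N, forall n m, (N <= n)%N -> (N <= m)%N -> `|u n - u m| <= e) ->
  exists l, forall e, 0 < e -> exists N, forall n, (N <= n)%N -> `|u n - l| <= e.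
Proof.
move=> cu; have /cauchy_cvg/cvg_ex[l ul] : cauchy (u @ \oo).
  apply: cauchy_exP => e e0; have [|N NP] := cu (e / 2); first by rewrite divr_gt0.
  exists (u N); exists N => // n /= Nn; rewrite -ball_normE/=.
  by apply: le_lt_trans (NP N n (leqnn N) Nn) _; rewrite ltr_pdivrMr// ltr_pMr// ltrDl.
by exists l; exact: (cvgn_epsilon u l).1.
Qed.

Lemma limit_orbit l : cluster_point y l -> exists gam : R -> 'cV[R]_3,
  [/\ trajectory (cyclic_matrix R) beta gam, exists2 T, 0 < T & forall s, gam (s + T) = gam s,
    exists s r, gam s <> gam r, gam 0 = l & forall s, cluster_point y (gam s)].
Proof.
move=> cl; have [Tmin [Tmax [T0 ret]]] := limit_recurrence cl.
have [K [K0 KP]] := urn_field_lipschitz beta1.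
have closedS l' : (forall e : R, 0 < e -> exists2 s : 'cV[R]_3, simplex s & `|s - l'| <= e) -> simplex l'.
  move=> h; have : forall n : nat, exists s : 'cV[R]_3, simplex s /\ `|s - l'| <= n.+1%:R^-1.
    by move=> n; have [|s] := h n.+1%:R^-1; [rewrite invr_gt0 | exists s].
  move=> /choice[s sP]; apply: (@simplex_cluster_closed _ s) => [n|e n1 e0]; first by have [] := sP n.
  have [N NP] := invn_small e0; exists (maxn N n1); rewrite leq_maxr; split=> //.
  by have [_ /le_trans] := sP (maxn N n1); apply; apply: NP; rewrite leq_maxl.
have [gam [T [Tp g0 gT gtr gcl]]] := periodic_trajectory (lexx 1) C1 K0 tmono tunb tstep eta0 window
  yS closedS (@urn_field_le1 _ beta) KP cV_complete cl T0 ret.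
exists gam; split=> //; first by exists T.
(* A constant trajectory would make [l] a zero of the field, against the positive angular velocity
   away from the centre. *)
apply: contrapT => const.
have gc : gam = cst l.
  by apply/funext => s; apply: contrapT => ne; apply: const; exists s, 0; rewrite g0.
have [_ [_]] := gtr 0; rewrite gc derive_cst /cst => F0.
have d2 : 0 < dl / 2 by have := dl0; move=> h; rewrite divr_gt0.
have [b [b0 /(_ l (simplex_cluster_closed yS cl) (cluster_away cl))]] := rotation_field_gt0 d2.
have F0i i : F l i 0 = 0 by rewrite -F0 mxE.
by rewrite !F0i !mulr0 subrr leNgt b0.
Qed.

Theorem limit_set_periodic : ~ cvgn y /\
  connected_union_of_periodic_orbits (cyclic_matrix R) beta (limit_set y).
Proof.
have [l cl] := simplex_cluster yS; split.
  move=> /cvg_ex[l' /cvgn_epsilon yl].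
  (* Convergence would leave a single limit point, but a whole nonconstant orbit consists of limit
     points. *)
  have uniq v : cluster_point y v -> v = l'.
    move=> cv; apply/eqP; rewrite -subr_eq0 -normr_le0; apply/ler_addgt0Pr => e e0.
    have e2 : 0 < e / 2 by rewrite divr_gt0.
    have [N NP] := yl _ e2; have [n [Nn nv]] := cv _ N e2; rewrite add0r.
    rewrite -(subrKA (y n)) [leRHS](_ : e = e / 2 + e / 2); last by field.
    by apply: normD_le; [rewrite distrC | exact: NP].
  have [gam [_ _ [s [r ne]] _ gcl]] := limit_orbit cl.
  by apply: ne; rewrite (uniq _ (gcl s)) (uniq _ (gcl r)).
have step (e : R) : 0 < e -> exists N, forall n, (N <= n)%N -> `|y n.+1 - y n| <= e.
  move=> e0; have C0 : 0 < C + 1 by have := C1; lra.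
  have d0 : 0 < Num.min 1 (e / 2 / (C + 1)) by rewrite lt_min ltr01/= !divr_gt0.
  have [N1 N1P] := tstep d0; have [|N2 N2P] := eta0 (_ : 0 < e / 2); first by rewrite divr_gt0.
  exists (maxn n0 (maxn N1 N2)) => n; rewrite !geq_max => /and3P[nn0 nN1 nN2].
  have := N1P n nN1; rewrite le_min => /andP[t1]; rewrite ler_pdivlMr// => te.
  have tp : 0 <= t n.+1 - t n by rewrite subr_ge0 tmono.
  have W := window nn0 (leqnSn n) t1; rewrite -[y _ - _](subrK ((t n.+1 - t n) *: F (y n))).
  have h : `|(t n.+1 - t n) *: F (y n)| <= (t n.+1 - t n) * 1.
    by rewrite normrZ (ger0_norm tp) ler_wpM2l// urn_field_le1.
  have sq : C * (t n.+1 - t n) ^+ 2 <= C * (t n.+1 - t n).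
    have C00 : 0 < C by have := C1; lra.
    by rewrite ler_pM2l// expr2 ler_piMl.
  have := N2P n nN2; have := le_trans (ler_normD _ _) (lerD W h).
  lra.
split; first exact: connected_limit_set.
(* All periodic orbits inside the limit set; by [limit_orbit] they cover it. *)
exists [set O | periodic_orbit (cyclic_matrix R) beta O /\ O `<=` limit_set y].
have orb v : limit_set y v -> exists O, [/\ periodic_orbit (cyclic_matrix R) beta O, O `<=` limit_set y & O v].
  move=> /limit_setP cv; have [gam [tr per nc g0 gcl]] := limit_orbit cv.
  exists (range gam); split; first by exists gam.
    by move=> _ [s _ <-]; apply/limit_setP.
  by exists 0.
split.
- by have [Z [pZ ZL _]] := orb _ ((limit_setP _ _).2 cl); exists Z.
- by move=> Z [].
- apply/seteqP; split=> v; last by move=> [Z [_ ZL] Zv]; exact: ZL.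
  by move=> /orb[Z [pZ ZL Zv]]; exists Z.
Qed.
End Orbits.

(** * The outward drift keeps the sequence away from the centre *)

Section Repulsion.
Context (R : realType) (beta : R) (b4 : 4 < beta).
Local Notation F := (urn_field (cyclic_matrix R) beta).
Context (y : nat -> 'cV[R]_3) (t eta : nat -> R) (C : R) (n0 : nat).
Context (yS : forall n, simplex (y n)) (C1 : 1 <= C).
Context (tmono : {homo t : k m / (k <= m)%N >-> k <= m}).
Context (tstep : forall e, 0 < e ->
  exists n1, forall k, (n1 <= k)%N -> t k.+1 - t k <= e).
Context (eta0 : forall e, 0 < e -> exists n1, forall k, (n1 <= k)%N -> eta k <= e).
Context (window : forall k m, (n0 <= k)%N -> (k <= m)%N -> t m - t k <= 1 ->
  `|y m - y k - (t m - t k) *: F (y k)| <= C * (t m - t k) ^+ 2 + eta k).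

Definition center_dist2 (v : 'cV[R]_3) : R :=
  (v i0 0 - 1 / 3) ^+ 2 + (v i1 0 - 1 / 3) ^+ 2 + (v i2 0 - 1 / 3) ^+ 2.
Local Notation V := center_dist2.

Lemma radial_drift : exists c r : R, [/\ 0 < c, 0 < r & forall v, simplex v -> V v <= r ->
  c * V v <= (v i0 0 - 1 / 3) * F v i0 0 + (v i1 0 - 1 / 3) * F v i1 0 + (v i2 0 - 1 / 3) * F v i2 0].
Proof.
pose c : R := (beta / 4 - 1) / 2; have c0 : 0 < c by have := b4; rewrite /c; lra.
have bp : 0 < beta by have := b4; lra.
have [r [r0 rP]] := drift_center bp c0; exists c, r; split=> // v /simplex3[_ _ _ S] vr.
have [+ _] := rP _ _ _ S vr; rewrite -!/(avg _ _ _ _) !urn_fieldE /next_share /= -/(V v).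
rewrite ler_norml => /andP[lo _].
have E : (v i0 0 - 1 / 3) * v i0 0 + (v i1 0 - 1 / 3) * v i1 0 + (v i2 0 - 1 / 3) * v i2 0 = V v.
  rewrite /V (_ : v i2 0 = 1 - v i0 0 - v i1 0); last by lra.
  by field.
have cE : beta / 4 * V v - c * V v = V v + c * V v by rewrite /c; field.
by move: lo cE; rewrite !mulrBr; move: E; move: (beta / 4 * V v) (c * V v) (V v) => *; lra.
Qed.

Lemma window_coord k m i : (n0 <= k)%N -> (k <= m)%N -> t m - t k <= 1 ->
  `|y m i 0 - y k i 0 - (t m - t k) * F (y k) i 0| <= C * (t m - t k) ^+ 2 + eta k.
Proof.
move=> nk km tm; have h := le_trans (norm_coord_le _ i) (window nk km tm).
by rewrite 2!cV_subE cV_scaleE in h.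
Qed.

Lemma dev_le1 n i : `|y n i 0 - 1 / 3| <= 1.
Proof.
by have /andP[? ?] := simplex_le1 (yS n) i; rewrite ler_norml; apply/andP; split; lra.
Qed.

Lemma center_dist2_variation k m : (n0 <= k)%N -> (k <= m)%N -> t m - t k <= 1 ->
  `|V (y m) - V (y k)| <= 6 * (t m - t k + (C * (t m - t k) ^+ 2 + eta k)).
Proof.
move=> nk km tm; have tp : 0 <= t m - t k by rewrite subr_ge0 tmono.
set D := t m - t k + _.
have z i : `|y m i 0 - y k i 0| <= D.
  rewrite -[X in `|X|](subrK ((t m - t k) * F (y k) i 0)) addrC; apply: normD_le.
    rewrite -[leRHS]mulr1; apply: normM_le; first by rewrite ger0_norm.
    exact: le_trans (norm_coord_le _ i) (urn_field_le1 beta (yS k)).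
  exact: window_coord.
have h i : `|(y m i 0 - 1 / 3) ^+ 2 - (y k i 0 - 1 / 3) ^+ 2| <= D * (1 + 1).
  rewrite subr_sqr opprB addrA subrK; apply: normM_le => //.
  by apply: normD_le; exact: dev_le1.
rewrite (_ : V (y m) - V (y k) = ((y m i0 0 - 1 / 3) ^+ 2 - (y k i0 0 - 1 / 3) ^+ 2) +
  ((y m i1 0 - 1 / 3) ^+ 2 - (y k i1 0 - 1 / 3) ^+ 2) +
  ((y m i2 0 - 1 / 3) ^+ 2 - (y k i2 0 - 1 / 3) ^+ 2)); last by rewrite /V; ring.
rewrite (_ : 6 * D = D * (1 + 1) + D * (1 + 1) + D * (1 + 1)); last by ring.
by do 2?apply: normD_le.
Qed.

(** Expand the squares at [y k]: the cross terms give the radial drift, and the squared displacement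
    is dropped as nonnegative. *)
Lemma center_dist2_growth c k m : (n0 <= k)%N -> (k <= m)%N -> t m - t k <= 1 ->
  c * V (y k) <= (y k i0 0 - 1 / 3) * F (y k) i0 0 + (y k i1 0 - 1 / 3) * F (y k) i1 0
    + (y k i2 0 - 1 / 3) * F (y k) i2 0 ->
  V (y k) + 2 * (t m - t k) * (c * V (y k)) - 6 * (C * (t m - t k) ^+ 2 + eta k) <= V (y m).
Proof.
move=> nk km tm dr; have tp : 0 <= t m - t k by rewrite subr_ge0 tmono.
set E := C * _ + _.
have h i : (y k i 0 - 1 / 3) ^+ 2 + 2 * (t m - t k) * ((y k i 0 - 1 / 3) * F (y k) i 0) - 2 * E
    <= (y m i 0 - 1 / 3) ^+ 2.
  have := normM_le (dev_le1 k i) (window_coord i nk km tm); rewrite [X in _ <= X -> _]mul1r -/E.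
  rewrite ler_norml => /andP[lo _].
  rewrite [leRHS](_ : _ = (y k i 0 - 1 / 3) ^+ 2 + 2 * (t m - t k) * ((y k i 0 - 1 / 3) * F (y k) i 0)
    + 2 * ((y k i 0 - 1 / 3) * (y m i 0 - y k i 0 - (t m - t k) * F (y k) i 0)) + (y m i 0 - y k i 0) ^+ 2); last by ring.
  rewrite -[leRHS]addrA lerD2l; apply: ler_wpDr; first exact: sqr_ge0.
  by move: lo; move: ((y k i 0 - 1 / 3) * _) => z lo; lra.
have h3 := lerD (lerD (h i0) (h i1)) (h i2); apply: le_trans h3.
have {}dr : 2 * (t m - t k) * (c * V (y k)) <= 2 * (t m - t k) * ((y k i0 0 - 1 / 3) * F (y k) i0 0) +
    2 * (t m - t k) * ((y k i1 0 - 1 / 3) * F (y k) i1 0) + 2 * (t m - t k) * ((y k i2 0 - 1 / 3) * F (y k) i2 0).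
  by rewrite -!mulrDr ler_wpM2l// mulr_ge0.
move: (2 * (t m - t k) * (c * V (y k))) dr => s; rewrite /V.
move: (2 * (t m - t k) * ((y k i0 0 - 1 / 3) * _)) (2 * (t m - t k) * ((y k i1 0 - 1 / 3) * _)) => p q.
move: (2 * (t m - t k) * ((y k i2 0 - 1 / 3) * _)) => p'.
move: (_ ^+ 2) (_ ^+ 2) (_ ^+ 2) => *; lra.
Qed.

(** Some late index has [V] above the level [e]. Over a block of duration between [h] and [2 * h] a
    value at least [e] stays so: by the radial drift if it is at most [r], and otherwise because
    [r >= 2 * e] and a block changes [V] by at most [e / 2]. Inside a block at most [e / 2] is
    lost. *)
Lemma repulsion : ~ (forall e, 0 < e -> exists N, forall n, (N <= n)%N -> V (y n) <= e) ->
  exists (dl : R) n1, [/\ 0 < dl, (n0 <= n1)%N & forall n, (n1 <= n)%N -> dl <= V (y n)].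
Proof.
move=> nc; have [c [r [c0 r0 crP]]] := radial_drift.
have [e1 [e10 e1P]] : exists e : R, 0 < e /\ forall N, exists n, (N <= n)%N /\ e < V (y n).
  apply: contrapT => h; apply: nc => e e0; apply: contrapT => h2; apply: h; exists e.
  split=> // N; apply: contrapT => h3; apply: h2; exists N => n Nn; rewrite leNgt.
  by apply/negP => h4; apply: h3; exists n.
have C0 : 0 < C by have := C1; lra.
pose e := Num.min e1 (r / 2); have e0 : 0 < e by rewrite lt_min e10 divr_gt0.
have er : 2 * e <= r by rewrite mulrC -ler_pdivlMr// ge_min lexx orbT.
have ee1 : e <= e1 by rewrite ge_min lexx.
clearbody e.
(* The third bound limits the variation over a block to [e / 2]. By the last one the quadratic Euler
   error takes at most half of the growth [2 * h * c * e]; the other half is left for [eta]. *)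
have [h [h0 h2 hv hg]] : exists h : R, [/\ 0 < h, 2 * h <= 1, (48 + 96 * C) * h <= e & 24 * C * h <= c * e].
  have p1 : 0 < 48 + 96 * C by lra.
  have p2 : 0 < 24 * C by lra.
  have p3 : 0 < c * e by rewrite mulr_gt0.
  exists (Num.min (1 / 2) (Num.min (e / (48 + 96 * C)) (c * e / (24 * C)))).
  split; first by rewrite !lt_min !divr_gt0.
  - by rewrite mulrC -ler_pdivlMr// !ge_min lexx ?orbT.
  - by rewrite mulrC -ler_pdivlMr// !ge_min lexx ?orbT.
  - by rewrite mulrC -ler_pdivlMr// !ge_min lexx ?orbT.
have ch0 : 0 < Num.min (e / 24) (c * h * e / 6) by rewrite lt_min !divr_gt0// !mulr_gt0.
have [N1 N1P] := eta0 ch0; have [N2 N2P] := tstep h0.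
have [n [nn ne]] := e1P (maxn n0 (maxn N1 N2)); move: nn; rewrite !geq_max => /and3P[nn0 nN1 nN2].
have etaP k : (n <= k)%N -> 24 * eta k <= e /\ 6 * eta k <= c * h * e.
  move=> nk; have := N1P k (leq_trans nN1 nk); rewrite le_min => /andP[]; lra.
have sq k m : (k <= m)%N -> t m - t k <= 2 * h -> C * (t m - t k) ^+ 2 <= 4 * (C * h ^+ 2).
  move=> km tm; rewrite (_ : 4 * (C * h ^+ 2) = C * (2 * h) ^+ 2); last by ring.
  have tp : 0 <= t m - t k by rewrite subr_ge0 tmono.
  by rewrite ler_pM2l// ler_sqr// nnegrE// mulr_ge0// ltW.
have hh : 24 * (C * h ^+ 2) <= h * (c * e).
  by rewrite (_ : 24 * (C * h ^+ 2) = h * (24 * C * h)); [rewrite ler_pM2l | ring].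
have hh1 : 2 * (C * h ^+ 2) <= C * h.
  rewrite mulrCA ler_pM2l// expr2 mulrCA -[leRHS]mulr1 ler_pM2l//.
have hv' : 48 * h + 96 * (C * h) <= e by move: hv; rewrite mulrDl mulrA.
have near k m : (n <= k)%N -> (k <= m)%N -> t m - t k <= 2 * h -> `|V (y m) - V (y k)| <= e / 2.
  move=> nk km tm; have [et _] := etaP k nk.
  have := center_dist2_variation (leq_trans nn0 nk) km (le_trans tm h2).
  have := sq k m km tm; move: (C * (t m - t k) ^+ 2) (C * h ^+ 2) (C * h) (mulr_gt0 C0 h0) hh1 hv' et tm.
  by clear; move=> *; lra.
have grow k m : (n <= k)%N -> (k <= m)%N -> h <= t m - t k -> t m - t k <= 2 * h -> e <= V (y k) -> e <= V (y m).
  move=> nk km th tm Vk; have [Vr|Vr] := leP (V (y k)) r; last first.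
    have := near k m nk km tm; rewrite ler_norml => /andP[lo _]; lra.
  have [_ et] := etaP k nk.
  have gr := center_dist2_growth (leq_trans nn0 nk) km (le_trans tm h2) (crP _ (yS k) Vr).
  apply: le_trans gr; have s1 := sq k m km tm.
  have s2 : 2 * h * (c * e) <= 2 * (t m - t k) * (c * V (y k)).
    apply: ler_pM; rewrite ?mulr_ge0 ?(ltW h0) ?(ltW c0) ?(ltW e0)//; last by rewrite ler_pM2l.
    by rewrite ler_pM2l.
  have ceh : c * h * e = h * (c * e) by ring.
  rewrite -[2 * h * _]mulrA in s2; rewrite ceh in et.
  move: (C * (t m - t k) ^+ 2) (2 * (t m - t k) * _) (h * (c * e)) (C * h ^+ 2) s1 s2 hh et Vk.
  by move: (V (y k)) (eta k); clear; move=> *; lra.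
have anchor i : exists k, [/\ (n <= k)%N, (k <= n + i)%N, e <= V (y k) & t (n + i)%N - t k <= 2 * h].
  elim: i => [|i [k [nk ki Vk tk]]].
    by exists n; rewrite addn0 subrr leqnn; split=> //; [apply: le_trans ee1 (ltW ne) | rewrite mulr_ge0// ltW].
  have st := N2P (n + i)%N (leq_trans nN2 (leq_addr _ _)); rewrite addnS.
  have [le2|gt2] := leP (t (n + i).+1 - t k) (2 * h); first by exists k; rewrite (leqW ki).
  exists (n + i)%N; rewrite leq_addr leqnSn; split=> //; last lra.
  apply: (grow k) => //; lra.
exists (e / 2), n; split=> //; first by rewrite divr_gt0.
move=> m nm; have [k [nk km Vk tk]] := anchor (m - n)%N; rewrite subnKC// in km tk.
have := near k m nk km tk; rewrite ler_norml => /andP[lo _]; lra.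
Qed.

Lemma center_dist2_coord (dl : R) n : dl <= V (y n) -> exists i, dl / 3 <= `|y n i 0 - 1 / 3|.
Proof.
move=> dV; have sq i : (y n i 0 - 1 / 3) ^+ 2 <= `|y n i 0 - 1 / 3|.
  by rewrite -real_normK ?num_real// expr2 ler_piMl// dev_le1.
have := sq i0; have := sq i1; have := sq i2.
have [h0|h0] := leP (dl / 3) `|y n i0 0 - 1 / 3|; first by exists i0.
have [h1|h1] := leP (dl / 3) `|y n i1 0 - 1 / 3|; first by exists i1.
have [h2|h2] := leP (dl / 3) `|y n i2 0 - 1 / 3|; first by exists i2.
by move: dV h0 h1 h2; rewrite /V; lra.
Qed.
End Repulsion.

(** [eta k] is the supremum of the oscillation after [k]. It is meaningful from [n0] on, where the
    oscillation is known to be bounded. *)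
Lemma tail_modulus (R : realType) (a : nat -> 'I_3 -> R) :
  (forall j e, 0 < e -> exists n, forall k m, (n <= k <= m)%N -> `|a m j - a k j| <= e) ->
  exists (eta : nat -> R) n0, [/\ forall k, (n0 <= k)%N -> 0 <= eta k,
    forall e, 0 < e -> exists n1, forall k, (n1 <= k)%N -> eta k <= e &
    forall k m j, (n0 <= k)%N -> (k <= m)%N -> `|a m j - a k j| <= eta k].
Proof.
move=> h; pose S k := [set z : R | exists m j, (k <= m)%N /\ z = `|a m j - a k j|].
have ub (e : R) : 0 < e -> exists n, forall k, (n <= k)%N -> ubound (S k) e.
  move=> e0; have [p pP] := h i0 e e0; have [q qP] := h i1 e e0; have [r rP] := h i2 e e0.
  exists (maxn p (maxn q r)) => k; rewrite !geq_max => /and3P[pk qk rk] _ [m [j [km ->]]].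
  by move: j; apply: ord3P; [apply: pP | apply: qP | apply: rP]; apply/andP.
have S0 k : S k 0 by exists k, i0; rewrite leqnn subrr normr0.
have [n0 nP] := ub 1 ltr01.
have hs k : (n0 <= k)%N -> has_sup (S k) by move=> nk; split; [exists 0 | exists 1; exact: nP].
exists (fun k => sup (S k)), n0; split.
- by move=> k nk; apply: sup_ubound => //; have [] := hs k nk.
- move=> e e0; have [n1 n1P] := ub e e0; exists n1 => k nk; apply: ge_sup; first by exists 0.
  exact: n1P.
- by move=> k m j nk km; apply: sup_ubound; [have [] := hs k nk | exists m, j].
Qed.

(** * The proportions shadow the flow on the harmonic clock *)

Section UrnLimit.
Context (R : realType) (d : measure_display) (Omega : measurableType d).
Context (P : probability Omega R) (beta : R) (x0 : 'cV[nat]_3).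
Context (x : nat -> Omega -> 'cV[nat]_3).
Context (Hx : urn_process P (cyclic_matrix R) beta x0 x) (b4 : 4 < beta).
Local Notation n0 := (ball_count x0).
Local Notation F := (urn_field (cyclic_matrix R) beta).

Lemma path_limit_set o W : path_of x o W ->
  (forall j e, 0 < e -> exists n, forall k m, (n <= k <= m)%N ->
    `|noise beta x0 0 j (W m) - noise beta x0 0 j (W k)| <= e) ->
  ~ (forall e, 0 < e -> exists N, forall n, (N <= n)%N -> dist2 R x0 (W n) <= e) ->
  let y n := prop_vec R x0 (W n) in
  ~ cvgn y /\ connected_union_of_periodic_orbits (cyclic_matrix R) beta (limit_set y).
Proof.
move=> pW cauchy_noise away y; have n0p := n0_gt0 Hx.
have b1 : 1 <= beta by have := b4; lra.
have yS n : simplex (y n).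
  split; first by move=> i; exact: prop_ge0.
  by rewrite sum3 addrA; exact: prop_sum.
pose t n : R := \sum_(k < n) (k + n0).+1%:R^-1.
have tS n : t n.+1 = t n + (n + n0).+1%:R^-1 by rewrite /t big_ord_recr.
have tmono : {homo t : k m / (k <= m)%N >-> k <= m}.
  move=> k m /subnKC <-; elim: (m - k)%N => [|i IH]; first by rewrite addn0.
  by rewrite addnS tS; apply: ler_wpDr IH; rewrite invr_ge0.
have tunb A : exists k, A <= t k by exact: harmonic_unbounded.
have tstep (e : R) : 0 < e -> exists n1, forall k, (n1 <= k)%N -> t k.+1 - t k <= e.
  move=> /invn_small[n1 nP]; exists n1 => k nk; rewrite tS addrAC subrr add0r.
  by apply: nP; rewrite (leq_trans nk)// leq_addr.
have [eta [n1 [eta_ge0 eta_lim etaP]]] := tail_modulus cauchy_noise.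
pose N m j : R := noise beta x0 0 j (W m).
(* Once the noise is subtracted, the proportions perform exact Euler steps of the field with
   harmonic step sizes. *)
have recur n j : y n.+1 j 0 - N n.+1 j = y n j 0 - N n j + (n + n0).+1%:R^-1 * F (y n) j 0.
  have sW := path_size n pW; have [_ /(_ n)[[i iE] _]] := pW.
  have gE : gain R x0 (W n) = (n + n0).+1%:R^-1 by rewrite /gain /total sW natr1.
  have -> : y n.+1 j 0 = y n j 0 + gain R x0 (W n) * ((i == j)%:R - y n j 0).
    by rewrite /y iE; exact: prop_cons.
  have -> : N n.+1 j = N n j + gain R x0 (W n) * ((i == j)%:R - share (cyclic_matrix R) beta x0 j (W n)).
    by rewrite /N iE /= mul1r.
  by rewrite gE urn_fieldE -share_next//; ring.
have {}away : ~ (forall e, 0 < e -> exists N, forall n, (N <= n)%N -> center_dist2 (y n) <= e) by [].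
clearbody y.
have [K [K0 KP]] := urn_field_lipschitz b1.
have sums k i j : y (k + i)%N j 0 - y k j 0 - (N (k + i)%N j - N k j)
   = \sum_(q < i) (k + q + n0).+1%:R^-1 * F (y (k + q)%N) j 0.
  elim: i => [|i IH]; first by rewrite big_ord0 addn0 !subrr.
  rewrite big_ord_recr/= -IH addnS; have := recur (k + i)%N j.
  move: (_ * F _ _ _) => z; move: (y _ _ _) (y _ _ _) (N _ _) (N _ _) => p q r s; lra.
have tsum k i : t (k + i)%N - t k = \sum_(q < i) (k + q + n0).+1%:R^-1.
  elim: i => [|i IH]; first by rewrite big_ord0 addn0 subrr.
  by rewrite big_ord_recr/= -IH addnS tS; ring.
have drift_sum k i (G : nat -> R) (z : R) : (forall q, (q < i)%N -> `|G q| <= z) ->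
   `|\sum_(q < i) (k + q + n0).+1%:R^-1 * G q| <= (t (k + i)%N - t k) * z.
  move=> Gz; rewrite tsum mulr_suml; apply: le_trans (ler_norm_sum _ _ _) _.
  apply: ler_sum => q _; rewrite normrM ger0_norm ?invr_ge0// ler_wpM2l ?invr_ge0//.
  exact: Gz.
have disp k m : (n1 <= k)%N -> (k <= m)%N -> `|y m - y k| <= t m - t k + eta k.
  move=> nk km; have tp : 0 <= t m - t k by rewrite subr_ge0 tmono.
  rewrite norm_cV_le; last exact: addr_ge0 tp (eta_ge0 k nk).
  apply/forallP => j; rewrite cV_subE.
  have nb := etaP k m j nk km; rewrite -/(N m j) -/(N k j) in nb.
  rewrite -[_ - _](subrK (N m j - N k j)); apply: normD_le => //.
  rewrite -(subnKC km) sums -[leRHS]mulr1.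
  apply: (drift_sum k (m - k)%N (fun q => F (y (k + q)%N) j 0)) => q _.
  exact: le_trans (norm_coord_le _ _) (urn_field_le1 beta (yS _)).
(* Within a window the field varies by at most [K * (t m - t k + eta k)]. As the duration is at most
   1, this and the noise oscillation [eta k] fit into the constant [K + 1]. *)
pose C := K + 1; pose eta' k := C * eta k.
have C1 : 1 <= C by rewrite lerDr.
have eta0 (e : R) : 0 < e -> exists n, forall k, (n <= k)%N -> eta' k <= e.
  move=> e0; have C0 : 0 < C by apply: lt_le_trans C1.
  have [|n nP] := eta_lim (e / C); first by rewrite divr_gt0.
  by exists n => k /nP; rewrite ler_pdivlMr// mulrC.
have window k m : (n1 <= k)%N -> (k <= m)%N -> t m - t k <= 1 ->
    `|y m - y k - (t m - t k) *: F (y k)| <= C * (t m - t k) ^+ 2 + eta' k.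
  move=> nk km; have [i mE] : exists i, (k + i)%N = m by exists (m - k)%N; rewrite subnKC.
  move=> tm; have tp : 0 <= t m - t k by rewrite subr_ge0 tmono.
  have e0 := eta_ge0 k nk.
  have bnd : (t m - t k) * (K * (t m - t k + eta k)) + eta k <= C * (t m - t k) ^+ 2 + eta' k.
    have : 0 <= K * eta k * (1 - (t m - t k)) by rewrite !mulr_ge0// subr_ge0.
    have := sqr_ge0 (t m - t k).
    by rewrite /eta' /C; move: (t m - t k) => T; rewrite expr2; lra.
  rewrite norm_cV_le; last first.
    by apply: le_trans bnd; exact: addr_ge0 (mulr_ge0 tp (mulr_ge0 K0 (addr_ge0 tp e0))) e0.
  apply/forallP => j; rewrite 2!cV_subE cV_scaleE; apply: le_trans bnd.
  have nb := etaP k m j nk km; rewrite -/(N m j) -/(N k j) in nb.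
  have -> : y m j 0 - y k j 0 - (t m - t k) * F (y k) j 0 =
     (y m j 0 - y k j 0 - (N m j - N k j) - (t m - t k) * F (y k) j 0) + (N m j - N k j) by ring.
  apply: normD_le => //.
  have -> : y m j 0 - y k j 0 - (N m j - N k j) - (t m - t k) * F (y k) j 0 =
      \sum_(q < i) (k + q + n0).+1%:R^-1 * (F (y (k + q)%N) j 0 - F (y k) j 0).
    rewrite -mE sums tsum mulr_suml -sumrB; apply: eq_bigr => q _; exact/esym/mulrBr.
  have -> : t m - t k = t (k + i)%N - t k by rewrite mE.
  apply: (drift_sum k i (fun q => F (y (k + q)%N) j 0 - F (y k) j 0)) => q qi.
  rewrite -cV_subE; apply: le_trans (norm_coord_le _ _) (le_trans (KP _ _ (yS _) (yS _)) _).
  apply: ler_wpM2l => //; apply: le_trans (disp _ _ nk (leq_addr _ _)) _.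
  by rewrite lerD2r lerD2r tmono// leq_add2l ltnW.
have [dl [n2 [dl0 n12 dlP]]] := repulsion b4 yS C1 tmono tstep eta0 window away.
apply: (@limit_set_periodic _ _ b1 y t eta' C (dl / 3) n2) => //.
- by move=> k m nk; apply: window; exact: leq_trans nk.
- by rewrite divr_gt0.
- by move=> n /dlP; exact: center_dist2_coord.
Qed.
End UrnLimit.

Theorem theorem1p2 (R : realType) (d : measure_display)
    (Omega : measurableType d) (P : probability Omega R) (beta : R)
    (x0 : 'cV[nat]_3) (x : nat -> Omega -> 'cV[nat]_3) :
  0 < beta ->
  urn_process P (cyclic_matrix R) beta x0 x ->
  (beta < 4 ->
     (0 < P [set w | (fun n => proportions x0 x n w) @ \oo -->
                     (const_mx (1 / 3)%R : 'cV[R]_3)])%E) /\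
  (4 < beta ->
     {ae P, forall w,
        ~ cvgn (fun n => proportions x0 x n w : 'cV[R]_3) /\
        let L : set 'cV[R]_3 := limit_set (fun n => proportions x0 x n w) in
        periodic_orbit (cyclic_matrix R) beta L \/
        connected_union_of_periodic_orbits (cyclic_matrix R) beta L}).
Proof.
move=> b0 Hx; split=> b4; first exact: (converges_with_positive_probability Hx b0 b4).
have n0p := n0_gt0 Hx.
have paths := ae_path Hx (fun w => etrans (sum3 _) (etrans (addrA _ _ _) (share_sum beta n0p w))).
apply: filterS3 paths (ae_noise Hx) (ae_away_from_center Hx b4) => o [W pW] noiseP awayP.
have [nc lim] := path_limit_set Hx b4 pW (noiseP W pW) (awayP W pW).
have E : (fun n => proportions x0 x n o : 'cV[R]_3) = fun n => prop_vec R x0 (W n).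
  by apply/funext => n; exact: (proportions_path Hx n pW).
by rewrite E; split=> //; right.
Qed.
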